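(* For $0<q<1$, let $\xi(x)$ denote the function (depending also on $q$) defined by $$\frac23[\xi(x)]^{3/2}=\frac{1}{\log(1/q)}\int_0^{\log(4x)}\arctan\sqrt{e^s-1}\,ds .$$ Then, for fixed $x>1/4$, the $q$-Airy function $A_q$ has the following asymptotic approximation $$A_q(\sqrt q\,x)\sim 2\sqrt{\pi}\,\exp\left\{\frac{3\log^2x-\pi^2}{12\log(1/q)}\right\}\left(\frac{\xi(x)}{4x-1}\right)^{1/4}\mathrm{Ai}(-\xi(x))$$ as $q\to1$.
   Context: Throughout $0<q<1$, so $q\to1$ means $q\to1^-$. Put $(q;q)_0=1$ and $(q;q)_k=\prod_{j=1}^{k}(1-q^j)$ for $k\ge1$. The $q$-Airy function (also called the Ramanujan function) is $$A_q(z)=\sum_{k=0}^\infty\frac{q^{k^2}}{(q;q)_k}(-z)^k .$$ $\mathrm{Ai}$ denotes the ordinary Airy function, $\log$ is the natural logarithm, $\log^2x=(\log x)^2$, and $x$ is real.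
   Formalization: Since Ai(-ξ(x)) has zeros at q accumulating at 1, ''∼'' is not read as ratio → 1: the difference of the two sides is shown to be o of the right-hand side with Ai(-ξ) replaced by its amplitude π^{-1/2}ξ^{-1/4}; ξ(x) is the positive root. *)

(* Defs.v *)
From Stdlib Require Import Reals Lra.
From Coquelicot Require Import Coquelicot.
Open Scope R_scope.

(* (q;q)_k *)
Fixpoint qpoch (q : R) (k : nat) : R :=
  match k with
  | O => 1
  | S j => qpoch q j * (1 - q ^ S j)
  end.

Definition qAiry (q z : R) : R :=
  Series (fun k => q ^ (k ^ 2)%nat / qpoch q k * (- z) ^ k).

(* The integral converges only conditionally; [RInt_gen] takes the limit of
   the proper integrals over [0, T] as T tends to +infinity. *)
Definition Ai (x : R) : R :=
  / PI * RInt_gen (fun t => cos (t ^ 3 / 3 + x * t))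
                  (at_point 0) (Rbar_locally p_infty).

(* Ai(-y) = Ai_env y * (sin (2/3 y^(3/2) + PI/4) + o(1)) as y tends to
   +infinity; in this limit Ai_env y is equivalent to the modulus
   sqrt (Ai(-y)^2 + Bi(-y)^2). *)
Definition Ai_env (y : R) : R := / sqrt PI * Rpower y (- (1 / 4)).

(* Asymptotic equivalence of oscillating functions.  [is_equiv F f g] is
   [is_domin F g (fun t => minus (g t) (f t))], which fails as soon as g has
   zeros, arbitrarily far along F, that are not zeros of f.  Here the error is
   instead compared with the amplitude E of the oscillation of g. *)
Definition is_equiv_env {T : Type} (F : (T -> Prop) -> Prop) (E f g : T -> R)
  : Prop :=
  is_domin F E (fun t => minus (g t) (f t)).

(* Rpower y a is the usual power only for y > 0; hence the condition
   0 < xi q x, which singles out the real root of the defining equation. *)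
Definition is_xi (xi : R -> R -> R) : Prop :=
  forall q x, 0 < q < 1 -> 1 / 4 < x ->
    0 < xi q x /\
    2 / 3 * Rpower (xi q x) (3 / 2) =
      1 / ln (1 / q) * RInt (fun s => atan (sqrt (exp s - 1))) 0 (ln (4 * x)).

Lemma is_xi_exists : exists xi, is_xi xi.
Proof.
exists (fun q x => Rpower (3 / 2 * (1 / ln (1 / q) *
  RInt (fun s => atan (sqrt (exp s - 1))) 0 (ln (4 * x)))) (2 / 3)).
intros q x [q0 q1] hx; split; [apply exp_pos|].
rewrite Rpower_mult; replace (2 / 3 * (3 / 2)) with 1 by field.
assert (Hl : 0 < ln (1 / q)).
{ rewrite <- ln_1; apply ln_increasing; [lra|].
  apply Rmult_lt_reg_r with q; [lra|]; field_simplify; lra. }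
assert (Hx : 0 < ln (4 * x)) by (rewrite <- ln_1; apply ln_increasing; lra).
rewrite Rpower_1; [field; lra|].
apply Rmult_lt_0_compat; [lra|]; apply Rmult_lt_0_compat.
{ apply Rdiv_lt_0_compat; lra. }
apply RInt_gt_0; [exact Hx| |].
- intros s [s0 _]; rewrite <- atan_0; apply atan_increasing, sqrt_lt_R0.
  generalize (exp_increasing 0 s s0); rewrite exp_0; lra.
- intros s _; apply continuous_comp.
  + apply (continuous_comp (fun s => exp s - 1) sqrt).
    * apply (continuous_minus exp (fun _ => 1)).
      -- apply continuous_exp.
      -- apply continuous_const.
    * apply continuous_sqrt.
  + apply continuous_atan.
Qed.

(* Main.v *)
(* Put e = log (1/q), theta = arctan sqrt (4x-1) and a = (log x)/2. Writing q^(k^2/2) as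
   the Fourier transform of a Gaussian turns the series into
     A_q(sqrt q x) = (2 pi e)^(-1/2) e^(a^2/(2e)) *
       int_R e^(-t^2/(2e)) Re (e^(-i a t/e) (q sqrt x e^(it); q)_oo) dt,
   and the real saddle points are t = theta and t = - theta.

   The modulus of the integrand is controlled at all t by its size at theta:
   ln (1 + y) <= y gives, with rho_k = sqrt x q^k,
     ln |(q sqrt x e^(it); q)_oo / (q sqrt x e^(i theta); q)_oo|
       <= (cos theta - cos t) sum_k rho_k / |1 - rho_k e^(i theta)|^2
       = (cos theta - cos t) theta / (e sin theta) + O(1),
   and (theta^2 - t^2)/2 + (cos theta - cos t) theta / sin theta <= - c (t - theta)^2 for
   t >= 0. Locally a second order expansion of each factor gives the Gaussian
   exp (- (1 - e^(2 i theta)) (t - theta)^2 / (2e)). The value at theta follows from the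
   trapezoid rule. The dilogarithm so produced is differentiated in sqrt (4x-1), and its
   constant - pi^2/12 comes from the derivative (pi - t)/2 in t of
   Re int_0^oo log (1 - e^(it) e^(-u)) du together with 1 - y + y^2 = (1 + y^3)/(1 + y).

   For Ai(-y) the line of integration is rotated by pi/4 about the saddle sqrt y, where
   the integrand becomes a perturbed real Gaussian. Contour shifts are Green's theorem
   for real integrals depending on a parameter. *)

Require Import Defs.
From Stdlib Require Import Reals Lra Lia Arith.
From Coquelicot Require Import Coquelicot.
Open Scope R_scope.

(** For fixed x, [xi q x] grows like (log (1/q))^(-2/3), so Ai is met only near minus infinity. The
    claim splits into two independent expansions: both sides are E (cos (pi/4 - Omega/e) + o(1))
    with the same amplitude E ([envelope]) and the same Omega ([airy_angle]).

    The infinite product itself never occurs. The expansion of the finite product (q w; q)_n is an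
    algebraic identity, so its Gaussian transform is taken term by term, and n tends to infinity at
    fixed q only at the end. The price is that every estimate must be uniform in n once exp (- n e)
    is small against a power of e.

    With m = sqrt (4x-1) the saddle is beta = sqrt x e^(i theta) = (1 + i m)/2. Since Re beta = 1/2,
    1 - beta is the conjugate of beta: log (1 - beta) has real part (log x)/2 and imaginary part -
    theta, which makes the boundary terms explicit. The integrand is even, so only t >= 0 is kept;
    with t = theta + r s and r = sqrt e this is s >= - theta / r. *)

Ltac cont2d :=
  match goal with
  | |- continuity_2d_pt (fun x y => ?c) _ _ => apply continuity_2d_pt_const
  | |- continuity_2d_pt (fun x y => x) _ _ => apply continuity_2d_pt_id1
  | |- continuity_2d_pt (fun x y => y) _ _ => apply continuity_2d_pt_id2
  | |- continuity_2d_pt (fun x y => @?f x y + @?g x y) _ _ =>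
      apply (continuity_2d_pt_plus f g); cont2d
  | |- continuity_2d_pt (fun x y => @?f x y - @?g x y) _ _ =>
      apply (continuity_2d_pt_minus f g); cont2d
  | |- continuity_2d_pt (fun x y => @?f x y * @?g x y) _ _ =>
      apply (continuity_2d_pt_mult f g); cont2d
  | |- continuity_2d_pt (fun x y => - @?f x y) _ _ =>
      apply (continuity_2d_pt_opp f); cont2d
  | |- continuity_2d_pt (fun x y => @?f x y / @?g x y) _ _ =>
      apply (continuity_2d_pt_mult f (fun x y => / g x y)); cont2d
  | |- continuity_2d_pt (fun x y => / @?f x y) _ _ =>
      apply (continuity_2d_pt_inv f); [cont2d |]
  | |- continuity_2d_pt (fun x y => ?h (@?f x y)) _ _ =>
      apply (continuity_1d_2d_pt_comp h f);
      [apply derivable_continuous_pt; reg | cont2d]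
  | |- continuity_2d_pt (fun x y => (@?f x y) ^ ?n) _ _ =>
      apply (continuity_1d_2d_pt_comp (fun z => z ^ n) f);
      [apply derivable_continuous_pt; reg | cont2d]
  | _ => idtac
  end.

(** Retypes an equality in the carrier of a normed module as one over R and generalises the
    integrals in it, so that [ring] and [field] apply. *)
Ltac toR :=
  match goal with |- @eq _ ?a ?b => change (@eq R a b) end;
  repeat match goal with |- context [RInt ?f ?a ?b] =>
    let I := fresh in set (I := RInt f a b : R); clearbody I end.

Ltac contd := apply (ex_derive_continuous (V := R_NormedModule)); auto_derive.

Ltac pos := first
  [ lra | apply exp_pos
  | first [ apply Rmult_lt_0_compat | apply Rdiv_lt_0_compat
          | apply Rinv_0_lt_compat | apply pow_lt | apply Rplus_lt_0_compat ]; pos ].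

(** * Real integrals: Green's theorem, linearity, Gaussian tails *)

Lemma ex_RInt_le_continuous (f : R -> R) (a b : R) : a <= b ->
  (forall t, a <= t <= b -> continuous f t) -> ex_RInt f a b.
Proof.
intros hab H; apply (ex_RInt_continuous (V := R_CompleteNormedModule)).
rewrite Rmin_left, Rmax_right by lra; exact H.
Qed.

Lemma ex_RInt_everywhere (f : R -> R) (a b : R) :
  (forall t, continuous f t) -> ex_RInt f a b.
Proof.
intros H; apply (ex_RInt_continuous (V := R_CompleteNormedModule)); auto.
Qed.


(* Green's theorem on a rectangle for the closed form u dt + v dc. *)
Lemma RInt_param_shift (u v w : R -> R -> R) (l h a' a b b' c0 c1 : R) :
  a' < a -> a <= b -> b < b' -> l < c0 < h -> l < c1 < h ->
  (forall c t, l < c < h -> a' < t < b' -> continuous (u c) t) ->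
  (forall c t, l < c < h -> a' < t < b' -> is_derive (fun c => u c t) c (w c t)) ->
  (forall c t, l < c < h -> a' < t < b' -> is_derive (v c) t (w c t)) ->
  (forall c t, l < c < h -> a' < t < b' -> continuity_2d_pt w c t) ->
  (forall c, l < c < h -> continuous (fun c => v c b - v c a) c) ->
  RInt (u c1) a b - RInt (u c0) a b = RInt (fun c => v c b - v c a) c0 c1.
Proof.
intros ha hab hb h0 h1 Hu Hc Ht Hw Hv.
assert (loc : forall l h c, l < c < h -> locally c (fun c' => l < c' < h)).
{ intros l' h' c hc; apply (open_and (fun c' => l' < c') (fun c' => c' < h'));
  [apply open_gt | apply open_lt | exact hc]. }
(* The c-derivative of u is w, which is also the t-derivative of v, so differentiating under the
   integral sign leaves the difference of v at the two ends. *)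
assert (D : forall c, l < c < h ->
  is_derive (fun c => RInt (u c) a b) c (v c b - v c a)).
{ intros c hc.
  replace (v c b - v c a) with (RInt (fun t => Derive (fun c' => u c' t) c) a b).
  - apply (is_derive_RInt_param u a b c).
    + generalize (loc l h c hc); apply filter_imp; intros c' hc' t ht.
      rewrite Rmin_left, Rmax_right in ht by lra.
      exists (w c' t); apply Hc; lra.
    + intros t ht; rewrite Rmin_left, Rmax_right in ht by lra.
      apply (continuity_2d_pt_ext_loc w); [|apply Hw; lra].
      destruct (loc l h c hc) as [d Hd].
      destruct (loc a' b' t) as [d' Hd']; [lra|].
      exists (mkposreal _ (Rmin_stable_in_posreal d d')); simpl; intros x y hx hy.
      symmetry; apply is_derive_unique, Hc.
      * apply Hd; apply Rlt_le_trans with (1 := hx), Rmin_l.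
      * apply Hd'; apply Rlt_le_trans with (1 := hy), Rmin_r.
    + generalize (loc l h c hc); apply filter_imp; intros c' hc'.
      apply ex_RInt_le_continuous; [lra|]; intros t ht; apply Hu; lra.
  - apply is_RInt_unique.
    apply is_RInt_ext with (fun t => w c t).
    { intros t; rewrite Rmin_left, Rmax_right by lra; intros ht.
      symmetry; apply is_derive_unique, Hc; lra. }
    apply (is_RInt_derive (v c) (fun t => w c t));
    intros t; rewrite Rmin_left, Rmax_right by lra; intros ht.
    + apply Ht; lra.
    + generalize (proj1 (continuity_2d_pt_filterlim w c t) (Hw c t hc ltac:(lra))).
      intros F P HP; specialize (F P HP).
      destruct F as [d Hd]; exists d; intros y Hy.
      apply (Hd (c, y)); split; [apply ball_center | exact Hy]. }
assert (inside : forall c, Rmin c0 c1 <= c <= Rmax c0 c1 -> l < c < h).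
{ intros c; unfold Rmin, Rmax; destruct (Rle_dec c0 c1); lra. }
symmetry; apply is_RInt_unique.
apply (is_RInt_derive (fun c => RInt (u c) a b)); intros c hc; auto.
Qed.

Lemma RInt_const_R (a b c : R) : RInt (fun _ => c) a b = (b - a) * c.
Proof. rewrite RInt_const; reflexivity. Qed.

Lemma RInt_abs_le (f g : R -> R) (a b : R) : a <= b ->
  ex_RInt f a b -> ex_RInt g a b ->
  (forall t, a < t < b -> Rabs (f t) <= g t) ->
  Rabs (RInt f a b) <= RInt g a b.
Proof.
intros hab hf hg H.
apply Rle_trans with (1 := abs_RInt_le f a b hab hf), RInt_le; auto.
apply (ex_RInt_norm f a b hf).
Qed.

Lemma RInt_minus_R (f g : R -> R) (a b : R) : ex_RInt f a b -> ex_RInt g a b ->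
  RInt (fun t => f t - g t) a b = RInt f a b - RInt g a b.
Proof. intros; apply (RInt_minus (V := R_CompleteNormedModule) f g); auto. Qed.

Lemma RInt_plus_R (f g : R -> R) (a b : R) : ex_RInt f a b -> ex_RInt g a b ->
  RInt (fun t => f t + g t) a b = RInt f a b + RInt g a b.
Proof. intros; apply (RInt_plus (V := R_CompleteNormedModule) f g); auto. Qed.

Lemma RInt_scal_R (f : R -> R) (k a b : R) : ex_RInt f a b ->
  RInt (fun t => k * f t) a b = k * RInt f a b.
Proof. intros; apply (RInt_scal (V := R_CompleteNormedModule) f); auto. Qed.

Lemma RInt_Chasles_R (f : R -> R) (a b c : R) : ex_RInt f a b -> ex_RInt f b c ->
  RInt f a c = RInt f a b + RInt f b c.
Proof. intros; symmetry; apply (RInt_Chasles (V := R_CompleteNormedModule) f); auto. Qed.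

Lemma RInt_swap_R (f : R -> R) (a b : R) : ex_RInt f b a ->
  RInt f a b = - RInt f b a.
Proof. intros; symmetry; apply (opp_RInt_swap (V := R_CompleteNormedModule)); auto. Qed.

Lemma RInt_substitution (f : R -> R) (u v a b : R) :
  ex_RInt f (u * a + v) (u * b + v) ->
  RInt f (u * a + v) (u * b + v) = u * RInt (fun y => f (u * y + v)) a b.
Proof.
intros H.
destruct (Req_dec u 0) as [->|hu].
{ rewrite !Rmult_0_l, !Rplus_0_l, RInt_point; unfold zero; simpl; ring. }
rewrite <- (RInt_comp_lin (V := R_CompleteNormedModule) f u v a b H).
rewrite (RInt_ext _ (fun y => u * f (u * y + v))); [|reflexivity].
apply RInt_scal_R.
apply ex_RInt_ext with (fun y => / u * (scal u (f (u * y + v)))).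
{ intros t _; unfold scal; simpl; unfold mult; simpl; field; exact hu. }
apply (ex_RInt_scal (V := R_NormedModule)).
apply (ex_RInt_comp_lin (V := R_NormedModule) f u v a b H).
Qed.

(* For t >= B the integrand is at most (t / B) K exp (- c t^2). *)
Lemma gauss_tail (f : R -> R) (K c B T : R) : 0 < K -> 0 < c -> 0 < B <= T ->
  (forall t, B <= t <= T -> continuous f t) ->
  (forall t, B <= t <= T -> Rabs (f t) <= K * exp (- c * t ^ 2)) ->
  Rabs (RInt f B T) <= K / (2 * c * B) * exp (- c * B ^ 2).
Proof.
intros hK hc hB Hf H.
assert (I : is_RInt (fun t => t / B * (K * exp (- c * t ^ 2))) B T
  (K / (2 * c * B) * exp (- c * B ^ 2) - K / (2 * c * B) * exp (- c * T ^ 2))).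
{ replace (_ - _) with (minus (- K / (2 * c * B) * exp (- c * T ^ 2))
      (- K / (2 * c * B) * exp (- c * B ^ 2)))
    by (unfold minus, plus, opp; simpl; field; lra).
  apply (is_RInt_derive (fun t => - K / (2 * c * B) * exp (- c * t ^ 2))).
  - intros t _; auto_derive; [trivial|]; simpl pow; field; lra.
  - intros t _; contd; trivial. }
apply Rle_trans with
  (K / (2 * c * B) * exp (- c * B ^ 2) - K / (2 * c * B) * exp (- c * T ^ 2)).
- rewrite <- (is_RInt_unique _ _ _ _ I); apply RInt_abs_le; try lra.
  + apply ex_RInt_le_continuous; [lra | auto].
  + eexists; exact I.
  + intros t ht; apply Rle_trans with (1 := H t ltac:(lra)).
    rewrite <- (Rmult_1_l (K * _)) at 1.
    apply Rmult_le_compat_r; [apply Rmult_le_pos; [lra | apply Rlt_le, exp_pos]|].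
    apply Rmult_le_reg_r with B; [lra|].
    unfold Rdiv; rewrite Rmult_assoc, Rinv_l by lra; lra.
- assert (0 < K / (2 * c * B) * exp (- c * T ^ 2)).
  { apply Rmult_lt_0_compat; [|apply exp_pos].
    apply Rdiv_lt_0_compat; [lra | apply Rmult_lt_0_compat; lra]. }
  lra.
Qed.

Lemma gauss_tail_neg (f : R -> R) (K c B A : R) : 0 < K -> 0 < c -> 0 < B <= A ->
  (forall t, - A <= t <= - B -> continuous f t) ->
  (forall t, - A <= t <= - B -> Rabs (f t) <= K * exp (- c * t ^ 2)) ->
  Rabs (RInt f (- A) (- B)) <= K / (2 * c * B) * exp (- c * B ^ 2).
Proof.
intros hK hc hB Hf H.
replace (- A) with (-1 * A + 0) by ring; replace (- B) with (-1 * B + 0) by ring.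
rewrite RInt_substitution.
2:{ apply ex_RInt_le_continuous; [lra|]; intros; apply Hf; lra. }
assert (C : forall t, B <= t <= A -> continuous (fun y => f (-1 * y + 0)) t).
{ intros t ht; apply (continuous_comp (fun y => -1 * y + 0) f).
  - contd; trivial.
  - apply Hf; lra. }
rewrite RInt_swap_R by (apply ex_RInt_le_continuous; [lra | exact C]).
assert (N : forall z : R, -1 * - z = z) by (intros; ring); rewrite N.
apply gauss_tail; auto.
intros t ht; rewrite (H (-1 * t + 0)) by lra.
right; f_equal; f_equal; ring.
Qed.

(** Laplace's method as a comparison: on [-B, B] the integrands differ by at most d, and outside
    both are below one Gaussian, which gives four tails. The bound does not involve A and T, so T
    may tend to infinity. *)
Lemma laplace_compare (f g : R -> R) (K c d B A T : R) : 0 < K -> 0 < c ->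
  0 < B <= A -> B <= T ->
  (forall t, - A <= t <= T -> continuous f t) ->
  (forall t, - A <= t <= T -> continuous g t) ->
  (forall t, - A <= t <= T -> Rabs (f t) <= K * exp (- c * t ^ 2)) ->
  (forall t, - A <= t <= T -> Rabs (g t) <= K * exp (- c * t ^ 2)) ->
  (forall t, - B <= t <= B -> Rabs (f t - g t) <= d) ->
  Rabs (RInt f (- A) T - RInt g (- A) T) <=
    2 * B * d + 2 * K / (c * B) * exp (- c * B ^ 2).
Proof.
intros hK hc hB hT Cf Cg Hf Hg Hd.
assert (E : forall (h : R -> R) a b, - A <= a -> a <= b -> b <= T ->
  (forall t, - A <= t <= T -> continuous h t) -> ex_RInt h a b).
{ intros h a b h1 h2 h3 C; apply ex_RInt_le_continuous; [lra|].
  intros; apply C; lra. }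
assert (S : forall h, (forall t, - A <= t <= T -> continuous h t) ->
  RInt h (- A) T = RInt h (- A) (- B) + RInt h (- B) B + RInt h B T).
{ intros h C; rewrite (RInt_Chasles_R h (- A) (- B) T), (RInt_Chasles_R h (- B) B T);
  try (apply E; trivial; lra); toR; ring. }
rewrite (S f Cf), (S g Cg).
assert (f1 := gauss_tail f K c B T hK hc ltac:(lra) ltac:(intros; apply Cf; lra)
  ltac:(intros; apply Hf; lra)).
assert (g1 := gauss_tail g K c B T hK hc ltac:(lra) ltac:(intros; apply Cg; lra)
  ltac:(intros; apply Hg; lra)).
assert (f2 := gauss_tail_neg f K c B A hK hc ltac:(lra) ltac:(intros; apply Cf; lra)
  ltac:(intros; apply Hf; lra)).
assert (g2 := gauss_tail_neg g K c B A hK hc ltac:(lra) ltac:(intros; apply Cg; lra)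
  ltac:(intros; apply Hg; lra)).
assert (m : Rabs (RInt f (- B) B - RInt g (- B) B) <= 2 * B * d).
{ rewrite <- RInt_minus_R by (apply E; trivial; lra).
  replace (2 * B) with (B - - B) by ring.
  apply abs_RInt_le_const; [lra| |exact Hd].
  apply (ex_RInt_minus (V := R_NormedModule)); apply E; trivial; lra. }
replace (2 * K / (c * B) * exp (- c * B ^ 2)) with
  (4 * (K / (2 * c * B) * exp (- c * B ^ 2))) by (field; lra).
revert f1 g1 f2 g2 m; unfold Rabs; repeat destruct Rcase_abs; lra.
Qed.

(** The end points may come in either order, because the parameter of a shift may move down as well
    as up. *)
Lemma RInt_abs_le_const (f : R -> R) (a b M : R) : ex_RInt f a b ->
  (forall t, Rmin a b <= t <= Rmax a b -> Rabs (f t) <= M) ->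
  Rabs (RInt f a b) <= Rabs (b - a) * M.
Proof.
intros E H; destruct (Rle_lt_dec a b) as [h|h].
- rewrite Rmin_left, Rmax_right in H by lra.
  rewrite (Rabs_pos_eq (b - a)) by lra; apply abs_RInt_le_const; auto.
- rewrite Rmin_right, Rmax_left in H by lra.
  rewrite RInt_swap_R by (apply ex_RInt_swap; exact E).
  rewrite Rabs_Ropp, (Rabs_left (b - a)) by lra; rewrite Ropp_minus_distr.
  apply abs_RInt_le_const; auto; [lra | apply ex_RInt_swap; exact E].
Qed.

(** * Gaussian integrals *)

Lemma exp_mono (a b : R) : a <= b -> exp a <= exp b.
Proof.
intros [h| ->]; [apply Rlt_le, exp_increasing, h | apply Rle_refl].
Qed.

Lemma is_derive_RInt_0 (f : R -> R) : (forall t, continuous f t) ->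
  forall t, is_derive (RInt f 0) t (f t).
Proof.
intros H t; apply (is_derive_RInt f (RInt f 0) 0 t); [|apply H].
exists (mkposreal 1 Rlt_0_1); intros y _.
apply (RInt_correct (V := R_CompleteNormedModule)), ex_RInt_everywhere, H.
Qed.

(** As a function of T the left side is constant, and at T = 0 it is arctan 1. The constancy is
    Green's theorem with T itself as the shift parameter c: the boundary term is the derivative of
    minus the squared Gaussian integral. *)
Lemma gauss_integral_sqr (T : R) : 0 < T ->
  (RInt (fun s => exp (- s ^ 2)) 0 T) ^ 2 +
  RInt (fun u => exp (- T ^ 2 * (1 + u ^ 2)) / (1 + u ^ 2)) 0 1 = PI / 4.
Proof.
intros hT; set (g := RInt (fun s => exp (- s ^ 2)) 0).
assert (pos : forall u, 0 < 1 + u ^ 2) by (intros; nra).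
assert (Dg : forall t, is_derive g t (exp (- t ^ 2))).
{ apply (is_derive_RInt_0 (fun s => exp (- s ^ 2))); intros; contd; trivial. }
assert (g0 : g 0 = 0) by apply (RInt_point (V := R_CompleteNormedModule)).
fold (g T); clearbody g.
assert (G := RInt_param_shift
  (fun c u => exp (- c ^ 2 * (1 + u ^ 2)) / (1 + u ^ 2))
  (fun c u => - 2 * exp (- c ^ 2) * g (c * u))
  (fun c u => - 2 * c * exp (- c ^ 2 * (1 + u ^ 2)))
  (-1) (T + 1) (-1) 0 1 2 0 T).
rewrite (RInt_ext (fun c => _ - _) (fun c => -2 * exp (- c ^ 2) * g c)) in G.
2:{ intros c _; rewrite Rmult_1_r, Rmult_0_r, g0; toR; ring. }
rewrite (is_RInt_unique (fun u => exp (- 0 ^ 2 * (1 + u ^ 2)) / (1 + u ^ 2)) 0 1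
  (PI / 4)) in G.
2:{ apply (is_RInt_ext (fun u => / (1 + u ^ 2))).
    { intros u _; replace (- 0 ^ 2 * (1 + u ^ 2)) with 0 by ring.
      rewrite exp_0; unfold Rdiv; toR; ring. }
    replace (PI / 4) with (minus (atan 1) (atan 0))
      by (rewrite atan_1, atan_0; unfold minus, plus, opp; simpl; ring).
    apply (is_RInt_derive atan (fun u => / (1 + u ^ 2))); intros u _.
    - auto_derive; [trivial | toR; simpl pow; field; specialize (pos u); lra].
    - contd; specialize (pos u); simpl in pos; lra. }
rewrite (is_RInt_unique (fun c => -2 * exp (- c ^ 2) * g c) 0 T (- g T ^ 2)) in G.
2:{ replace (- g T ^ 2) with (minus (- g T ^ 2) (- g 0 ^ 2)).
    2:{ rewrite g0; unfold minus, plus, opp, zero; simpl; ring. }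
    apply (is_RInt_derive (fun t => - g t ^ 2) (fun c => -2 * exp (- c ^ 2) * g c));
      intros t _.
    - auto_derive; [eexists; apply Dg|].
      replace (Derive (fun x : R => g x) t) with (exp (- t ^ 2))
        by (symmetry; apply is_derive_unique, Dg); simpl; ring.
    - contd; eexists; apply Dg. }
cut (RInt (fun u => exp (- T ^ 2 * (1 + u ^ 2)) / (1 + u ^ 2)) 0 1 - PI / 4 = - g T ^ 2).
{ simpl; lra. }
apply G; [lra | lra | lra | lra | lra | | | | |].
- intros c t _ _; contd; specialize (pos t); simpl in pos; lra.
- intros c t _ _; auto_derive; [trivial|]; toR.
  simpl pow; field; specialize (pos t); lra.
- intros c t _ _; auto_derive; [eexists; apply Dg|].
  replace (Derive (fun x : R => g x) (c * t)) with (exp (- (c * t) ^ 2))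
    by (symmetry; apply is_derive_unique, Dg).
  replace (- c ^ 2 * (1 + t ^ 2)) with (- c ^ 2 + - (c * t) ^ 2) by ring.
  rewrite exp_plus; simpl; ring.
- intros c t _ _; cont2d.
- intros c _; contd; repeat split; eexists; apply Dg.
Qed.

Lemma gauss_integral_bound (T : R) : 0 < T ->
  Rabs (RInt (fun s => exp (- s ^ 2)) 0 T - sqrt PI / 2) <= 2 * exp (- T ^ 2).
Proof.
intros hT; assert (S := gauss_integral_sqr T hT).
set (g := RInt _ 0 T) in *; set (h := RInt _ 0 1) in S.
assert (pos : forall u, 0 < 1 + u ^ 2) by (intros; nra).
assert (Eh : ex_RInt (fun u => exp (- T ^ 2 * (1 + u ^ 2)) / (1 + u ^ 2)) 0 1).
{ apply ex_RInt_everywhere; intros u; contd; specialize (pos u); simpl in pos; lra. }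
assert (h0 : Rabs h <= (1 - 0) * exp (- T ^ 2)).
{ apply abs_RInt_le_const; [lra | exact Eh |]; intros u hu.
  rewrite Rabs_pos_eq.
  2:{ apply Rlt_le, Rdiv_lt_0_compat; [apply exp_pos | apply pos]. }
  apply Rle_trans with (exp (- T ^ 2) / 1).
  - unfold Rdiv; apply Rmult_le_compat.
    + apply Rlt_le, exp_pos.
    + apply Rlt_le, Rinv_0_lt_compat, pos.
    + apply exp_mono; nra.
    + apply Rinv_le_contravar; nra.
  - unfold Rdiv; lra. }
assert (g0 : 0 <= g).
{ apply RInt_ge_0; [lra | apply ex_RInt_everywhere; intros; contd; trivial |].
  intros; apply Rlt_le, exp_pos. }
(* Makes the cofactor g + sqrt PI / 2 in the factorisation of g^2 - PI/4 at least 1/2; this is the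
   factor 2 of the bound. *)
assert (s1 : 1 <= sqrt PI).
{ rewrite <- sqrt_1; apply sqrt_le_1_alt; generalize PI2_1; lra. }
assert (s2 : sqrt PI * sqrt PI = PI) by (apply sqrt_sqrt; generalize PI_RGT_0; lra).
assert (E : (g - sqrt PI / 2) * (g + sqrt PI / 2) = - h) by nra.
assert (A : Rabs (g - sqrt PI / 2) * (g + sqrt PI / 2) = Rabs h).
{ rewrite <- (Rabs_pos_eq (g + sqrt PI / 2)) by lra.
  rewrite <- Rabs_mult, E; apply Rabs_Ropp. }
generalize (Rabs_pos (g - sqrt PI / 2)); nra.
Qed.

Lemma exp_inv_le (z : R) : 0 < z -> exp (- z) <= / z.
Proof.
intros hz; rewrite exp_Ropp; apply Rinv_le_contravar; [exact hz|].
generalize (exp_ineq1_le z); lra.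
Qed.

Lemma gauss_integral_scaled (p X : R) : 0 < p -> 0 < X ->
  Rabs (RInt (fun s => exp (- p * s ^ 2)) 0 X - sqrt (PI / p) / 2) <=
  2 / sqrt p * exp (- p * X ^ 2).
Proof.
intros hp hX; set (r := sqrt p).
assert (hr : 0 < r) by (apply sqrt_lt_R0, hp).
assert (rr : r * r = p) by (apply sqrt_sqrt; lra).
assert (C1 : forall t, continuous (fun s => exp (- s ^ 2)) t)
  by (intros; contd; trivial).
assert (B := gauss_integral_bound (r * X) ltac:(nra)).
rewrite <- (Rplus_0_r (r * X)) in B at 1.
rewrite <- (Rplus_0_r 0), <- (Rmult_0_r r) in B at 1.
rewrite RInt_substitution in B by (apply ex_RInt_everywhere; exact C1).
rewrite (RInt_ext _ (fun s => exp (- p * s ^ 2))) in B.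
2:{ intros s _; apply f_equal; rewrite <- rr; ring. }
rewrite sqrt_div_alt by lra; fold r.
replace (- p * X ^ 2) with (- (r * X) ^ 2) by (rewrite <- rr; ring).
set (I := RInt _ _ _) in *.
replace (I - sqrt PI / r / 2) with (/ r * (r * I - sqrt PI / 2)) by (field; lra).
rewrite Rabs_mult, (Rabs_pos_eq (/ r)) by (apply Rlt_le, Rinv_0_lt_compat, hr).
replace (2 / r) with (/ r * 2) by (unfold Rdiv; ring); rewrite Rmult_assoc.
apply Rmult_le_compat_l; [apply Rlt_le, Rinv_0_lt_compat, hr | exact B].
Qed.

Lemma gauss_integral_two_sided (p A T : R) : 0 < p -> 0 < A -> 0 < T ->
  Rabs (RInt (fun s => exp (- p * s ^ 2)) (- A) T - sqrt (PI / p)) <=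
  2 / sqrt p * (exp (- p * A ^ 2) + exp (- p * T ^ 2)).
Proof.
intros hp hA hT.
assert (C : forall q t, continuous (fun s => exp (- q * s ^ 2)) t)
  by (intros; contd; trivial).
rewrite (RInt_Chasles_R _ (- A) 0 T) by (apply ex_RInt_everywhere; auto).
replace (RInt (fun s => exp (- p * s ^ 2)) (- A) 0) with
  (RInt (fun s => exp (- p * s ^ 2)) 0 A).
2:{ assert (S := RInt_substitution (fun s => exp (- p * s ^ 2)) (-1) 0 A 0
      ltac:(apply ex_RInt_everywhere; auto)).
    replace (-1 * A + 0) with (- A) in S by ring.
    replace (-1 * 0 + 0) with 0 in S by ring.
    rewrite S, (RInt_ext (fun y => exp _) (fun s => exp (- p * s ^ 2)) A 0).
    - rewrite (RInt_swap_R _ A 0) by (apply ex_RInt_everywhere; auto); toR; ring.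
    - intros s _; apply f_equal; ring. }
assert (HA := gauss_integral_scaled p A hp hA).
assert (HT := gauss_integral_scaled p T hp hT).
rewrite Rmult_plus_distr_l; revert HA HT; unfold Rabs; repeat destruct Rcase_abs; lra.
Qed.

Lemma is_lim_of_Rinv_bound (f : R -> R) (L K : R) :
  (forall T, 1 < T -> Rabs (f T - L) <= K * / T) -> is_lim f p_infty L.
Proof.
intros bound.
assert (Z : is_lim (fun T => K * / T) p_infty 0).
{ replace (Finite 0) with (Rbar_mult K 0) by (simpl; f_equal; ring).
  apply is_lim_scal_l.
  apply (is_lim_inv (fun T => T) p_infty p_infty); [apply is_lim_id | discriminate]. }
apply (is_lim_le_le_loc (fun T => L - K * / T) (fun T => L + K * / T)).
- exists 1; intros T hT; generalize (bound T hT).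
  unfold Rabs; destruct Rcase_abs; lra.
- replace (Finite L) with (Finite (L - 0)) by (f_equal; ring).
  apply is_lim_minus'; [apply is_lim_const | exact Z].
- replace (Finite L) with (Finite (L + 0)) by (f_equal; ring).
  apply is_lim_plus'; [apply is_lim_const | exact Z].
Qed.

(** The line of integration is moved from c = 0 to c = b for exp (- (s - i c)^2 / 2), whose real
    part is exp ((c^2 - s^2)/2) cos (c s). The boundary term vanishes at s = 0 and is at most exp
    ((b^2 - T^2)/2) at s = T. *)
Lemma gauss_fourier (b : R) :
  is_lim (fun T => RInt (fun s => exp (- s ^ 2 / 2) * cos (b * s)) 0 T) p_infty
    (sqrt (2 * PI) / 2 * exp (- b ^ 2 / 2)).
Proof.
set (L := sqrt (2 * PI) / 2 * exp (- b ^ 2 / 2)).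
assert (bound : forall T, 1 < T ->
  Rabs (RInt (fun s => exp (- s ^ 2 / 2) * cos (b * s)) 0 T - L) <=
  (8 + 2 * Rabs b) * / T).
{ intros T hT; unfold L; set (l := Rmin 0 b - 1); set (h := Rmax 0 b + 1).
  assert (hl := Rmin_l 0 b); assert (hl' := Rmin_r 0 b).
  assert (hh := Rmax_l 0 b); assert (hh' := Rmax_r 0 b).
  assert (G := RInt_param_shift
    (fun c s => exp ((c ^ 2 - s ^ 2) / 2) * cos (c * s))
    (fun c s => exp ((c ^ 2 - s ^ 2) / 2) * sin (c * s))
    (fun c s => exp ((c ^ 2 - s ^ 2) / 2) * (c * cos (c * s) - s * sin (c * s)))
    l h (-1) 0 T (T + 1) 0 b).
  specialize (G ltac:(lra) ltac:(lra) ltac:(lra) ltac:(unfold l, h; lra)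
    ltac:(unfold l, h; lra)).
  rewrite (RInt_ext (fun s => exp ((b ^ 2 - s ^ 2) / 2) * cos (b * s))
    (fun s => exp (b ^ 2 / 2) * (exp (- s ^ 2 / 2) * cos (b * s)))) in G.
  2:{ intros s _; rewrite <- Rmult_assoc, <- exp_plus; toR.
      f_equal; f_equal; field. }
  rewrite RInt_scal_R in G by (apply ex_RInt_everywhere; intros; contd; trivial).
  rewrite (RInt_ext (fun s => exp ((0 ^ 2 - s ^ 2) / 2) * cos (0 * s))
    (fun s => exp (- (1 / 2) * s ^ 2))) in G.
  2:{ intros s _; rewrite Rmult_0_l, cos_0, Rmult_1_r; toR; f_equal; field. }
  set (I := RInt (fun s => exp (- s ^ 2 / 2) * cos (b * s)) 0 T) in *.
  set (J := RInt (fun s => exp (- (1 / 2) * s ^ 2)) 0 T) in *.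
  assert (HV : Rabs (exp (b ^ 2 / 2) * I - J) <=
    Rabs (b - 0) * (exp (b ^ 2 / 2) * exp (- (T ^ 2 / 2)))).
  { rewrite G.
    - apply RInt_abs_le_const.
      + apply ex_RInt_everywhere; intros; contd; trivial.
      + intros c hc.
        rewrite Rmult_0_r, sin_0, Rmult_0_r, Rminus_0_r, Rabs_mult.
        rewrite <- (Rmult_1_r (_ * exp _)); apply Rmult_le_compat.
        * apply Rabs_pos.
        * apply Rabs_pos.
        * rewrite Rabs_pos_eq by (apply Rlt_le, exp_pos).
          rewrite <- exp_plus; apply exp_mono.
          assert (Rabs c <= Rabs b).
          { revert hc; unfold Rmin, Rmax, Rabs; destruct (Rle_dec 0 b);
            repeat destruct Rcase_abs; lra. }
          assert (c ^ 2 <= b ^ 2).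
          { rewrite <- (pow2_abs c), <- (pow2_abs b).
            apply pow_incr; split; [apply Rabs_pos | assumption]. }
          lra.
        * apply Rabs_le, SIN_bound.
    - intros; contd; trivial.
    - intros; auto_derive; [trivial|]; toR; unfold Rminus, Rdiv; simpl pow; field.
    - intros; auto_derive; [trivial|]; toR; unfold Rminus, Rdiv; simpl pow; field.
    - intros; cont2d.
    - intros; contd; trivial. }
  assert (HJ := gauss_integral_scaled (1 / 2) T ltac:(lra) ltac:(lra)).
  fold J in HJ; clearbody I J.
  replace (PI / (1 / 2)) with (2 * PI) in HJ by field.
  set (e := exp (b ^ 2 / 2)) in *.
  replace (exp (- b ^ 2 / 2)) with (/ e)
    by (unfold e; rewrite <- exp_Ropp; f_equal; field).
  assert (he : 1 <= e) by (generalize (exp_ineq1_le (b ^ 2 / 2)); unfold e; nra).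
  assert (hT2 : exp (- (T ^ 2 / 2)) <= 2 / T).
  { apply Rle_trans with (1 := exp_inv_le (T ^ 2 / 2) ltac:(nra)).
    replace (/ (T ^ 2 / 2)) with (2 * / (T * T)) by (field; lra).
    unfold Rdiv; apply Rmult_le_compat_l; [lra|].
    apply Rinv_le_contravar; nra. }
  replace (- (1 / 2) * T ^ 2) with (- (T ^ 2 / 2)) in HJ by field.
  set (d := exp (- (T ^ 2 / 2))) in *.
  assert (hd : 0 < d) by apply exp_pos.
  assert (h2 : 2 / sqrt (1 / 2) <= 4).
  { assert (hs : 1 / 2 <= sqrt (1 / 2)).
    { rewrite <- (sqrt_square (1 / 2)) at 1 by lra; apply sqrt_le_1_alt; lra. }
    apply Rmult_le_reg_r with (sqrt (1 / 2)); [lra|].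
    unfold Rdiv at 1; rewrite Rmult_assoc, Rinv_l by lra; lra. }
  replace (I - sqrt (2 * PI) / 2 * / e) with
    (/ e * (e * I - J) + / e * (J - sqrt (2 * PI) / 2)) by (field; lra).
  assert (hi : 0 < / e <= 1).
  { split; [apply Rinv_0_lt_compat; lra|].
    rewrite <- Rinv_1; apply Rinv_le_contravar; lra. }
  apply Rle_trans with (1 := Rabs_triang _ _).
  rewrite !Rabs_mult, (Rabs_pos_eq (/ e)) by lra.
  rewrite Rminus_0_r in HV.
  assert (V1 : / e * Rabs (e * I - J) <= Rabs b * d).
  { apply Rmult_le_reg_l with e; [lra|].
    rewrite <- Rmult_assoc, Rinv_r, Rmult_1_l by lra; lra. }
  assert (V2 : / e * Rabs (J - sqrt (2 * PI) / 2) <= 1 * (4 * d)).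
  { apply Rmult_le_compat; [lra | apply Rabs_pos | lra |].
    apply Rle_trans with (1 := HJ), Rmult_le_compat_r; lra. }
  apply Rle_trans with ((4 + Rabs b) * d); [lra|].
  replace ((8 + 2 * Rabs b) * / T) with ((4 + Rabs b) * (2 / T)) by (field; lra).
  apply Rmult_le_compat_l; [generalize (Rabs_pos b); lra | exact hT2]. }
exact (is_lim_of_Rinv_bound _ L _ bound).
Qed.

Lemma mul_gauss_le (k X : R) : 0 < k -> 0 < X -> X * exp (- k * X ^ 2) <= / k * / X.
Proof.
intros hk hX.
assert (h := exp_inv_le (k * X ^ 2) ltac:(pos)).
replace (- k * X ^ 2) with (- (k * X ^ 2)) by ring.
apply Rle_trans with (X * / (k * X ^ 2)).
- apply Rmult_le_compat_l; lra.
- right; field; lra.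
Qed.

(* Rotating the line of integration by the angle c turns the complex Gaussian
   into a real one. *)
Lemma gauss_integral_rotated (rho psi alpha A T : R) :
  0 < rho -> Rabs psi < PI / 4 -> 1 <= A -> 1 <= T ->
  Rabs (RInt (fun t => exp (- (rho * cos (2 * psi) / 2) * t ^ 2) *
      cos (alpha + psi - rho * sin (2 * psi) / 2 * t ^ 2)) (- A) T -
    sqrt (2 * PI / rho) * cos alpha) <=
  (2 / (rho * cos (2 * psi)) + 8 / rho / sqrt (rho / 2)) * (/ A + / T).
Proof.
intros hr hpsi hA hT.
assert (pi1 := PI_4).
(* On every intermediate line the Gaussian decays at least as fast as on the final one, which makes
   the boundary terms small. *)
assert (cp : forall c, Rabs c <= Rabs psi -> cos (2 * psi) <= cos (2 * c)).
{ intros c hc.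
  assert (E : forall z, cos (2 * z) = cos (2 * Rabs z)).
  { intros z; unfold Rabs; destruct Rcase_abs; [|reflexivity].
    rewrite <- cos_neg; f_equal; ring. }
  rewrite (E c), (E psi); generalize (Rabs_pos c); intros.
  apply cos_decr_1; lra. }
assert (c0 : 0 < cos (2 * psi)).
{ apply cos_gt_0; revert hpsi; unfold Rabs; destruct Rcase_abs; lra. }
set (k := rho * cos (2 * psi) / 2).
assert (hk : 0 < k) by (unfold k; pos).
assert (G := RInt_param_shift
  (fun c t => exp (- (rho * cos (2 * c) / 2) * t ^ 2) *
      cos (alpha + c - rho * sin (2 * c) / 2 * t ^ 2))
  (fun c t => - t * (exp (- (rho * cos (2 * c) / 2) * t ^ 2) *
      sin (alpha + c - rho * sin (2 * c) / 2 * t ^ 2)))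
  (fun c t => exp (- (rho * cos (2 * c) / 2) * t ^ 2) *
      (rho * sin (2 * c) * t ^ 2 *
       cos (alpha + c - rho * sin (2 * c) / 2 * t ^ 2) -
       (1 - rho * cos (2 * c) * t ^ 2) *
       sin (alpha + c - rho * sin (2 * c) / 2 * t ^ 2)))
  (-2) 2 (- A - 1) (- A) T (T + 1) 0 psi).
assert (p2 : -2 < psi < 2) by (revert hpsi; unfold Rabs; destruct Rcase_abs; lra).
specialize (G ltac:(lra) ltac:(lra) ltac:(lra) ltac:(lra) p2).
rewrite (RInt_ext (fun t => exp (- (rho * cos (2 * 0) / 2) * t ^ 2) *
    cos (alpha + 0 - rho * sin (2 * 0) / 2 * t ^ 2))
  (fun t => cos alpha * exp (- (rho / 2) * t ^ 2))) in G.
2:{ intros t _; rewrite Rmult_0_r, cos_0, sin_0.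
    replace (alpha + 0 - rho * 0 / 2 * t ^ 2) with alpha by field.
    replace (rho * 1) with rho by ring; toR; ring. }
rewrite RInt_scal_R in G by (apply ex_RInt_everywhere; intros; contd; trivial).
fold k in G.
assert (gb := gauss_integral_two_sided (rho / 2) A T ltac:(lra) ltac:(lra) ltac:(lra)).
replace (PI / (rho / 2)) with (2 * PI / rho) in gb by (field; lra).
set (I := RInt (fun t => exp (- k * t ^ 2) *
  cos (alpha + psi - rho * sin (2 * psi) / 2 * t ^ 2)) (- A) T) in *.
set (J := RInt (fun s => exp (- (rho / 2) * s ^ 2)) (- A) T) in *.
assert (HV : Rabs (I - cos alpha * J) <= Rabs (psi - 0) * (/ k * (/ A + / T))).
{ rewrite G.
  - apply RInt_abs_le_const.
    + apply ex_RInt_everywhere; intros; contd; trivial.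
    + intros c hc.
      assert (cc : Rabs c <= Rabs psi).
      { revert hc; unfold Rmin, Rmax, Rabs; destruct (Rle_dec 0 psi);
        repeat destruct Rcase_abs; lra. }
      assert (V : forall X s, 1 <= X -> Rabs s <= 1 ->
        Rabs (X * (exp (- (rho * cos (2 * c) / 2) * X ^ 2) * s)) <= / k * / X).
      { intros X s hX hs.
        apply Rle_trans with (2 := mul_gauss_le k X hk ltac:(lra)).
        rewrite !Rabs_mult, (Rabs_pos_eq X), (Rabs_pos_eq (exp _))
          by (lra || apply Rlt_le, exp_pos).
        apply Rmult_le_compat_l; [lra|].
        rewrite <- (Rmult_1_r (exp (- k * X ^ 2))).
        apply Rmult_le_compat; [apply Rlt_le, exp_pos | apply Rabs_pos | | exact hs].
        apply exp_mono; unfold k; specialize (cp c cc).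
        assert (0 < X ^ 2) by nra; assert (rho * cos (2 * psi) <= rho * cos (2 * c)) by nra.
        nra. }
      rewrite (Rplus_comm (/ A)), Rmult_plus_distr_l.
      match goal with |- Rabs (- T * ?x - - - A * ?y) <= _ =>
        replace (- T * x - - - A * y) with (- (T * x + A * y)) by ring end.
      rewrite Rabs_Ropp; apply Rle_trans with (1 := Rabs_triang _ _).
      apply Rplus_le_compat.
      * apply V; [lra | apply Rabs_le, SIN_bound].
      * replace ((- A) ^ 2) with (A ^ 2) by ring.
        apply V; [lra | apply Rabs_le, SIN_bound].
  - intros; contd; trivial.
  - intros; auto_derive; [trivial|]; toR; unfold Rminus, Rdiv; simpl pow; field.
  - intros; auto_derive; [trivial|]; toR; unfold Rminus, Rdiv; simpl pow; field.
  - intros; cont2d.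
  - intros; contd; trivial. }
clearbody I J.
assert (ps : Rabs (psi - 0) <= 1) by (rewrite Rminus_0_r; lra).
assert (iA : 0 < / A) by (apply Rinv_0_lt_compat; lra).
assert (iT : 0 < / T) by (apply Rinv_0_lt_compat; lra).
assert (ik : 0 < / k) by (apply Rinv_0_lt_compat; lra).
assert (HV' : Rabs (I - cos alpha * J) <= / k * (/ A + / T)).
{ apply Rle_trans with (1 := HV); rewrite <- Rmult_1_l.
  apply Rmult_le_compat_r; [nra | exact ps]. }
assert (hs : 0 < sqrt (rho / 2)) by (apply sqrt_lt_R0; lra).
assert (gt : forall X, 1 <= X -> exp (- (rho / 2) * X ^ 2) <= 2 / rho * / X).
{ intros X hX; replace (- (rho / 2) * X ^ 2) with (- (rho / 2 * X ^ 2)) by ring.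
  apply Rle_trans with (1 := exp_inv_le (rho / 2 * X ^ 2) ltac:(pos)).
  replace (2 / rho * / X) with (/ (rho / 2 * X)) by (field; lra).
  apply Rinv_le_contravar; [pos|].
  apply Rmult_le_compat_l; [lra|]; nra. }
assert (HJ : Rabs (cos alpha * J - sqrt (2 * PI / rho) * cos alpha) <=
  8 / rho / sqrt (rho / 2) * (/ A + / T)).
{ replace (cos alpha * J - sqrt (2 * PI / rho) * cos alpha) with
    ((J - sqrt (2 * PI / rho)) * cos alpha) by ring.
  rewrite Rabs_mult, <- (Rmult_1_r (8 / _ / _ * _)).
  apply Rmult_le_compat; [apply Rabs_pos | apply Rabs_pos | |
    apply Rabs_le, COS_bound].
  apply Rle_trans with (1 := gb).
  replace (8 / rho / sqrt (rho / 2) * (/ A + / T)) with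
    (2 / sqrt (rho / 2) * (2 * (2 / rho * / A) + 2 * (2 / rho * / T)))
    by (field; repeat split; lra).
  apply Rmult_le_compat_l; [apply Rlt_le, Rdiv_lt_0_compat; lra|].
  assert (a1 := gt A hA); assert (a2 := gt T hT).
  assert (0 < 2 / rho) by (apply Rdiv_lt_0_compat; lra).
  nra. }
replace (2 / (rho * cos (2 * psi))) with (/ k) by (unfold k; field; lra).
rewrite Rmult_plus_distr_r.
apply Rle_trans with (2 := Rplus_le_compat _ _ _ _ HV' HJ).
replace (I - _) with ((I - cos alpha * J) + (cos alpha * J - sqrt (2 * PI / rho) * cos alpha))
  by ring.
apply Rabs_triang.
Qed.

(** * The Airy function on the negative axis *)

Lemma gauss_ex_lim (f : R -> R) (a K c : R) : 0 < K -> 0 < c ->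
  (forall t, a <= t -> continuous f t) ->
  (forall t, a <= t -> Rabs (f t) <= K * exp (- c * t ^ 2)) ->
  exists l : R, is_lim (RInt f a) p_infty l.
Proof.
intros hK hc C H.
apply (proj1 (filterlim_locally_cauchy (F := Rbar_locally p_infty) (RInt f a))).
intros [eps heps].
set (B := Rmax (Rmax 1 a) (K / c / eps)).
assert (B1 : 1 <= B) by (apply Rle_trans with (2 := Rmax_l _ _), Rmax_l).
assert (Ba : a <= B) by (apply Rle_trans with (2 := Rmax_l _ _), Rmax_r).
assert (Be : K / c / eps <= B) by apply Rmax_r.
exists (fun T => B < T); split; [exists B; auto|].
assert (S : forall T1 T2, B < T1 -> T1 <= T2 -> Rabs (RInt f a T2 - RInt f a T1) < eps).
{ intros T1 T2 h1 h2.
  assert (E : forall x y, a <= x <= y -> ex_RInt f x y).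
  { intros x y hxy; apply ex_RInt_le_continuous; [lra|]; intros; apply C; lra. }
  rewrite (RInt_Chasles_R f a T1 T2) by (apply E; lra).
  replace (RInt f a T1 + RInt f T1 T2 - RInt f a T1) with (RInt f T1 T2) by (toR; ring).
  apply Rle_lt_trans with (1 := gauss_tail f K c T1 T2 hK hc ltac:(lra)
    ltac:(intros; apply C; lra) ltac:(intros; apply H; lra)).
  apply Rle_lt_trans with (K / (2 * c * T1) * 1).
  - apply Rmult_le_compat_l; [apply Rlt_le; pos|].
    rewrite <- exp_0; apply exp_mono.
    assert (0 < c * T1 ^ 2) by pos; lra.
  - apply Rmult_lt_reg_r with (T1 / eps); [pos|].
    replace (K / (2 * c * T1) * 1 * (T1 / eps)) with (K / c / eps / 2) by (field; lra).
    replace (eps * (T1 / eps)) with T1 by (field; lra).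
    lra. }
intros u v hu hv; unfold ball; simpl; unfold AbsRing_ball, abs, minus, plus, opp; simpl.
destruct (Rle_lt_dec u v) as [h|h].
- apply S; assumption.
- rewrite <- Rabs_Ropp, Ropp_plus_distr, Ropp_involutive, Rplus_comm.
  apply S; [assumption | lra].
Qed.

(* With - mu^4 as argument of Ai and t = mu^2 + s / mu, the phase t^3 / 3 - mu^4 t
   becomes airy_phase mu s; airy_rot is the real part of the integrand on the line
   through the saddle s = 0 of direction 1 + i. *)
Definition airy_phase (mu s : R) : R := - (2 / 3 * mu ^ 6) + s ^ 2 + s ^ 3 / (3 * mu ^ 3).

Definition airy_rot (mu s : R) : R :=
  exp (- 2 * s ^ 2 - 2 / 3 * (s ^ 3 / mu ^ 3)) *
  (cos (- (2 / 3 * mu ^ 6) - 2 / 3 * (s ^ 3 / mu ^ 3)) -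
   sin (- (2 / 3 * mu ^ 6) - 2 / 3 * (s ^ 3 / mu ^ 3))).

(** The integrand is Re ((1 + i c) exp (i phase)) on the line s (1 + i c), with c going from 0 to 1.
    At s = - mu^3 the point t lies on the imaginary axis, where the exponential is real and dt
    imaginary, so this end contributes nothing. At s = T the boundary term is at most T exp (- 2 c
    T^2), whose integral over c is below 1 / (2 T). *)
Lemma airy_rotate (mu T : R) : 0 < mu -> 0 < T ->
  Rabs (RInt (airy_rot mu) (- mu ^ 3) T -
        RInt (fun s => cos (airy_phase mu s)) (- mu ^ 3) T) <= 1 / 2 * / T.
Proof.
intros hm hT.
assert (hm3 : 0 < mu ^ 3) by pos.
set (re := fun c s => - 2 * c * s ^ 2 - (3 * c - c ^ 3) / (3 * mu ^ 3) * s ^ 3).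
set (im := fun c s => - (2 / 3 * mu ^ 6) + (1 - c ^ 2) * s ^ 2 +
   (1 - 3 * c ^ 2) / (3 * mu ^ 3) * s ^ 3).
assert (G := RInt_param_shift
  (fun c s => exp (re c s) * (cos (im c s) - c * sin (im c s)))
  (fun c s => - s * (exp (re c s) * sin (im c s)))
  (fun c s => exp (re c s) * (- sin (im c s) - s *
     ((- 4 * c * s - (3 * c - c ^ 3) / mu ^ 3 * s ^ 2) * sin (im c s) +
      (2 * (1 - c ^ 2) * s + (1 - 3 * c ^ 2) / mu ^ 3 * s ^ 2) * cos (im c s))))
  (-1) 2 (- mu ^ 3 - 1) (- mu ^ 3) T (T + 1) 0 1).
specialize (G ltac:(lra) ltac:(lra) ltac:(lra) ltac:(lra) ltac:(lra)).
rewrite (RInt_ext (airy_rot mu)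
  (fun s => exp (re 1 s) * (cos (im 1 s) - 1 * sin (im 1 s)))).
2:{ intros s _; unfold airy_rot, re, im.
    rewrite Rmult_1_l; toR; f_equal; f_equal; f_equal; field; lra. }
rewrite (RInt_ext (fun s => cos (airy_phase mu s))
  (fun s => exp (re 0 s) * (cos (im 0 s) - 0 * sin (im 0 s)))).
2:{ intros s _; unfold airy_phase, re, im.
    replace (- 2 * 0 * s ^ 2 - _) with 0 by (field; lra).
    rewrite exp_0, Rmult_0_l, Rmult_1_l, Rminus_0_r; toR.
    f_equal; field; lra. }
rewrite G; clear G.
- rewrite (RInt_ext _ (fun c => - T * (exp (re c T) * sin (im c T)))).
  2:{ intros c _; replace (im c (- mu ^ 3)) with 0 by (unfold im; field; lra).
      rewrite sin_0; toR; ring. }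
  assert (I : is_RInt (fun c => T * exp (- (2 * T ^ 2) * c)) 0 1
      (/ (2 * T) - / (2 * T) * exp (- (2 * T ^ 2)))).
  { replace (_ - _) with (minus (- / (2 * T) * exp (- (2 * T ^ 2) * 1))
      (- / (2 * T) * exp (- (2 * T ^ 2) * 0))).
    2:{ rewrite Rmult_1_r, Rmult_0_r, exp_0; unfold minus, plus, opp; simpl; ring. }
    apply (is_RInt_derive (fun c => - / (2 * T) * exp (- (2 * T ^ 2) * c)));
      intros c _.
    - auto_derive; [trivial | toR; simpl pow; field; lra].
    - contd; trivial. }
  apply Rle_trans with (/ (2 * T) - / (2 * T) * exp (- (2 * T ^ 2))).
  + rewrite <- (is_RInt_unique _ _ _ _ I); apply RInt_abs_le; [lra | | |].
    * apply ex_RInt_everywhere; intros c; unfold re, im; contd; trivial.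
    * eexists; exact I.
    * intros c hc; rewrite !Rabs_mult, Rabs_Ropp, (Rabs_pos_eq T) by lra.
      apply Rmult_le_compat_l; [lra|].
      rewrite <- (Rmult_1_r (exp (- _ * _))).
      apply Rmult_le_compat; [apply Rabs_pos | apply Rabs_pos | |
        apply Rabs_le, SIN_bound].
      rewrite Rabs_pos_eq by (apply Rlt_le, exp_pos).
      apply exp_mono; unfold re.
      assert (0 <= (3 * c - c ^ 3) / (3 * mu ^ 3) * T ^ 3); [|lra].
      apply Rmult_le_pos; [|apply Rlt_le; pos].
      apply Rmult_le_pos; [nra | apply Rlt_le; pos].
  + assert (0 < / (2 * T) * exp (- (2 * T ^ 2))) by (apply Rmult_lt_0_compat; pos).
    replace (1 / 2 * / T) with (/ (2 * T)) by (field; lra); lra.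
- intros; unfold re, im; contd; trivial.
- intros; unfold re, im; auto_derive; [trivial|]; toR; unfold Rminus, Rdiv;
    simpl pow; field; lra.
- intros; unfold re, im; auto_derive; [trivial|]; toR; unfold Rminus, Rdiv;
    simpl pow; field; lra.
- intros; unfold re, im; cont2d; simpl; nra.
- intros; unfold re, im; contd; trivial.
Qed.

Lemma is_RInt_gen_of_is_lim (f : R -> R) (a l : R) :
  (forall t, continuous f t) -> is_lim (RInt f a) p_infty l ->
  is_RInt_gen f (at_point a) (Rbar_locally p_infty) l.
Proof.
intros C H P HP.
apply (Filter_prod (at_point a) (Rbar_locally p_infty) _ (fun x => x = a)
  (fun T => P (RInt f a T))).
- reflexivity.
- exact (H P HP).
- intros x T -> HT; exists (RInt f a T); split; [|exact HT].
  apply (RInt_correct (V := R_CompleteNormedModule)), ex_RInt_everywhere, C.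
Qed.

Lemma RInt_airy_scale (mu X : R) : 0 < mu ->
  RInt (fun t => cos (t ^ 3 / 3 + - mu ^ 4 * t)) 0 X =
  / mu * RInt (fun s => cos (airy_phase mu s)) (- mu ^ 3) (mu * X + - mu ^ 3).
Proof.
intros hm.
assert (S := RInt_substitution (fun t => cos (t ^ 3 / 3 + - mu ^ 4 * t)) (/ mu) (mu ^ 2)
  (- mu ^ 3) (mu * X + - mu ^ 3)).
replace (/ mu * - mu ^ 3 + mu ^ 2) with 0 in S by (field; lra).
replace (/ mu * (mu * X + - mu ^ 3) + mu ^ 2) with X in S by (field; lra).
rewrite S by (apply ex_RInt_everywhere; intros; contd; trivial).
f_equal; apply RInt_ext; intros s _; unfold airy_phase; toR; f_equal; field; lra.
Qed.

(** For s >= - mu^3 one has - s^3 / mu^3 <= s^2, so the cubic term of the exponent costs at most 2/3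
    of the 2 s^2. *)
Lemma airy_rot_bound (mu s : R) : 0 < mu -> - mu ^ 3 <= s ->
  Rabs (airy_rot mu s) <= 2 * exp (- (4 / 3) * s ^ 2).
Proof.
intros hm hs; unfold airy_rot; rewrite Rabs_mult, Rmult_comm.
assert (hm3 : 0 < mu ^ 3) by pos.
apply Rmult_le_compat; [apply Rabs_pos | apply Rabs_pos | |].
- match goal with |- Rabs (cos ?z - sin ?z) <= _ =>
    generalize (SIN_bound z), (COS_bound z) end; unfold Rabs; destruct Rcase_abs; lra.
- rewrite Rabs_pos_eq by (apply Rlt_le, exp_pos); apply exp_mono.
  assert (hz : - s ^ 2 <= s ^ 3 / mu ^ 3);
    [|set (z := s ^ 3 / mu ^ 3) in *; clearbody z; lra].
  apply Rmult_le_reg_r with (mu ^ 3); [exact hm3|].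
  replace (s ^ 3 / mu ^ 3 * mu ^ 3) with (s ^ 3) by (field; lra).
  assert (0 <= s ^ 2 * (s + mu ^ 3)) by (apply Rmult_le_pos; [apply pow2_ge_0 | lra]).
  nra.
Qed.

Lemma airy_rot_continuous (mu t : R) : 0 < mu -> continuous (airy_rot mu) t.
Proof. intros hm; unfold airy_rot; contd; lra. Qed.

(** Convergence of the oscillating integral is obtained on the way: the rotated integral converges
    absolutely, and the two differ by O(1/T). *)
Lemma Ai_rotated (mu : R) : 0 < mu ->
  exists l : R, is_lim (RInt (airy_rot mu) (- mu ^ 3)) p_infty l /\
    Ai (- mu ^ 4) = / (PI * mu) * l.
Proof.
intros hm.
destruct (gauss_ex_lim (airy_rot mu) (- mu ^ 3) 2 (4 / 3)) as [l Hl]; try lra.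
{ intros; apply airy_rot_continuous, hm. }
{ intros; apply airy_rot_bound; auto. }
exists l; split; [exact Hl|].
assert (D : is_lim (fun T => RInt (fun s => cos (airy_phase mu s)) (- mu ^ 3) T -
  RInt (airy_rot mu) (- mu ^ 3) T) p_infty 0).
{ apply is_lim_of_Rinv_bound with (1 / 2); intros T hT.
  rewrite Rminus_0_r, Rabs_minus_sym; apply airy_rotate; lra. }
assert (L : is_lim (RInt (fun s => cos (airy_phase mu s)) (- mu ^ 3)) p_infty l).
{ apply is_lim_ext with (fun T => (RInt (fun s => cos (airy_phase mu s)) (- mu ^ 3) T -
    RInt (airy_rot mu) (- mu ^ 3) T) + RInt (airy_rot mu) (- mu ^ 3) T).
  - intros T; toR; ring.
  - replace (Finite l) with (Finite (0 + l)) by (f_equal; ring).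
    apply is_lim_plus'; assumption. }
assert (L2 : is_lim (RInt (fun t => cos (t ^ 3 / 3 + - mu ^ 4 * t)) 0) p_infty (/ mu * l)).
{ apply is_lim_ext with (fun X => / mu *
    RInt (fun s => cos (airy_phase mu s)) (- mu ^ 3) (mu * X + - mu ^ 3)).
  - intros X; symmetry; apply RInt_airy_scale, hm.
  - apply (is_lim_scal_l _ (/ mu) p_infty l).
    apply (is_lim_comp_lin (RInt (fun s => cos (airy_phase mu s)) (- mu ^ 3))
      mu (- mu ^ 3) p_infty l); [|lra].
    replace (Rbar_plus (Rbar_mult mu p_infty) (- mu ^ 3)) with p_infty; [exact L|].
    simpl; destruct Rle_dec; [|lra]; destruct Rle_lt_or_eq_dec; [reflexivity | lra]. }
unfold Ai; rewrite Rinv_mult, Rmult_assoc; f_equal.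
apply is_RInt_gen_unique, is_RInt_gen_of_is_lim; [|exact L2].
intros; contd; trivial.
Qed.

(** The z-derivative collapses to 2 exp (- z) sin (alpha - z), which is at most 2 * 3 in absolute
    value. The bound is uniform in alpha, which tends to infinity with mu. *)
Lemma airy_rot_local (alpha z : R) : Rabs z <= 1 ->
  Rabs (exp (- z) * (cos (alpha - z) - sin (alpha - z)) - (cos alpha - sin alpha)) <=
  6 * Rabs z.
Proof.
intros hz.
destruct (MVT_gen (fun z => exp (- z) * (cos (alpha - z) - sin (alpha - z))) 0 z
  (fun z => exp (- z) * (2 * sin (alpha - z)))) as [c [hc E]].
- intros; auto_derive; [trivial | toR; unfold Rminus; ring].
- intros; apply derivable_continuous_pt; reg.
- rewrite Ropp_0, exp_0, Rmult_1_l, !Rminus_0_r in E; rewrite E, Rabs_mult.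
  apply Rmult_le_compat_r; [apply Rabs_pos|].
  assert (cz : - c <= 1).
  { revert hz hc; unfold Rmin, Rmax, Rabs; destruct (Rle_dec 0 z); destruct Rcase_abs; lra. }
  rewrite Rabs_mult, Rabs_mult, (Rabs_pos_eq (exp _)), (Rabs_pos_eq 2)
    by (lra || apply Rlt_le, exp_pos).
  replace 6 with (3 * (2 * 1)) by ring.
  apply Rmult_le_compat; [apply Rlt_le, exp_pos | | |].
  + apply Rmult_le_pos; [lra | apply Rabs_pos].
  + apply Rle_trans with (2 := exp_le_3), exp_mono, cz.
  + apply Rmult_le_compat_l; [lra | apply Rabs_le, SIN_bound].
Qed.

Lemma is_lim_le_bound (f : R -> R) (l k d M : R) : is_lim f p_infty l ->
  (forall T, M < T -> Rabs (f T - k) <= d) -> Rabs (l - k) <= d.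
Proof.
intros H B.
apply (is_lim_le_loc (fun T => Rabs (f T - k)) (fun _ => d) p_infty (Rabs (l - k)) d).
- exists M; exact B.
- apply (is_lim_Rabs _ p_infty (l - k)); apply is_lim_minus'; [exact H | apply is_lim_const].
- apply is_lim_const.
Qed.

Lemma exists_gauss_small (K c eta : R) : 0 < K -> 0 < c -> 0 < eta ->
  exists B, 1 <= B /\ K / (c * B) * exp (- c * B ^ 2) <= eta.
Proof.
intros hK hc he; exists (Rmax 1 (K / c / eta)).
assert (h1 := Rmax_l 1 (K / c / eta)); assert (h2 := Rmax_r 1 (K / c / eta)).
set (B := Rmax _ _) in *; split; [exact h1|].
apply Rle_trans with (K / (c * B) * 1).
- apply Rmult_le_compat_l; [apply Rlt_le; pos|].
  rewrite <- exp_0; apply exp_mono; assert (0 < c * B ^ 2) by pos; lra.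
- apply Rmult_le_reg_r with (B / eta); [pos|].
  replace (K / (c * B) * 1 * (B / eta)) with (K / c / eta) by (field; lra).
  replace (eta * (B / eta)) with B by (field; lra); exact h2.
Qed.

Lemma Ai_asymptotic (eta : R) : 0 < eta -> exists M, 0 < M /\ forall mu, M <= mu ->
  Rabs (Ai (- mu ^ 4) - / (PI * mu) *
    (sqrt (PI / 2) * (cos (- (2 / 3 * mu ^ 6)) - sin (- (2 / 3 * mu ^ 6))))) <= eta / mu.
Proof.
intros he.
destruct (exists_gauss_small 4 (4 / 3) eta) as [B [B1 HB]]; try lra.
(* B <= mu^3 makes room for the central interval, 8 B^4 / eta bounds the effect of the cubic term
   there, and 8 / eta that of the ends missing from the comparison Gaussian. *)
set (M := 1 + B + 8 * B ^ 4 / eta + 8 / eta).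
assert (hB4 : 0 < 8 * B ^ 4 / eta) by pos.
assert (h8 : 0 < 8 / eta) by pos.
exists M; split; [unfold M; lra|]; intros mu hmu.
assert (hm : 1 <= mu) by (unfold M in hmu; lra).
assert (hm3 : mu <= mu ^ 3) by nra.
destruct (Ai_rotated mu ltac:(lra)) as [l [Hl ->]].
set (alpha := - (2 / 3 * mu ^ 6)); set (k := cos alpha - sin alpha).
assert (hk : Rabs k <= 2).
{ unfold k; generalize (SIN_bound alpha), (COS_bound alpha); unfold Rabs;
  destruct Rcase_abs; lra. }
assert (L : Rabs (l - sqrt (PI / 2) * k) <= 3 * eta).
{ apply (is_lim_le_bound _ l _ _ (B + 8 / eta) Hl); intros T hT.
  assert (LC := laplace_compare (airy_rot mu) (fun s => k * exp (- (2) * s ^ 2)) 2 (4 / 3)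
    (6 * (2 / 3 * (B ^ 3 / mu ^ 3))) B (mu ^ 3) T ltac:(lra) ltac:(lra)).
  specialize (LC ltac:(unfold M in hmu; lra) ltac:(lra)).
  specialize (LC ltac:(intros; apply airy_rot_continuous; lra)
    ltac:(intros; contd; trivial)
    ltac:(intros; apply airy_rot_bound; lra)).
  rewrite RInt_scal_R in LC by (apply ex_RInt_everywhere; intros; contd; trivial).
  assert (g := gauss_integral_two_sided 2 (mu ^ 3) T ltac:(lra) ltac:(lra) ltac:(lra)).
  set (I := RInt (airy_rot mu) (- mu ^ 3) T) in *.
  set (J := RInt (fun s => exp (- (2) * s ^ 2)) (- mu ^ 3) T) in *.
  assert (LC' : Rabs (I - k * J) <= 2 * B * (6 * (2 / 3 * (B ^ 3 / mu ^ 3))) + eta).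
  { apply Rle_trans with (2 := Rplus_le_compat_l _ _ _ HB).
    replace 4 with (2 * 2) at 2 by ring; apply LC.
    - intros t _; rewrite Rabs_mult; apply Rmult_le_compat;
        [apply Rabs_pos | apply Rabs_pos | exact hk |].
      rewrite Rabs_pos_eq by (apply Rlt_le, exp_pos); apply exp_mono.
      generalize (pow2_ge_0 t); lra.
    - intros t ht; unfold airy_rot; fold alpha.
      set (z := 2 / 3 * (t ^ 3 / mu ^ 3)).
      assert (hz : Rabs z <= 2 / 3 * (B ^ 3 / mu ^ 3)).
      { unfold z, Rdiv; rewrite !Rabs_mult, (Rabs_pos_eq (/ mu ^ 3)), (Rabs_pos_eq 2),
          (Rabs_pos_eq (/ 3)) by (lra || (apply Rlt_le; pos)).
        apply Rmult_le_compat_l; [lra|]; apply Rmult_le_compat_r; [apply Rlt_le; pos|].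
        rewrite <- RPow_abs; apply pow_incr; split; [apply Rabs_pos | apply Rabs_le; lra]. }
      assert (hz1 : Rabs z <= 1).
      { apply Rle_trans with (1 := hz).
        assert (B ^ 3 / mu ^ 3 <= 1); [|lra].
        apply Rmult_le_reg_r with (mu ^ 3); [pos|].
        unfold Rdiv; rewrite Rmult_assoc, Rinv_l, Rmult_1_r, Rmult_1_l
          by (apply Rgt_not_eq; pos).
        apply pow_incr; unfold M in hmu; lra. }
      replace (- 2 * t ^ 2 - z) with (- (2) * t ^ 2 + - z) by ring; rewrite exp_plus.
      replace (_ - k * _) with (exp (- (2) * t ^ 2) *
        (exp (- z) * (cos (alpha - z) - sin (alpha - z)) - (cos alpha - sin alpha)))
        by (unfold k; ring).
      rewrite Rabs_mult, <- (Rmult_1_l (6 * _)).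
      apply Rmult_le_compat; [apply Rabs_pos | apply Rabs_pos | |].
      + rewrite Rabs_pos_eq by (apply Rlt_le, exp_pos); rewrite <- exp_0.
        apply exp_mono; generalize (pow2_ge_0 t); lra.
      + apply Rle_trans with (1 := airy_rot_local alpha z hz1); lra. }
  clearbody I J.
  assert (e1 : 2 * B * (6 * (2 / 3 * (B ^ 3 / mu ^ 3))) <= eta).
  { replace (2 * B * _) with (8 * B ^ 4 / mu ^ 3) by (field; lra).
    apply Rmult_le_reg_r with (mu ^ 3 / eta); [pos|].
    replace (8 * B ^ 4 / mu ^ 3 * (mu ^ 3 / eta)) with (8 * B ^ 4 / eta) by (field; lra).
    replace (eta * (mu ^ 3 / eta)) with (mu ^ 3) by (field; lra).
    unfold M in hmu; lra. }
  assert (small : forall X, 1 <= X -> 8 / eta <= X -> exp (- (2) * X ^ 2) <= eta / 16).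
  { intros X h1 hX; replace (- (2) * X ^ 2) with (- (2 * X ^ 2)) by ring.
    apply Rle_trans with (1 := exp_inv_le (2 * X ^ 2) ltac:(pos)).
    apply Rmult_le_reg_r with (16 * X / eta); [pos|].
    replace (/ (2 * X ^ 2) * (16 * X / eta)) with (8 / eta * / X) by (field; lra).
    replace (eta / 16 * (16 * X / eta)) with X by (field; lra).
    rewrite <- (Rmult_1_r X) at 2; apply Rmult_le_compat; [lra | | lra |].
    - apply Rlt_le; pos.
    - rewrite <- Rinv_1; apply Rinv_le_contravar; lra. }
  assert (s2 : 2 / sqrt 2 <= 2).
  { rewrite <- (Rdiv_1_r 2) at 3; apply Rmult_le_compat_l; [lra|].
    apply Rinv_le_contravar; [lra|]; rewrite <- sqrt_1; apply sqrt_le_1_alt; lra. }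
  assert (e2 : Rabs (k * J - sqrt (PI / 2) * k) <= eta / 2).
  { replace (k * J - _) with (k * (J - sqrt (PI / 2))) by ring; rewrite Rabs_mult.
    apply Rle_trans with (2 * (2 * (eta / 16 + eta / 16))); [|lra].
    apply Rmult_le_compat; [apply Rabs_pos | apply Rabs_pos | exact hk |].
    apply Rle_trans with (1 := g); apply Rmult_le_compat.
    - apply Rlt_le; generalize (sqrt_lt_R0 2 ltac:(lra)); intros; pos.
    - apply Rlt_le, Rplus_lt_0_compat; apply exp_pos.
    - exact s2.
    - apply Rplus_le_compat; apply small; unfold M in hmu; lra. }
  replace (I - _) with ((I - k * J) + (k * J - sqrt (PI / 2) * k)) by ring.
  apply Rle_trans with (1 := Rabs_triang _ _); lra. }
(* PI > 3 absorbs the factor 3 of the error 3 eta. *)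
assert (pi3 := PI2_3_2).
rewrite <- Rmult_minus_distr_l, Rabs_mult, (Rabs_pos_eq (/ (PI * mu))) by (apply Rlt_le; pos).
apply Rle_trans with (/ (PI * mu) * (3 * eta)).
- apply Rmult_le_compat_l; [apply Rlt_le; pos | exact L].
- apply Rmult_le_reg_r with (PI * mu); [pos|].
  replace (/ (PI * mu) * (3 * eta) * (PI * mu)) with (3 * eta) by (field; lra).
  replace (eta / mu * (PI * mu)) with (PI * eta) by (field; lra).
  apply Rmult_le_compat_r; lra.
Qed.

(** * Riemann sums *)

Fixpoint psum (f : nat -> R) (n : nat) : R :=
  match n with O => 0 | S k => psum f k + f k end.

Lemma psum_ext (f g : nat -> R) (n : nat) :
  (forall k, f k = g k) -> psum f n = psum g n.
Proof. intros H; induction n as [|n IH]; simpl; [reflexivity | rewrite IH, H; reflexivity]. Qed.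

Lemma psum_plus (f g : nat -> R) (n : nat) :
  psum (fun k => f k + g k) n = psum f n + psum g n.
Proof. induction n as [|n IH]; simpl; [ring | rewrite IH; ring]. Qed.

Lemma psum_scal (c : R) (f : nat -> R) (n : nat) :
  psum (fun k => c * f k) n = c * psum f n.
Proof. induction n as [|n IH]; simpl; [ring | rewrite IH; ring]. Qed.

Lemma psum_le (f g : nat -> R) (n : nat) :
  (forall k, f k <= g k) -> psum f n <= psum g n.
Proof. intros H; induction n as [|n IH]; simpl; [lra | specialize (H n); lra]. Qed.

Lemma psum_abs (f : nat -> R) (n : nat) :
  Rabs (psum f n) <= psum (fun k => Rabs (f k)) n.
Proof.
induction n as [|n IH]; simpl; [rewrite Rabs_R0; lra|].
apply Rle_trans with (1 := Rabs_triang _ _); lra.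
Qed.

Lemma psum_telescope (G : R -> R) (e : R) (n : nat) :
  psum (fun k => G (INR k * e + e) - G (INR k * e)) n = G (INR n * e) - G 0.
Proof.
induction n as [|n IH].
- simpl; rewrite Rmult_0_l; ring.
- cbn [psum]; rewrite IH, S_INR.
  replace ((INR n + 1) * e) with (INR n * e + e) by ring; ring.
Qed.

Lemma one_minus_exp_neg (e : R) : 0 < e <= 1 -> e / 2 <= 1 - exp (- e).
Proof.
intros he; assert (h : exp (- e) <= / (1 + e)).
{ rewrite exp_Ropp; apply Rinv_le_contravar; [lra | apply exp_ineq1_le]. }
assert (/ (1 + e) <= 1 - e / 2); [|lra].
apply Rmult_le_reg_l with (1 + e); [lra|]; rewrite Rinv_r by lra; nra.
Qed.

(** A geometric sum bounded independently of n; errors summed over the factors of the product are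
    compared with it. *)
Lemma psum_exp_le (e : R) (n : nat) : 0 < e <= 1 ->
  psum (fun k => exp (- (INR k * e))) n <= 2 / e.
Proof.
intros he.
assert (H : psum (fun k => exp (- (INR k * e))) n * (1 - exp (- e)) =
  1 - exp (- (INR n * e))).
{ induction n as [|n IH].
  - replace (INR 0 * e) with 0 by (simpl; ring); rewrite Ropp_0, exp_0; simpl; ring.
  - cbn [psum]; rewrite Rmult_plus_distr_r, IH, S_INR.
    replace (- ((INR n + 1) * e)) with (- (INR n * e) + - e) by ring.
    rewrite exp_plus; ring. }
assert (h := one_minus_exp_neg e he).
assert (0 < exp (- (INR n * e))) by apply exp_pos.
apply Rmult_le_reg_r with (1 - exp (- e)); [lra|]; rewrite H.
apply Rle_trans with (2 / e * (e / 2)).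
- replace (2 / e * (e / 2)) with 1 by (field; lra); lra.
- apply Rmult_le_compat_l; [apply Rlt_le; pos | exact h].
Qed.

Lemma abs_increment_le (f df : R -> R) (a b M : R) : a <= b ->
  (forall t, a <= t <= b -> is_derive f t (df t)) ->
  (forall t, a <= t <= b -> Rabs (df t) <= M) ->
  Rabs (f b - f a) <= M * (b - a).
Proof.
intros hab D H.
destruct (MVT_gen f a b df) as [c [hc ->]]; try rewrite Rmin_left, Rmax_right in * by lra.
- intros; apply D; lra.
- intros x hx; apply continuity_pt_filterlim.
  apply (ex_derive_continuous (V := R_NormedModule) f x); eexists; apply D; lra.
- rewrite Rabs_mult, (Rabs_pos_eq (b - a)) by lra.
  apply Rmult_le_compat_r; [lra | apply H; lra].
Qed.

Lemma exp_neg_anti (a b : R) : a <= b -> exp (- b) <= exp (- a).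
Proof. intros; apply exp_mono; lra. Qed.

Lemma interval_sum_bound (err : nat -> R) (e K : R) (n : nat) : 0 < e <= 1 -> 0 <= K ->
  (forall k, Rabs (err k) <= K * exp (- (INR k * e))) ->
  Rabs (psum err n) <= K * (2 / e).
Proof.
intros he hK H; apply Rle_trans with (1 := psum_abs _ _).
apply Rle_trans with (1 := psum_le _ _ n H).
rewrite psum_scal; apply Rmult_le_compat_l; [exact hK | apply psum_exp_le, he].
Qed.

(** The rectangle rule errs by at most C e^2 exp (- a) on an interval of length e starting at a.
    Summing these errors gives a factor 2/e, and dividing by e leaves O(1). *)
Lemma riemann_sum (G g dg : R -> R) (C e : R) (n : nat) : 0 < e <= 1 -> 0 <= C ->
  (forall u, 0 <= u -> is_derive G u (g u)) ->
  (forall u, 0 <= u -> is_derive g u (dg u)) ->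
  (forall u, 0 <= u -> Rabs (dg u) <= C * exp (- u)) ->
  Rabs (psum (fun k => g (INR k * e + e)) n - (G (INR n * e) - G 0) / e) <= 2 * C.
Proof.
intros he hC DG Dg H.
assert (B : forall k, Rabs (G (INR k * e + e) - G (INR k * e) - e * g (INR k * e + e))
  <= C * e ^ 2 * exp (- (INR k * e))).
{ intros k; set (a := INR k * e).
  assert (ha : 0 <= a) by (apply Rmult_le_pos; [apply pos_INR | lra]).
  assert (N := abs_increment_le (fun u => G u - (u - a) * g (a + e))
    (fun u => g u - g (a + e)) a (a + e) (C * e * exp (- a)) ltac:(lra)).
  replace (G (a + e) - G a - e * g (a + e)) with
    (G (a + e) - (a + e - a) * g (a + e) - (G a - (a - a) * g (a + e))) by ring.
  replace (C * e ^ 2 * exp (- a)) with (C * e * exp (- a) * (a + e - a)) by ring.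
  apply N.
  - intros t ht; auto_derive; [eexists; apply DG; lra|].
    replace (Derive (fun x : R => G x) t) with (g t)
      by (symmetry; apply is_derive_unique, DG; lra); ring.
  - intros t ht; rewrite Rabs_minus_sym.
    apply Rle_trans with (C * exp (- a) * (a + e - t)).
    + apply (abs_increment_le g dg); [lra | intros; apply Dg; lra|].
      intros s hs; apply Rle_trans with (1 := H s ltac:(lra)).
      apply Rmult_le_compat_l; [exact hC | apply exp_neg_anti; lra].
    + replace (C * e * exp (- a)) with (C * exp (- a) * e) by ring.
      apply Rmult_le_compat_l; [|lra].
      apply Rmult_le_pos; [exact hC | apply Rlt_le, exp_pos]. }
assert (S := interval_sum_bound _ e (C * e ^ 2) n he ltac:(nra) B).
rewrite (psum_ext _ (fun k => (G (INR k * e + e) - G (INR k * e)) +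
  - e * g (INR k * e + e))) in S by (intros; ring).
rewrite psum_plus, psum_telescope, psum_scal in S.
set (s := psum _ n) in *.
replace (s - _ / e) with (- / e * (G (INR n * e) - G 0 + - e * s)) by (field; lra).
rewrite Rabs_mult, Rabs_Ropp, Rabs_pos_eq by (apply Rlt_le; pos).
apply Rmult_le_reg_l with e; [lra|].
rewrite <- Rmult_assoc, Rinv_r, Rmult_1_l by lra.
replace (e * (2 * C)) with (C * e ^ 2 * (2 / e)) by (field; lra); exact S.
Qed.

(** The nodes are e, 2e, ..., n e, as for factors 1 - q^j w with j >= 1; replacing the right end
    rule by the trapezoid rule costs the half difference of the end values. The local error C e^3 /
    2 leaves O(e) in total, so that the sum may stand in an exponent. *)
Lemma trapezoid_sum (g dg ddg : R -> R) (C e : R) (n : nat) : 0 < e <= 1 -> 0 <= C ->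
  (forall u, - (1 / 2) < u -> is_derive g u (dg u)) ->
  (forall u, 0 <= u -> is_derive dg u (ddg u)) ->
  (forall u, 0 <= u -> Rabs (ddg u) <= C * exp (- u)) ->
  Rabs (psum (fun k => g (INR k * e + e)) n - RInt g 0 (INR n * e) / e +
    (g 0 - g (INR n * e)) / 2) <= C * e.
Proof.
intros he hC Dg Ddg H.
assert (Cg : forall u, - (1 / 2) < u -> continuous g u).
{ intros u hu; apply (ex_derive_continuous (V := R_NormedModule)).
  eexists; apply Dg, hu. }
assert (Eg : forall a b, 0 <= a <= b -> ex_RInt g a b).
{ intros a b h; apply ex_RInt_le_continuous; [lra|]; intros; apply Cg; lra. }
set (I := fun u => RInt g 0 u).
assert (DI : forall u, 0 <= u -> is_derive I u (g u)).
{ intros u hu; apply (is_derive_RInt g I 0 u); [|apply Cg; lra].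
  assert (h4 : 0 < 1 / 4) by lra.
  exists (mkposreal _ h4); intros y hy.
  apply (RInt_correct (V := R_CompleteNormedModule)).
  revert hy; unfold ball; simpl; unfold AbsRing_ball, abs, minus, plus, opp; simpl; intros hy.
  apply (ex_RInt_continuous (V := R_CompleteNormedModule)); intros z hz; apply Cg.
  revert hz hy; unfold Rmin, Rmax, Rabs; destruct (Rle_dec 0 y); destruct Rcase_abs; lra. }
assert (I0 : I 0 = 0) by apply (RInt_point (V := R_CompleteNormedModule)).
fold (I (INR n * e)); clearbody I.
assert (B : forall k, Rabs (I (INR k * e + e) - I (INR k * e) -
    e * (g (INR k * e) + g (INR k * e + e)) / 2) <= C * e ^ 3 / 2 * exp (- (INR k * e))).
{ intros k; set (a := INR k * e).
  assert (ha : 0 <= a) by (apply Rmult_le_pos; [apply pos_INR | lra]).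
  assert (N := abs_increment_le (fun t => I t - (t - a) * (g a + g t) / 2)
    (fun t => (g t - g a - (t - a) * dg t) / 2) a (a + e)
    (C * e ^ 2 / 2 * exp (- a)) ltac:(lra)).
  replace (I (a + e) - I a - e * (g a + g (a + e)) / 2) with
    (I (a + e) - (a + e - a) * (g a + g (a + e)) / 2 - (I a - (a - a) * (g a + g a) / 2))
    by field.
  replace (C * e ^ 3 / 2 * exp (- a)) with (C * e ^ 2 / 2 * exp (- a) * (a + e - a))
    by field.
  apply N.
  - intros t ht; auto_derive.
    { repeat split; eexists; [apply DI | apply Dg]; lra. }
    replace (Derive (fun x : R => I x) t) with (g t)
      by (symmetry; apply is_derive_unique, DI; lra).
    replace (Derive (fun x : R => g x) t) with (dg t)
      by (symmetry; apply is_derive_unique, Dg; lra).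
    toR; field.
  - intros t ht.
    unfold Rdiv; rewrite Rabs_mult, (Rabs_pos_eq (/ 2)) by lra.
    replace (C * e ^ 2 * / 2 * exp (- a)) with (C * e * exp (- a) * e * / 2) by ring.
    apply Rmult_le_compat_r; [lra|].
    assert (ea := exp_pos (- a)).
    assert (N2 := abs_increment_le (fun s => g s - s * dg t) (fun s => dg s - dg t) a t
      (C * e * exp (- a)) ltac:(lra)).
    replace (g t - g a - (t - a) * dg t) with (g t - t * dg t - (g a - a * dg t)) by ring.
    apply Rle_trans with (C * e * exp (- a) * (t - a)).
    + apply N2.
      * intros s hs; auto_derive; [eexists; apply Dg; lra|].
        replace (Derive (fun x : R => g x) s) with (dg s)
          by (symmetry; apply is_derive_unique, Dg; lra); ring.
      * intros s hs; rewrite Rabs_minus_sym.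
        apply Rle_trans with (C * exp (- a) * (t - s)).
        -- apply (abs_increment_le dg ddg); [lra | intros; apply Ddg; lra|].
           intros v hv; apply Rle_trans with (1 := H v ltac:(lra)).
           apply Rmult_le_compat_l; [exact hC | apply exp_neg_anti; lra].
        -- replace (C * e * exp (- a)) with (C * exp (- a) * e) by ring.
           apply Rmult_le_compat_l; [|lra].
           apply Rmult_le_pos; lra.
    + apply Rmult_le_compat_l; [|lra].
      apply Rmult_le_pos; [apply Rmult_le_pos|]; lra. }
assert (e3 : 0 < e ^ 3) by pos.
assert (S := interval_sum_bound _ e (C * e ^ 3 / 2) n he ltac:(nra) B).
rewrite (psum_ext _ (fun k => (I (INR k * e + e) - I (INR k * e)) +
  (- e * g (INR k * e + e) + e / 2 * (g (INR k * e + e) - g (INR k * e))))) in S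
  by (intros; field).
rewrite !psum_plus, !psum_scal, !psum_telescope, I0 in S.
set (s := psum _ n) in *.
replace (s - _ / e + _) with
  (- / e * (I (INR n * e) - 0 + (- e * s + e / 2 * (g (INR n * e) - g 0)))) by (field; lra).
rewrite Rabs_mult, Rabs_Ropp, Rabs_pos_eq by (apply Rlt_le; pos).
apply Rmult_le_reg_l with e; [lra|].
rewrite <- Rmult_assoc, Rinv_r, Rmult_1_l by lra.
replace (e * (C * e)) with (C * e ^ 3 / 2 * (2 / e)) by (field; lra); exact S.
Qed.

(** * Logarithms of the factors of the infinite product *)

(* Throughout m = sqrt (4 x - 1). Write beta = (1 + i m) / 2 = sqrt x e^{i theta},
   theta = atan m, and y = exp (- u). Then den m u = 4 |1 - beta y|^2,
   log (1 - beta y) = lmod m u - i phase m u and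
   beta y / (1 - beta y) = zre m u + i zim m u. *)
Definition den (m u : R) : R := (2 - exp (- u)) ^ 2 + m ^ 2 * exp (- u) ^ 2.
Definition lmod (m u : R) : R := ln (den m u / 4) / 2.
Definition phase (m u : R) : R := atan (m * exp (- u) / (2 - exp (- u))).
Definition zre (m u : R) : R :=
  (2 * exp (- u) - (1 + m ^ 2) * exp (- u) ^ 2) / den m u.
Definition zim (m u : R) : R := 2 * m * exp (- u) / den m u.

Lemma exp_neg_lt_2 (u : R) : - (1 / 2) < u -> exp (- u) < 2.
Proof.
intros hu; rewrite exp_Ropp, <- (Rinv_inv 2).
assert (h := exp_ineq1_le u); apply Rinv_lt_contravar; [apply Rmult_lt_0_compat|]; lra.
Qed.

Lemma den_pos (m u : R) : - (1 / 2) < u -> 0 < den m u.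
Proof.
intros hu; unfold den; assert (h := exp_neg_lt_2 u hu).
assert (0 < (2 - exp (- u)) ^ 2) by (apply pow_lt; lra).
assert (0 <= m ^ 2 * exp (- u) ^ 2) by (apply Rmult_le_pos; apply pow2_ge_0).
lra.
Qed.

Lemma exp_neg_le_1 (u : R) : 0 <= u -> exp (- u) <= 1.
Proof. intros; rewrite <- exp_0; apply exp_mono; lra. Qed.

Lemma den_ge_1 (m u : R) : 0 <= u -> 1 <= den m u.
Proof.
intros hu; unfold den; assert (h := exp_neg_le_1 u hu).
assert (0 <= m ^ 2 * exp (- u) ^ 2) by (apply Rmult_le_pos; apply pow2_ge_0).
nra.
Qed.

Lemma lmod_derive (m u : R) : - (1 / 2) < u -> is_derive (lmod m) u (zre m u).
Proof.
intros hu; assert (h := den_pos m u hu); unfold lmod, zre, den in *.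
auto_derive; [apply Rmult_lt_0_compat; lra|].
toR; unfold Rminus, Rdiv in *; simpl pow in *; field; repeat split; lra.
Qed.

Lemma phase_derive (m u : R) : - (1 / 2) < u -> is_derive (phase m) u (- zim m u).
Proof.
intros hu; assert (h := den_pos m u hu); assert (h2 := exp_neg_lt_2 u hu).
unfold phase, zim, den in *.
auto_derive; [lra|].
toR; unfold Rminus, Rdiv in *; simpl pow in *; field; repeat split; try lra; nra.
Qed.

Lemma zre_derive (m u : R) : - (1 / 2) < u ->
  is_derive (zre m) u (- (zre m u + zre m u ^ 2 - zim m u ^ 2)).
Proof.
intros hu; assert (h := den_pos m u hu); unfold zre, zim, den in *.
auto_derive; [simpl in h; lra|].
toR; unfold Rminus, Rdiv in *; simpl pow in *; field; lra.
Qed.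

Lemma zim_derive (m u : R) : - (1 / 2) < u ->
  is_derive (zim m) u (- (zim m u + 2 * zre m u * zim m u)).
Proof.
intros hu; assert (h := den_pos m u hu); unfold zre, zim, den in *.
auto_derive; [simpl in h; lra|].
toR; unfold Rminus, Rdiv in *; simpl pow in *; field; lra.
Qed.

Lemma Rdiv_ge_1_le (a d : R) : 0 <= a -> 1 <= d -> a / d <= a.
Proof.
intros ha hd; rewrite <- (Rmult_1_r a) at 2; apply Rmult_le_compat_l; [exact ha|].
rewrite <- Rinv_1; apply Rinv_le_contravar; lra.
Qed.

Lemma zre_bound (m u : R) : 0 <= u -> Rabs (zre m u) <= (3 + m ^ 2) * exp (- u).
Proof.
intros hu; assert (h := den_ge_1 m u hu); assert (h1 := exp_neg_le_1 u hu).
assert (h0 := exp_pos (- u)); assert (hm := pow2_ge_0 m); unfold zre.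
unfold Rdiv; rewrite Rabs_mult, (Rabs_pos_eq (/ _)) by (apply Rlt_le; pos).
apply Rle_trans with (1 := Rdiv_ge_1_le _ _ (Rabs_pos _) h).
set (y := exp (- u)) in *; apply Rabs_le.
assert (0 <= (1 + m ^ 2) * y ^ 2 <= (1 + m ^ 2) * y); [|lra].
split; [apply Rmult_le_pos; [lra | apply pow2_ge_0]|].
apply Rmult_le_compat_l; [lra | nra].
Qed.

Lemma zim_bound (m u : R) : 0 < m -> 0 <= u -> 0 <= zim m u <= (3 + m ^ 2) * exp (- u).
Proof.
intros hm hu; assert (h := den_ge_1 m u hu).
assert (h0 := exp_pos (- u)); unfold zim; split.
- apply Rlt_le; pos.
- apply Rle_trans with (1 := Rdiv_ge_1_le (2 * m * exp (- u)) _ ltac:(apply Rlt_le; pos) h).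
  apply Rmult_le_compat_r; [lra|]; nra.
Qed.

Definition zbound (m : R) : R := 3 + m ^ 2.

Lemma zbound_ge_1 (m : R) : 1 <= zbound m.
Proof. unfold zbound; generalize (pow2_ge_0 m); lra. Qed.

Lemma abs_quadratic (a b c d e K L y : R) : 0 <= K -> 0 <= L ->
  Rabs a <= L * y -> Rabs b <= K -> Rabs c <= L * y -> Rabs d <= K -> Rabs e <= L * y ->
  Rabs (a + b * c + d * e) <= (L + 2 * K * L) * y.
Proof.
intros hK hL ha hb hc hd he.
assert (P : forall x z, Rabs x <= K -> Rabs z <= L * y -> Rabs (x * z) <= K * (L * y)).
{ intros x z hx hz; rewrite Rabs_mult; apply Rmult_le_compat; auto using Rabs_pos. }
assert (h1 := P b c hb hc); assert (h2 := P d e hd he).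
apply Rle_trans with (1 := Rabs_triang _ _).
assert (h3 := Rabs_triang a (b * c)); lra.
Qed.

(** With zeta = beta y / (1 - beta y), [zre1] and [zim1] are the real and imaginary parts of zeta +
    zeta^2, which is minus the u-derivative of zeta. *)
Definition zre1 (m u : R) : R := zre m u + zre m u ^ 2 - zim m u ^ 2.
Definition zim1 (m u : R) : R := zim m u + 2 * zre m u * zim m u.

Lemma z_bounds (m u : R) (K := zbound m) (y := exp (- u)) : 0 < m -> 0 <= u ->
  Rabs (zre m u) <= K * y /\ Rabs (zim m u) <= K * y /\
  Rabs (zre m u) <= K /\ Rabs (zim m u) <= K.
Proof.
intros hm hu.
assert (h1 := zre_bound m u hu); assert (h2 := zim_bound m u hm hu).
assert (h3 := exp_neg_le_1 u hu); assert (h4 := zbound_ge_1 m).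
fold (zbound m) in h1, h2; fold y in h1, h2, h3; fold K in h1, h2, h4.
rewrite (Rabs_pos_eq (zim m u)) by lra.
assert (K * y <= K) by nra; lra.
Qed.

Lemma z1_bounds (m u : R) (K := zbound m) (y := exp (- u)) : 0 < m -> 0 <= u ->
  Rabs (zre1 m u) <= 3 * K ^ 2 * y /\ Rabs (zim1 m u) <= 3 * K ^ 2 * y.
Proof.
intros hm hu; destruct (z_bounds m u hm hu) as [h1 [h2 [h3 h4]]]; assert (h5 := zbound_ge_1 m).
fold K y in h1, h2, h3, h4, h5.
assert (hy : 0 < y) by apply exp_pos.
assert (B : (K + 2 * K * K) * y <= 3 * K ^ 2 * y).
{ apply Rmult_le_compat_r; [lra | nra]. }
split; apply Rle_trans with (2 := B).
- replace (zre1 m u) with (zre m u + zre m u * zre m u + - zim m u * zim m u)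
    by (unfold zre1; ring).
  apply abs_quadratic; rewrite ?Rabs_Ropp; lra.
- replace (zim1 m u) with (zim m u + zre m u * zim m u + zre m u * zim m u)
    by (unfold zim1; ring).
  apply abs_quadratic; lra.
Qed.

(** The two expressions are the real and imaginary parts of - (1 + 2 zeta) (zeta + zeta^2), the
    u-derivative of zeta + zeta^2. *)
Lemma z2_bounds (m u : R) (K := zbound m) (y := exp (- u)) : 0 < m -> 0 <= u ->
  Rabs (- zre1 m u + 2 * zre m u * - zre1 m u + - (2 * zim m u) * - zim1 m u) <=
    15 * K ^ 3 * y /\
  Rabs (- zim1 m u + 2 * zim m u * - zre1 m u + 2 * zre m u * - zim1 m u) <=
    15 * K ^ 3 * y.
Proof.
intros hm hu.
destruct (z_bounds m u hm hu) as [h1 [h2 [h3 h4]]]; assert (h5 := zbound_ge_1 m).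
destruct (z1_bounds m u hm hu) as [h6 h7]; fold K y in h1, h2, h3, h4, h5, h6, h7.
assert (hy : 0 < y) by apply exp_pos.
assert (D : forall z, Rabs z <= K -> Rabs (2 * z) <= 2 * K).
{ intros z hz; rewrite Rabs_mult, Rabs_pos_eq; lra. }
assert (h8 := D _ h3); assert (h9 := D _ h4).
assert (B : (3 * K ^ 2 + 2 * (2 * K) * (3 * K ^ 2)) * y <= 15 * K ^ 3 * y).
{ apply Rmult_le_compat_r; [lra|]; assert (K ^ 2 <= K ^ 3) by nra; nra. }
split; apply Rle_trans with (2 := B); apply abs_quadratic; rewrite ?Rabs_Ropp; try lra;
  nra.
Qed.

Lemma zre1_derive (m u : R) : - (1 / 2) < u ->
  is_derive (zre1 m) u (- zre1 m u + 2 * zre m u * - zre1 m u +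
    - (2 * zim m u) * - zim1 m u).
Proof.
intros hu; unfold zre1 at 1.
assert (d1 := zre_derive m u hu); assert (d2 := zim_derive m u hu).
auto_derive.
{ repeat split; match goal with
  | |- ex_derive (fun x => zre _ _) _ => eexists; exact d1
  | |- ex_derive (fun x => zim _ _) _ => eexists; exact d2 end. }
replace (Derive (fun x : R => zre m x) u) with (- zre1 m u)
  by (symmetry; apply is_derive_unique, d1).
replace (Derive (fun x : R => zim m x) u) with (- zim1 m u)
  by (symmetry; apply is_derive_unique, d2).
toR; ring.
Qed.

Lemma zim1_derive (m u : R) : - (1 / 2) < u ->
  is_derive (zim1 m) u (- zim1 m u + 2 * zim m u * - zre1 m u +
    2 * zre m u * - zim1 m u).
Proof.
intros hu; unfold zim1 at 1.
assert (d1 := zre_derive m u hu); assert (d2 := zim_derive m u hu).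
auto_derive.
{ repeat split; match goal with
  | |- ex_derive (fun x => zre _ _) _ => eexists; exact d1
  | |- ex_derive (fun x => zim _ _) _ => eexists; exact d2 end. }
replace (Derive (fun x : R => zre m x) u) with (- zre1 m u)
  by (symmetry; apply is_derive_unique, d1).
replace (Derive (fun x : R => zim m x) u) with (- zim1 m u)
  by (symmetry; apply is_derive_unique, d2).
toR; ring.
Qed.

(** * Dilogarithm integrals *)

(* logr m = log |beta| = (log x) / 2 when m = sqrt (4 x - 1). *)
Definition logr (m : R) : R := ln ((1 + m ^ 2) / 4) / 2.

Lemma lmod_0 (m : R) : lmod m 0 = logr m.
Proof.
unfold lmod, logr, den; rewrite Ropp_0, exp_0; do 2 f_equal; field.
Qed.

Lemma phase_0 (m : R) : phase m 0 = atan m.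
Proof. unfold phase; rewrite Ropp_0, exp_0; f_equal; field. Qed.

Lemma ln_bounds (z : R) : 0 < z -> 1 - / z <= ln z <= z - 1.
Proof.
assert (U : forall z, 0 < z -> ln z <= z - 1).
{ intros t ht; generalize (exp_ineq1_le (ln t)); rewrite exp_ln; lra. }
intros hz; split; [|apply U, hz].
assert (h := U (/ z) ltac:(pos)); rewrite ln_Rinv in h; lra.
Qed.

Lemma lmod_bound (m u : R) : 0 <= u -> Rabs (lmod m u) <= zbound m * exp (- u).
Proof.
intros hu; unfold lmod; assert (h := den_ge_1 m u hu).
assert (hy := exp_neg_le_1 u hu); assert (y0 := exp_pos (- u)).
destruct (ln_bounds (den m u / 4)) as [h1 h2]; [lra|].
assert (m2 := pow2_ge_0 m).
assert (e : den m u = 4 - 4 * exp (- u) + (1 + m ^ 2) * exp (- u) ^ 2)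
  by (unfold den; ring).
set (y := exp (- u)) in *.
assert (y2 : 0 <= y ^ 2 <= y) by (split; nra).
assert (0 <= (1 + m ^ 2) * y ^ 2 <= (1 + m ^ 2) * y) by (split; nra).
assert (hi : - (4 * y) <= 1 - / (den m u / 4)).
{ replace (1 - / (den m u / 4)) with ((den m u - 4) / den m u) by (field; lra).
  apply Rmult_le_reg_r with (den m u); [lra|].
  unfold Rdiv; rewrite Rmult_assoc, Rinv_l, Rmult_1_r by lra; nra. }
unfold zbound; apply Rabs_le; split; lra.
Qed.

Lemma atan_abs_le (z : R) : Rabs (atan z) <= Rabs z.
Proof.
assert (P : forall z, 0 <= z -> 0 <= atan z <= z).
{ intros t ht; assert (a0 : 0 <= atan t).
  { rewrite <- atan_0; destruct ht as [ht| <-]; [apply Rlt_le, atan_increasing, ht|lra]. }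
  split; [exact a0|].
  assert (h := abs_increment_le atan (fun x => / (1 + x ^ 2)) 0 t 1 ht).
  rewrite atan_0, !Rminus_0_r, Rmult_1_l in h.
  rewrite (Rabs_pos_eq _ a0) in h; apply h.
  - intros x _; auto_derive; [trivial|]; toR; simpl pow; field; nra.
  - intros x _; rewrite Rabs_pos_eq.
    + rewrite <- Rinv_1; apply Rinv_le_contravar; nra.
    + apply Rlt_le, Rinv_0_lt_compat; nra. }
destruct (Rle_lt_dec 0 z) as [h|h].
- destruct (P z h) as [h1 h2]; rewrite !Rabs_pos_eq; lra.
- destruct (P (- z)) as [h1 h2]; [lra|]; rewrite atan_opp in h1, h2.
  rewrite (Rabs_left1 (atan z)), (Rabs_left z); lra.
Qed.

Lemma phase_bound (m u : R) : 0 <= u -> Rabs (phase m u) <= zbound m * exp (- u).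
Proof.
intros hu; unfold phase; apply Rle_trans with (1 := atan_abs_le _).
assert (hy := exp_neg_le_1 u hu); assert (y0 := exp_pos (- u)).
unfold Rdiv; rewrite !Rabs_mult, (Rabs_pos_eq (exp _)), (Rabs_pos_eq (/ _))
  by (try apply Rlt_le; pos).
assert (Rabs m <= zbound m).
{ unfold zbound; apply Rabs_le; nra. }
apply Rle_trans with (1 := Rdiv_ge_1_le (Rabs m * exp (- u)) (2 - exp (- u))
  ltac:(apply Rmult_le_pos; [apply Rabs_pos | lra]) ltac:(lra)).
apply Rmult_le_compat_r; lra.
Qed.

Lemma logr_derive (c : R) : is_derive logr c (c / (1 + c ^ 2)).
Proof.
unfold logr; auto_derive; [nra|]; toR; simpl pow; field; nra.
Qed.

Lemma atan_derive (c : R) : is_derive atan c (/ (1 + c ^ 2)).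
Proof. auto_derive; [trivial|]; toR; simpl pow; field; nra. Qed.

Lemma zbound_le (c m : R) : Rabs c <= Rabs m -> zbound c <= zbound m.
Proof.
intros h; unfold zbound; rewrite <- (pow2_abs c), <- (pow2_abs m).
apply Rplus_le_compat_l, pow_incr; split; [apply Rabs_pos | exact h].
Qed.

Lemma abs_combination_le (c a b B : R) : Rabs a <= B -> Rabs b <= B ->
  Rabs (- (c * a + b) / (1 + c ^ 2)) <= 2 * B.
Proof.
intros ha hb; assert (c2 := pow2_ge_0 c).
unfold Rdiv; rewrite Rabs_mult, Rabs_Ropp, (Rabs_pos_eq (/ _)) by (apply Rlt_le; pos).
apply Rmult_le_reg_r with (1 + c ^ 2); [lra|].
rewrite Rmult_assoc, Rinv_l, Rmult_1_r by lra.
apply Rle_trans with (1 := Rabs_triang _ _); rewrite Rabs_mult.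
assert (h0 : 0 <= B) by (apply Rle_trans with (2 := ha), Rabs_pos).
assert (Rabs c * Rabs a <= Rabs c * B) by (apply Rmult_le_compat_l; [apply Rabs_pos | exact ha]).
assert (hc : Rabs c <= 1 + c ^ 2) by (apply Rabs_le; nra).
assert (Rabs c * B <= (1 + c ^ 2) * B) by (apply Rmult_le_compat_r; lra).
assert (0 <= c ^ 2 * B) by (apply Rmult_le_pos; lra).
lra.
Qed.

Lemma lmod_param_derive (c u : R) : - (1 / 2) < u ->
  is_derive (fun c => lmod c u) c (c * exp (- u) ^ 2 / den c u).
Proof.
intros hu; assert (h := den_pos c u hu); unfold lmod, den in *.
auto_derive; [apply Rmult_lt_0_compat; lra|].
toR; unfold Rminus, Rdiv in *; simpl pow in *; field; repeat split; lra.
Qed.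

Lemma phase_param_derive (c u : R) : - (1 / 2) < u ->
  is_derive (fun c => phase c u) c (exp (- u) * (2 - exp (- u)) / den c u).
Proof.
intros hu; assert (h := den_pos c u hu); assert (h2 := exp_neg_lt_2 u hu).
unfold phase, den in *; auto_derive; [trivial|].
toR; unfold Rminus, Rdiv in *; simpl pow in *; field; repeat split; try lra; nra.
Qed.

Ltac known_derive d1 d2 :=
  repeat split; match goal with
    | |- ex_derive (fun x => lmod _ _) _ => eexists; exact d1
    | |- ex_derive (fun x => phase _ _) _ => eexists; exact d2
    | |- ex_derive (fun x => lmod x _) _ => eexists; exact d1
    | |- ex_derive (fun x => phase x _) _ => eexists; exact d2
    | |- _ => nra || trivial end.

(* The boundary term at u = 0 is half the derivative of logr^2 + atan^2. *)
Lemma RInt_lmod_shift (m0 m1 U : R) : 0 < U ->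
  Rabs (RInt (lmod m1) 0 U - RInt (lmod m0) 0 U -
    ((logr m1 ^ 2 + atan m1 ^ 2) / 2 - (logr m0 ^ 2 + atan m0 ^ 2) / 2)) <=
  Rabs (m1 - m0) * (2 * (zbound (Rabs m0 + Rabs m1) * exp (- U))).
Proof.
intros hU.
(* The real part of - i log (1 - beta y) / (2 beta) with beta = (1 + i c)/2. As the u-derivative of
   log (1 - beta y) is zeta and its c-derivative is - i zeta / (2 beta), this is the required
   u-primitive. *)
set (V := fun c u => - (c * lmod c u + phase c u) / (1 + c ^ 2)).
assert (dV : forall c u, - (1 / 2) < u -> is_derive (V c) u (c * exp (- u) ^ 2 / den c u)).
{ intros c u hu; unfold V.
  assert (d1 := lmod_derive c u hu); assert (d2 := phase_derive c u hu).
  auto_derive; [known_derive d1 d2|].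
  replace (Derive (fun x : R => lmod c x) u) with (zre c u)
    by (symmetry; apply is_derive_unique, d1).
  replace (Derive (fun x : R => phase c x) u) with (- zim c u)
    by (symmetry; apply is_derive_unique, d2).
  assert (h := den_pos c u hu); unfold zre, zim; toR; field; split; nra. }
assert (cV : forall c u, - (1 / 2) < u -> continuous (fun c => V c u) c).
{ intros c u hu; apply (ex_derive_continuous (V := R_NormedModule)); unfold V.
  assert (d1 := lmod_param_derive c u hu); assert (d2 := phase_param_derive c u hu).
  auto_derive; known_derive d1 d2. }
assert (G := RInt_param_shift lmod V (fun c u => c * exp (- u) ^ 2 / den c u)
  (Rmin m0 m1 - 1) (Rmax m0 m1 + 1) (- (1 / 4)) 0 U (U + 1) m0 m1).
assert (b1 := Rmin_l m0 m1); assert (b2 := Rmin_r m0 m1).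
assert (b3 := Rmax_l m0 m1); assert (b4 := Rmax_r m0 m1).
rewrite G; clear G; try lra.
- assert (E : forall u, - (1 / 2) < u -> ex_RInt (fun c => V c u) m0 m1).
  { intros u hu; apply ex_RInt_everywhere; intros; apply cV, hu. }
  rewrite (RInt_minus_R (fun c => V c U) (fun c => V c 0)) by (apply E; lra).
  rewrite (is_RInt_unique (fun c => V c 0) m0 m1
    (- ((logr m1 ^ 2 + atan m1 ^ 2) / 2 - (logr m0 ^ 2 + atan m0 ^ 2) / 2))).
  + replace (_ - - _ - _) with (RInt (fun c => V c U) m0 m1) by (toR; ring).
    apply RInt_abs_le_const; [apply E; lra|]; intros c hc.
    assert (hc' : zbound c <= zbound (Rabs m0 + Rabs m1)).
    { apply zbound_le; rewrite (Rabs_pos_eq (_ + _))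
        by (generalize (Rabs_pos m0), (Rabs_pos m1); lra).
      revert hc; unfold Rmin, Rmax, Rabs; destruct (Rle_dec m0 m1);
        repeat destruct Rcase_abs; lra. }
    assert (eU := exp_pos (- U)).
    assert (hz : zbound c * exp (- U) <= zbound (Rabs m0 + Rabs m1) * exp (- U))
      by (apply Rmult_le_compat_r; lra).
    apply abs_combination_le; [generalize (lmod_bound c U) | generalize (phase_bound c U)];
      lra.
  + replace (- _) with (minus (- (logr m1 ^ 2 + atan m1 ^ 2) / 2)
      (- (logr m0 ^ 2 + atan m0 ^ 2) / 2))
      by (unfold minus, plus, opp; simpl; field).
    apply (is_RInt_derive (fun c => - (logr c ^ 2 + atan c ^ 2) / 2)).
    * intros c _; unfold V; rewrite lmod_0, phase_0.
      auto_derive.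
      { repeat split; eexists; apply logr_derive. }
      replace (Derive (fun x : R => logr x) c) with (c / (1 + c ^ 2))
        by (symmetry; apply is_derive_unique, logr_derive).
      toR; unfold Rdiv; simpl pow; field; nra.
    * intros c _; apply cV; lra.
- intros c t _ ht; apply (ex_derive_continuous (V := R_NormedModule)).
  eexists; apply lmod_derive; lra.
- intros; apply lmod_param_derive; lra.
- intros; apply dV; lra.
- intros c t _ ht; assert (h := den_pos c t ltac:(lra)); unfold den in *; cont2d; lra.
- intros c _; apply (continuous_minus (V := R_NormedModule)); apply cV; lra.
Qed.

(** The shift starts at m = 0, where the phase vanishes identically. At u = 0 the boundary term
    differs from the derivative of [logr] times [atan] by 2 c atan c / (1 + c^2), and the
    substitution s = ln (1 + c^2) turns the integral of the latter into that of the theorem. *)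
Lemma RInt_phase (m U : R) : 0 < m -> 0 < U ->
  Rabs (RInt (phase m) 0 U - (RInt (fun s => atan (sqrt (exp s - 1))) 0 (ln (1 + m ^ 2)) -
    logr m * atan m)) <= m * (2 * (zbound m * exp (- U))).
Proof.
intros hm hU.
set (V := fun c u => - (c * phase c u + - lmod c u) / (1 + c ^ 2)).
assert (dV : forall c u, - (1 / 2) < u ->
  is_derive (V c) u (exp (- u) * (2 - exp (- u)) / den c u)).
{ intros c u hu; unfold V.
  assert (d1 := lmod_derive c u hu); assert (d2 := phase_derive c u hu).
  auto_derive; [known_derive d1 d2|].
  replace (Derive (fun x : R => lmod c x) u) with (zre c u)
    by (symmetry; apply is_derive_unique, d1).
  replace (Derive (fun x : R => phase c x) u) with (- zim c u)
    by (symmetry; apply is_derive_unique, d2).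
  assert (h := den_pos c u hu); unfold zre, zim; toR; field; split; nra. }
assert (cV : forall c u, - (1 / 2) < u -> continuous (fun c => V c u) c).
{ intros c u hu; apply (ex_derive_continuous (V := R_NormedModule)); unfold V.
  assert (d1 := lmod_param_derive c u hu); assert (d2 := phase_param_derive c u hu).
  auto_derive; known_derive d1 d2. }
assert (G := RInt_param_shift phase V (fun c u => exp (- u) * (2 - exp (- u)) / den c u)
  (- 1) (m + 1) (- (1 / 4)) 0 U (U + 1) 0 m).
rewrite (RInt_ext (phase 0) (fun _ => 0)), RInt_const_R, Rmult_0_r, Rminus_0_r in G.
2:{ intros; unfold phase, Rdiv; rewrite !Rmult_0_l; apply atan_0. }
assert (S : RInt (fun s => atan (sqrt (exp s - 1))) 0 (ln (1 + m ^ 2)) =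
  RInt (fun c => 2 * c * atan c / (1 + c ^ 2)) 0 m).
{ assert (Q := RInt_comp (V := R_CompleteNormedModule)
    (fun s => atan (sqrt (exp s - 1))) (fun c => ln (1 + c ^ 2))
    (fun c => 2 * c / (1 + c ^ 2)) 0 m).
  cbv beta in Q; replace (ln (1 + 0 ^ 2)) with 0 in Q
    by (replace (1 + 0 ^ 2) with 1 by ring; symmetry; apply ln_1).
  rewrite <- Q.
  - apply RInt_ext; rewrite Rmin_left, Rmax_right by lra; intros c hc.
    rewrite exp_ln by nra; replace (1 + c ^ 2 - 1) with (c * c) by ring.
    rewrite sqrt_square by lra; unfold scal; simpl; unfold mult; simpl; field; nra.
  - intros c _; apply (continuous_comp (fun s => sqrt (exp s - 1)) atan).
    + apply (continuous_comp (fun s => exp s - 1) sqrt); [contd; trivial|].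
      apply continuous_sqrt.
    + apply continuous_atan.
  - intros c _; split.
    + auto_derive; [nra|]; toR; simpl pow; field; nra.
    + contd; nra. }
rewrite S.
rewrite G; clear G S; try lra.
- assert (E : forall u, - (1 / 2) < u -> ex_RInt (fun c => V c u) 0 m).
  { intros u hu; apply ex_RInt_everywhere; intros; apply cV, hu. }
  rewrite (RInt_minus_R (fun c => V c U) (fun c => V c 0)) by (apply E; lra).
  assert (E2 : ex_RInt (fun c => 2 * c * atan c / (1 + c ^ 2)) 0 m).
  { apply ex_RInt_everywhere; intros; contd; nra. }
  assert (I : RInt (fun c => V c 0 + 2 * c * atan c / (1 + c ^ 2)) 0 m = logr m * atan m).
  { apply is_RInt_unique.
    replace (logr m * atan m) with (minus (logr m * atan m) (logr 0 * atan 0))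
      by (rewrite atan_0; unfold minus, plus, opp; simpl; ring).
    apply (is_RInt_derive (fun c => logr c * atan c)).
    * intros c _; unfold V; rewrite lmod_0, phase_0.
      auto_derive; [eexists; apply logr_derive|].
      replace (Derive (fun x : R => logr x) c) with (c / (1 + c ^ 2))
        by (symmetry; apply is_derive_unique, logr_derive).
      toR; unfold Rdiv; simpl pow; field; nra.
    * intros c _; apply (continuous_plus (V := R_NormedModule)); [apply cV; lra|].
      contd; nra. }
  rewrite RInt_plus_R in I; [ | apply (E 0); lra | exact E2].
  replace (_ - _ - (_ - _)) with (RInt (fun c => V c U) 0 m) by (rewrite <- I; toR; ring).
  rewrite <- (Rabs_pos_eq m) at 2 by lra; rewrite <- (Rminus_0_r m) at 2.
  apply RInt_abs_le_const; [apply E; lra|]; intros c hc.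
  rewrite Rmin_left, Rmax_right in hc by lra.
  assert (hc' : zbound c <= zbound m).
  { apply zbound_le; rewrite !Rabs_pos_eq; lra. }
  assert (eU := exp_pos (- U)).
  assert (hz : zbound c * exp (- U) <= zbound m * exp (- U))
    by (apply Rmult_le_compat_r; lra).
  apply abs_combination_le;
    [generalize (phase_bound c U) | rewrite Rabs_Ropp; generalize (lmod_bound c U)]; lra.
- intros c t _ ht; apply (ex_derive_continuous (V := R_NormedModule)).
  eexists; apply phase_derive; lra.
- intros; apply phase_param_derive; lra.
- intros; apply dV; lra.
- intros c t _ ht; assert (h := den_pos c t ltac:(lra)); unfold den in *; cont2d; lra.
- intros c _; apply (continuous_minus (V := R_NormedModule)); apply cV; lra.
Qed.

(** This is |1 - e^(it) e^(-u)|^2: the modulus of a factor whose beta has been moved to the unit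
    circle. *)
Definition uden (t u : R) : R := 1 - 2 * exp (- u) * cos t + exp (- u) ^ 2.
Definition ulog (t u : R) : R := ln (uden t u) / 2.

(** An open range of t around [PI/3, PI], as Green's theorem demands; 9/2 lies below 3 PI / 2. The
    bound 3/4 is paired with exp (- u) < 4/3 to keep 1 - exp (- u) cos t positive slightly below u =
    0. *)
Lemma cos_lt_3_4 (t : R) : PI / 4 < t < 9 / 2 -> cos t < 3 / 4.
Proof.
intros ht; assert (p3 := PI2_3_2); assert (p4 := PI_4).
destruct (Rle_lt_dec t PI) as [h|h].
- apply Rlt_trans with (cos (PI / 4)); [apply cos_decreasing_1; lra|].
  rewrite cos_PI4; assert (h2 : 0 < sqrt 2) by (apply sqrt_lt_R0; lra).
  assert (h3 := sqrt_sqrt 2 ltac:(lra)).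
  apply Rmult_lt_reg_r with (sqrt 2); [lra|].
  unfold Rdiv at 1; rewrite Rmult_assoc, Rinv_l by lra; nra.
- apply Rle_lt_trans with 0; [|lra]; apply cos_le_0; lra.
Qed.

Lemma exp_neg_lt_4_3 (u : R) : - (1 / 4) < u -> exp (- u) < 4 / 3.
Proof.
intros hu; rewrite exp_Ropp; replace (4 / 3) with (/ (3 / 4)) by field.
assert (h := exp_ineq1_le u); apply Rinv_lt_contravar; [apply Rmult_lt_0_compat|]; lra.
Qed.

Lemma ucos_pos (t u : R) : PI / 4 < t < 9 / 2 -> - (1 / 4) < u -> 0 < 1 - exp (- u) * cos t.
Proof.
intros ht hu; assert (h1 := cos_lt_3_4 t ht); assert (h2 := exp_neg_lt_4_3 u hu).
assert (h3 := exp_pos (- u)); nra.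
Qed.

Lemma uden_eq (t u : R) :
  uden t u = (1 - exp (- u) * cos t) ^ 2 + (exp (- u) * sin t) ^ 2.
Proof.
unfold uden; assert (h := sin2_cos2 t); unfold Rsqr in h.
replace 1 with (1 * 1) at 1 by ring.
replace (exp (- u) ^ 2) with (exp (- u) ^ 2 * (sin t * sin t + cos t * cos t))
  by (rewrite h; ring).
ring.
Qed.

Lemma uden_pos (t u : R) : PI / 4 < t < 9 / 2 -> - (1 / 4) < u -> 0 < uden t u.
Proof.
intros ht hu; rewrite uden_eq; assert (h := ucos_pos t u ht hu).
assert (0 < (1 - exp (- u) * cos t) ^ 2) by pos.
assert (h2 := pow2_ge_0 (exp (- u) * sin t)); lra.
Qed.

Lemma atan_half_angle (t : R) : 0 < t <= PI ->
  atan (sin t / (1 - cos t)) = (PI - t) / 2.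
Proof.
intros ht; set (s := t / 2).
assert (s0 : 0 < sin s) by (apply sin_gt_0; unfold s; lra).
assert (h := sin2_cos2 s); unfold Rsqr in h.
replace t with (2 * s) by (unfold s; field).
rewrite sin_2a, cos_2a.
replace (_ / _) with (tan (PI / 2 - s)).
- rewrite atan_tan by (unfold s; lra); unfold s; field.
- unfold tan; rewrite sin_shift, cos_shift.
  replace (1 - (cos s * cos s - sin s * sin s)) with (2 * (sin s * sin s)) by lra.
  field; lra.
Qed.

(** The u-primitive of the t-derivative of log |1 - e^(it) y| is the argument of the same number. At
    u = 0 it equals (t - PI)/2, and integrating from PI/3 to PI gives PI^2 / 9. *)
Lemma ulog_PI_integral (U : R) : 0 < U ->
  Rabs (RInt (ulog PI) 0 U - RInt (ulog (PI / 3)) 0 U - PI ^ 2 / 9) <= 6 * exp (- U).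
Proof.
intros hU; assert (p3 := PI2_3_2); assert (p4 := PI_4).
set (V := fun t u => - atan (exp (- u) * sin t / (1 - exp (- u) * cos t))).
assert (cV : forall t u, PI / 4 < t < 9 / 2 -> - (1 / 4) < u -> continuous (fun t => V t u) t).
{ intros t u ht hu; assert (h := ucos_pos t u ht hu); unfold V; contd; lra. }
assert (G := RInt_param_shift ulog V (fun t u => exp (- u) * sin t / uden t u)
  (PI / 4) (9 / 2) (- (1 / 4)) 0 U (U + 1) (PI / 3) PI).
rewrite G; clear G; try lra.
- assert (E : forall u, - (1 / 4) < u -> ex_RInt (fun c => V c u) (PI / 3) PI).
  { intros u hu; apply ex_RInt_le_continuous; [lra|]; intros; apply cV; lra. }
  rewrite (RInt_minus_R (fun c => V c U) (fun c => V c 0)) by (apply E; lra).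
  rewrite (RInt_ext (fun c => V c 0) (fun t => (t - PI) / 2)).
  2:{ rewrite Rmin_left, Rmax_right by lra; intros t ht; unfold V.
      rewrite Ropp_0, exp_0, !Rmult_1_l, atan_half_angle by lra; toR; field. }
  rewrite (is_RInt_unique (fun t => (t - PI) / 2) (PI / 3) PI (- (PI ^ 2 / 9))).
  2:{ replace (- (PI ^ 2 / 9)) with (minus ((PI - PI) ^ 2 / 4) ((PI / 3 - PI) ^ 2 / 4))
        by (unfold minus, plus, opp; simpl; field).
      apply (is_RInt_derive (fun t => (t - PI) ^ 2 / 4)); intros t _.
      - auto_derive; [trivial|]; toR; field.
      - contd; trivial. }
  replace (_ - - _ - _) with (RInt (fun c => V c U) (PI / 3) PI) by (toR; ring).
  apply Rle_trans with ((PI - PI / 3) * (2 * exp (- U))).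
  2:{ rewrite <- Rmult_assoc; apply Rmult_le_compat_r; [apply Rlt_le, exp_pos | lra]. }
  apply abs_RInt_le_const; [lra | apply E; lra|]; intros t ht.
  unfold V; rewrite Rabs_Ropp; apply Rle_trans with (1 := atan_abs_le _).
  assert (hc : cos t <= 1 / 2) by (rewrite <- cos_PI3; apply cos_decr_1; lra).
  assert (hy := exp_neg_le_1 U ltac:(lra)); assert (y0 := exp_pos (- U)).
  assert (hd : 1 / 2 <= 1 - exp (- U) * cos t) by nra.
  unfold Rdiv; rewrite !Rabs_mult, (Rabs_pos_eq (exp _)), (Rabs_pos_eq (/ _))
    by (apply Rlt_le; pos).
  assert (hs : Rabs (sin t) <= 1) by apply Rabs_le, SIN_bound.
  apply Rle_trans with (exp (- U) * 1 * / (1 / 2)); [|lra].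
  apply Rmult_le_compat.
  + apply Rmult_le_pos; [lra | apply Rabs_pos].
  + apply Rlt_le; pos.
  + apply Rmult_le_compat_l; lra.
  + apply Rinv_le_contravar; lra.
- intros t u ht hu; assert (h := uden_pos t u ht ltac:(lra)); unfold ulog, uden in *.
  contd; lra.
- intros t u ht hu; assert (h := uden_pos t u ht ltac:(lra)); unfold ulog, uden in *.
  auto_derive; [simpl in h; lra|]; toR; unfold Rminus, Rdiv in *; simpl pow in *; field; lra.
- intros t u ht hu; assert (h := uden_pos t u ht ltac:(lra)).
  assert (h2 := ucos_pos t u ht ltac:(lra)); rewrite uden_eq in *; unfold V.
  auto_derive; [lra|].
  toR; unfold Rminus, Rdiv in *; simpl pow in *; field; split; lra.
- intros t u ht hu; assert (h := uden_pos t u ht ltac:(lra)); unfold uden in *; cont2d; lra.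
- intros t ht; apply (continuous_minus (V := R_NormedModule)); apply cV; lra.
Qed.

Lemma ulog_PI (u : R) : ulog PI u = ln (1 + exp (- u)).
Proof.
assert (h := exp_pos (- u)); unfold ulog, uden; rewrite cos_PI.
replace (1 - 2 * exp (- u) * -1 + exp (- u) ^ 2) with
  ((1 + exp (- u)) * (1 + exp (- u))) by ring.
rewrite ln_mult by lra; field.
Qed.

Lemma ulog_PI3 (u : R) :
  ulog (PI / 3) u = / 2 * ln (1 + exp (- (3 * u))) - / 2 * ln (1 + exp (- u)).
Proof.
assert (h := exp_pos (- u)); unfold ulog, uden; rewrite cos_PI3.
set (y := exp (- u)) in *.
assert (hd : 0 < 1 - 2 * y * (1 / 2) + y ^ 2) by nra.
replace (exp (- (3 * u))) with (y ^ 3).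
2:{ unfold y; replace (- (3 * u)) with (- u + (- u + - u)) by ring.
    rewrite !exp_plus; ring. }
replace (1 + y ^ 3) with ((1 + y) * (1 - 2 * y * (1 / 2) + y ^ 2)) by field.
rewrite ln_mult by lra; field.
Qed.

Lemma lmod_sqrt3 (u : R) : lmod (sqrt 3) u = ulog (PI / 3) u.
Proof.
unfold lmod, den, ulog, uden; rewrite cos_PI3, pow2_sqrt by lra.
do 2 f_equal; field.
Qed.

(* With a = int_0^U ln (1 + e^{-u}) du, tripling u gives
   int_0^U ulog (PI / 3) = - a / 3 up to an exponentially small term. *)
Lemma lmod_sqrt3_integral (U : R) : 0 < U ->
  Rabs (RInt (lmod (sqrt 3)) 0 U + PI ^ 2 / 36) <= 2 * exp (- U).
Proof.
intros hU; assert (H := ulog_PI_integral U hU).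
set (g := fun u => ln (1 + exp (- u))).
assert (Cg : forall u, continuous g u).
{ intros u; unfold g; contd; generalize (exp_pos (- u)); lra. }
rewrite (RInt_ext _ (ulog (PI / 3))) by (intros; apply lmod_sqrt3).
rewrite (RInt_ext _ g) in H by (intros; apply ulog_PI).
assert (C3 : forall u, continuous (fun u => g (3 * u + 0)) u).
{ intros u; apply (continuous_comp (fun u => 3 * u + 0) g); [contd; trivial | apply Cg]. }
assert (S := RInt_substitution g 3 0 0 U ltac:(apply ex_RInt_everywhere; exact Cg)).
replace (3 * 0 + 0) with 0 in S by ring; rewrite Rplus_0_r in S.
rewrite (RInt_Chasles_R g 0 U (3 * U)) in S by (apply ex_RInt_everywhere; exact Cg).
rewrite (RInt_ext (ulog (PI / 3)) (fun u => / 2 * g (3 * u + 0) - / 2 * g u)) in *.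
2:{ intros u _; rewrite ulog_PI3; unfold g; rewrite Rplus_0_r; reflexivity. }
2:{ intros u _; rewrite ulog_PI3; unfold g; rewrite Rplus_0_r; reflexivity. }
rewrite RInt_minus_R, !RInt_scal_R in * by
  (apply ex_RInt_everywhere; auto || (intros; apply (continuous_scal_r (K := R_AbsRing)
    (V := R_NormedModule)); auto)).
assert (T : Rabs (RInt g U (3 * U)) <= exp (- U)).
{ assert (I : is_RInt (fun u => exp (- u)) U (3 * U) (exp (- U) - exp (- (3 * U)))).
  { replace (_ - _) with (minus (- exp (- (3 * U))) (- exp (- U)))
      by (unfold minus, plus, opp; simpl; ring).
    apply (is_RInt_derive (fun u => - exp (- u))); intros u _.
    - auto_derive; [trivial|]; toR; ring.
    - contd; trivial. }
  apply Rle_trans with (exp (- U) - exp (- (3 * U)));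
    [|generalize (exp_pos (- (3 * U))); lra].
  rewrite <- (is_RInt_unique _ _ _ _ I); apply RInt_abs_le; [lra | | |].
  - apply ex_RInt_everywhere; exact Cg.
  - eexists; exact I.
  - intros u _; assert (h := exp_pos (- u)); unfold g.
    destruct (ln_bounds (1 + exp (- u))) as [h1 h2]; [lra|].
    rewrite Rabs_pos_eq; [lra|].
    rewrite <- ln_1; apply Rlt_le, ln_increasing; lra. }
set (a := RInt g 0 U : R) in *; set (b := RInt g U (3 * U) : R) in *.
set (c := RInt (fun u => g (3 * u + 0)) 0 U : R) in *.
change (a + b = 3 * c) in S; clearbody a b c.
(* The integral of [ulog (PI / 3)] is now b/6 - a/3, while [H] puts 4a/3 - b/6 near PI^2 / 9. As b
   is small, - a/3 is near - PI^2 / 36. *)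
replace c with ((a + b) / 3) in * by lra.
revert H T; unfold Rabs; repeat destruct Rcase_abs; lra.
Qed.

(** The shift in m is anchored at m = sqrt 3, that is x = 1 and theta = PI/3, where [logr] vanishes.
    The constant is - PI^2/36 - (PI/3)^2 / 2 = - PI^2/12. *)
Lemma RInt_lmod (m : R) : 0 < m -> exists C, 0 < C /\ forall U, 0 < U ->
  Rabs (RInt (lmod m) 0 U - ((logr m ^ 2 + atan m ^ 2) / 2 - PI ^ 2 / 12)) <= C * exp (- U).
Proof.
intros hm; set (K := zbound (Rabs (sqrt 3) + Rabs m)).
assert (hK : 1 <= K) by apply zbound_ge_1.
exists (2 + Rabs (m - sqrt 3) * (2 * K)); split.
{ generalize (Rabs_pos (m - sqrt 3)); nra. }
intros U hU; assert (h1 := RInt_lmod_shift (sqrt 3) m U hU).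
assert (h2 := lmod_sqrt3_integral U hU); fold K in h1.
assert (e1 : logr (sqrt 3) = 0).
{ unfold logr; rewrite pow2_sqrt by lra.
  replace ((1 + 3) / 4) with 1 by field; rewrite ln_1; field. }
assert (e2 : atan (sqrt 3) = PI / 3).
{ rewrite <- tan_PI3; apply atan_tan; generalize PI_RGT_0; lra. }
rewrite e1, e2 in h1.
set (x := RInt (lmod m) 0 U : R) in *; set (z := RInt (lmod (sqrt 3)) 0 U : R) in *.
change (Rabs (x - z - ((logr m ^ 2 + atan m ^ 2) / 2 - (0 ^ 2 + (PI / 3) ^ 2) / 2)) <=
  Rabs (m - sqrt 3) * (2 * (K * exp (- U)))) in h1.
clearbody x z; rewrite Rmult_plus_distr_r.
replace (x - _) with ((x - z - ((logr m ^ 2 + atan m ^ 2) / 2 - (0 ^ 2 + (PI / 3) ^ 2) / 2))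
  + (z + PI ^ 2 / 36)) by field.
apply Rle_trans with (1 := Rabs_triang _ _).
replace (Rabs (m - sqrt 3) * (2 * K) * exp (- U)) with
  (Rabs (m - sqrt 3) * (2 * (K * exp (- U)))) by ring.
lra.
Qed.

(* For m = sqrt (4 x - 1) this is (2 / 3) xi(x)^(3 / 2) log (1 / q). *)
Definition airy_angle (m : R) : R :=
  RInt (fun s => atan (sqrt (exp s - 1))) 0 (ln (1 + m ^ 2)).

Lemma zre_0 (m : R) : zre m 0 = (1 - m ^ 2) / (1 + m ^ 2).
Proof. unfold zre, den; rewrite Ropp_0, exp_0; field; nra. Qed.

Lemma zim_0 (m : R) : zim m 0 = 2 * m / (1 + m ^ 2).
Proof. unfold zim, den; rewrite Ropp_0, exp_0; field; nra. Qed.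

Lemma riemann_sum_limit (G g dg : R -> R) (C K e : R) (n : nat) :
  0 < e <= 1 -> 0 <= C -> 0 <= K -> exp (- (INR n * e)) <= e ->
  (forall u, 0 <= u -> is_derive G u (g u)) ->
  (forall u, 0 <= u -> is_derive g u (dg u)) ->
  (forall u, 0 <= u -> Rabs (dg u) <= C * exp (- u)) ->
  (forall u, 0 <= u -> Rabs (G u) <= K * exp (- u)) ->
  Rabs (psum (fun k => g (INR k * e + e)) n + G 0 / e) <= 2 * C + K.
Proof.
intros he hC hK hn DG Dg H HG.
assert (R := riemann_sum G g dg C e n he hC DG Dg H).
assert (h := HG (INR n * e) ltac:(apply Rmult_le_pos; [apply pos_INR | lra])).
replace (_ + _) with ((psum (fun k => g (INR k * e + e)) n - (G (INR n * e) - G 0) / e) +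
  G (INR n * e) / e) by (field; lra).
apply Rle_trans with (1 := Rabs_triang _ _), Rplus_le_compat; [exact R|].
unfold Rdiv; rewrite Rabs_mult, (Rabs_pos_eq (/ e)) by (apply Rlt_le; pos).
apply Rmult_le_reg_r with e; [lra|].
rewrite Rmult_assoc, Rinv_l, Rmult_1_r by lra.
apply Rle_trans with (1 := h), Rmult_le_compat_l; lra.
Qed.

(** Sums of zeta and of zeta + zeta^2 over the factors, to leading order 1/e; they give the first
    two Taylor coefficients of the logarithm of the product in the angle. The u-primitives are log
    (1 - beta y) and - zeta, so only values at u = 0 remain. *)
Lemma zeta_sums (m : R) : 0 < m -> exists C, 0 < C /\ forall e n, 0 < e <= 1 ->
  exp (- (INR n * e)) <= e ->
  Rabs (psum (fun k => zre m (INR k * e + e)) n + logr m / e) <= C /\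
  Rabs (psum (fun k => zim m (INR k * e + e)) n - atan m / e) <= C /\
  Rabs (psum (fun k => zre1 m (INR k * e + e)) n - zre m 0 / e) <= C /\
  Rabs (psum (fun k => zim1 m (INR k * e + e)) n - zim m 0 / e) <= C.
Proof.
intros hm; set (K := zbound m); assert (hK : 1 <= K) by apply zbound_ge_1.
assert (hK2 : K <= K ^ 2) by nra; assert (hK3 : K ^ 2 <= K ^ 3) by nra.
exists (31 * K ^ 3); split; [lra|]; intros e n he hn.
assert (F : forall C, 0 <= C <= 15 * K ^ 3 -> 2 * C + K <= 31 * K ^ 3) by (intros; lra).
assert (F1 := F (3 * K ^ 2) ltac:(lra)); assert (F2 := F (15 * K ^ 3) ltac:(lra)).
split; [|split; [|split]].
- rewrite <- lmod_0; apply Rle_trans with (2 := F1).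
  apply (riemann_sum_limit (lmod m) (zre m) (fun u => - zre1 m u)); auto; try lra.
  + intros; apply lmod_derive; lra.
  + intros; apply zre_derive; lra.
  + intros; rewrite Rabs_Ropp; apply z1_bounds; auto.
  + intros; apply lmod_bound; auto.
- rewrite <- phase_0; apply Rle_trans with (2 := F1).
  unfold Rminus; replace (- (phase m 0 / e)) with (- phase m 0 / e) by (field; lra).
  apply (riemann_sum_limit (fun u => - phase m u) (zim m) (fun u => - zim1 m u)); auto; try lra.
  + intros; rewrite <- (Ropp_involutive (zim m u)).
    apply (is_derive_opp (V := R_NormedModule) (phase m)), phase_derive; lra.
  + intros; apply zim_derive; lra.
  + intros; rewrite Rabs_Ropp; apply z1_bounds; auto.
  + intros; rewrite Rabs_Ropp; apply phase_bound; auto.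
- apply Rle_trans with (2 := F2).
  unfold Rminus; replace (- (zre m 0 / e)) with (- zre m 0 / e) by (field; lra).
  apply (riemann_sum_limit (fun u => - zre m u) (zre1 m) (fun u => - zre1 m u + 2 * zre m u * - zre1 m u +
    - (2 * zim m u) * - zim1 m u)); auto; try lra.
  + intros; rewrite <- (Ropp_involutive (zre1 m u)).
    apply (is_derive_opp (V := R_NormedModule) (zre m)), zre_derive; lra.
  + intros; apply zre1_derive; lra.
  + intros; apply z2_bounds; auto.
  + intros; rewrite Rabs_Ropp; apply z_bounds; auto.
- apply Rle_trans with (2 := F2).
  unfold Rminus; replace (- (zim m 0 / e)) with (- zim m 0 / e) by (field; lra).
  apply (riemann_sum_limit (fun u => - zim m u) (zim1 m) (fun u => - zim1 m u + 2 * zim m u * - zre1 m u +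
    2 * zre m u * - zim1 m u)); auto; try lra.
  + intros; rewrite <- (Ropp_involutive (zim1 m u)).
    apply (is_derive_opp (V := R_NormedModule) (zim m)), zim_derive; lra.
  + intros; apply zim1_derive; lra.
  + intros; apply z2_bounds; auto.
  + intros; rewrite Rabs_Ropp; apply z_bounds; auto.
Qed.

(** Here exp (- n e) must be below e^2 rather than e: the tail of the integral is divided by e and
    still has to be O(e). *)
Lemma trapezoid_sum_limit (g dg ddg : R -> R) (C K L I e : R) (n : nat) :
  0 < e <= 1 -> 0 <= C -> 0 <= K -> 0 <= L -> 0 < INR n * e ->
  exp (- (INR n * e)) <= e ^ 2 ->
  (forall u, - (1 / 2) < u -> is_derive g u (dg u)) ->
  (forall u, 0 <= u -> is_derive dg u (ddg u)) ->
  (forall u, 0 <= u -> Rabs (ddg u) <= C * exp (- u)) ->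
  (forall u, 0 <= u -> Rabs (g u) <= K * exp (- u)) ->
  (forall U, 0 < U -> Rabs (RInt g 0 U - I) <= L * exp (- U)) ->
  Rabs (psum (fun k => g (INR k * e + e)) n - I / e + g 0 / 2) <= (C + K + L) * e.
Proof.
intros he hC hK hL hn0 hn Dg Ddg H Hg HI.
assert (T := trapezoid_sum g dg ddg C e n he hC Dg Ddg H).
set (U := INR n * e) in *.
assert (h1 := Hg U ltac:(lra)); assert (h2 := HI U hn0).
set (J := RInt g 0 U : R) in *.
change (Rabs (psum (fun k => g (INR k * e + e)) n - J / e + (g 0 - g U) / 2) <= C * e) in T.
change (Rabs (J - I) <= L * exp (- U)) in h2; clearbody J.
replace (_ + _) with ((psum (fun k => g (INR k * e + e)) n - J / e + (g 0 - g U) / 2) +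
  (g U / 2 + (J - I) / e)) by (field; lra).
apply Rle_trans with (1 := Rabs_triang _ _).
rewrite Rplus_assoc, Rmult_plus_distr_r; apply Rplus_le_compat; [exact T|].
apply Rle_trans with (1 := Rabs_triang _ _).
rewrite Rmult_plus_distr_r; apply Rplus_le_compat.
- unfold Rdiv; rewrite Rabs_mult, (Rabs_pos_eq (/ 2)) by lra.
  assert (K * exp (- U) <= K * e) by (apply Rmult_le_compat_l; nra).
  assert (0 <= K * e) by nra; lra.
- unfold Rdiv; rewrite Rabs_mult, (Rabs_pos_eq (/ e)) by (apply Rlt_le; pos).
  apply Rmult_le_reg_r with e; [lra|].
  rewrite Rmult_assoc, Rinv_l, Rmult_1_r by lra.
  apply Rle_trans with (1 := h2); rewrite Rmult_assoc.
  apply Rmult_le_compat_l; [exact hL | lra].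
Qed.

(** The logarithm of the product at the saddle. The constant terms, from - log (1 - beta) / 2, are
    kept because they contribute to the amplitude and to the phase of the result. *)
Lemma log_sums (m : R) : 0 < m -> exists C, 0 < C /\ forall e n, 0 < e <= 1 ->
  0 < INR n * e -> exp (- (INR n * e)) <= e ^ 2 ->
  Rabs (psum (fun k => lmod m (INR k * e + e)) n -
    ((logr m ^ 2 + atan m ^ 2) / 2 - PI ^ 2 / 12) / e + logr m / 2) <= C * e /\
  Rabs (psum (fun k => phase m (INR k * e + e)) n -
    (airy_angle m - logr m * atan m) / e + atan m / 2) <= C * e.
Proof.
intros hm; set (K := zbound m); assert (hK : 1 <= K) by apply zbound_ge_1.
destruct (RInt_lmod m hm) as [L [hL HL]].
exists (3 * K ^ 2 + K + (L + m * (2 * K))); split; [nra|]; intros e n he hn0 hn.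
split.
- rewrite <- lmod_0 at 2.
  apply Rle_trans with ((3 * K ^ 2 + K + L) * e); [|apply Rmult_le_compat_r; nra].
  apply (trapezoid_sum_limit (lmod m) (zre m) (fun u => - zre1 m u)); auto; try nra.
  + intros; apply lmod_derive; lra.
  + intros; apply zre_derive; lra.
  + intros; rewrite Rabs_Ropp; apply z1_bounds; auto.
  + intros; apply lmod_bound; auto.
- rewrite <- phase_0 at 2.
  apply Rle_trans with ((3 * K ^ 2 + K + m * (2 * K)) * e);
    [|apply Rmult_le_compat_r; nra].
  apply (trapezoid_sum_limit (phase m) (fun u => - zim m u) (fun u => zim1 m u)); auto;
    try nra.
  + intros; apply phase_derive; lra.
  + intros; rewrite <- (Ropp_involutive (zim1 m u)).
    apply (is_derive_opp (V := R_NormedModule) (zim m)), zim_derive; lra.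
  + intros; apply z1_bounds; auto.
  + intros; apply phase_bound; auto.
  + intros U hU; replace (m * (2 * K) * exp (- U)) with (m * (2 * (K * exp (- U)))) by ring.
    apply RInt_phase; auto.
Qed.

(** * Complex exponentials and logarithms *)

Definition cexp (a b : R) : C := (exp a * cos b, exp a * sin b).

Fixpoint cprod (f : nat -> C) (n : nat) : C :=
  match n with O => RtoC 1 | S k => Cmult (cprod f k) (f k) end.

Lemma cexp_plus (a b c d : R) : Cmult (cexp a b) (cexp c d) = cexp (a + c) (b + d).
Proof.
unfold cexp, Cmult; simpl; rewrite exp_plus, cos_plus, sin_plus.
apply injective_projections; simpl; ring.
Qed.

Lemma cexp_0 : cexp 0 0 = RtoC 1.
Proof.
unfold cexp, RtoC; rewrite exp_0, cos_0, sin_0; f_equal; ring.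
Qed.

Lemma cprod_ext (f g : nat -> C) (n : nat) :
  (forall k, f k = g k) -> cprod f n = cprod g n.
Proof. intros H; induction n as [|n IH]; simpl; [reflexivity | rewrite IH, H; reflexivity]. Qed.

Lemma cprod_mult (f g : nat -> C) (n : nat) :
  cprod (fun k => Cmult (f k) (g k)) n = Cmult (cprod f n) (cprod g n).
Proof. induction n as [|n IH]; simpl; [|rewrite IH]; ring. Qed.

Lemma cprod_cexp (a b : nat -> R) (n : nat) :
  cprod (fun k => cexp (a k) (b k)) n = cexp (psum a n) (psum b n).
Proof.
induction n as [|n IH]; simpl; [rewrite cexp_0; reflexivity|].
rewrite IH, cexp_plus; reflexivity.
Qed.

Lemma Cmod_cprod_le (f : nat -> C) (a : nat -> R) (n : nat) :
  (forall k, Cmod (f k) <= exp (a k)) -> Cmod (cprod f n) <= exp (psum a n).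
Proof.
intros H; induction n as [|n IH]; simpl.
- rewrite Cmod_1, exp_0; lra.
- rewrite Cmod_mult, exp_plus; apply Rmult_le_compat; auto using Cmod_ge_0.
Qed.

Lemma cexp_polar (a b : R) : 0 < a ->
  cexp (ln (a ^ 2 + b ^ 2) / 2) (atan (b / a)) = (a, b).
Proof.
intros ha; assert (h1 : 0 < 1 + (b / a)²).
{ generalize (Rle_0_sqr (b / a)); lra. }
assert (h2 : a ^ 2 + b ^ 2 = (a * sqrt (1 + (b / a)²)) * (a * sqrt (1 + (b / a)²))).
{ replace (_ * _) with (a ^ 2 * (sqrt (1 + (b / a)²) * sqrt (1 + (b / a)²))) by ring.
  rewrite sqrt_sqrt by lra; unfold Rsqr; field; lra. }
set (r := sqrt (1 + (b / a)²)) in *.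
assert (hr : 0 < r) by (apply sqrt_lt_R0, h1).
assert (har : 0 < a * r) by pos.
unfold cexp; rewrite h2, ln_mult, cos_atan, sin_atan by exact har; fold r.
replace ((ln (a * r) + ln (a * r)) / 2) with (ln (a * r)) by field.
rewrite exp_ln by exact har; f_equal; field; lra.
Qed.

Definition clog_re (u v : R) : R := ln ((1 + u) ^ 2 + v ^ 2) / 2.
Definition clog_im (u v : R) : R := atan (v / (1 + u)).

(* Both derivatives along t |-> 1 + t w are parts of
   w / (1 + t w) = w - t w^2 + t^2 w^3 / (1 + t w). *)
Lemma clog_taylor (u v : R) : Cmod (u, v) <= 1 / 2 ->
  Rabs (clog_re u v - (u - (u ^ 2 - v ^ 2) / 2)) <= 2 * Cmod (u, v) ^ 3 /\
  Rabs (clog_im u v - (v - u * v)) <= 2 * Cmod (u, v) ^ 3.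
Proof.
intros hw; set (w := (u, v) : C) in *; set (W := Cmod w) in *.
assert (hu : Rabs u <= W) by apply (re_le_Cmod w).
assert (W0 : 0 <= W) by apply Cmod_ge_0.
assert (hu' : forall t, 0 <= t <= 1 -> 1 / 2 <= 1 + t * u).
{ intros t ht; revert hu; unfold Rabs; destruct Rcase_abs; nra. }
assert (D : forall t, 0 <= t <= 1 ->
  let z := Cdiv (Cmult (RtoC (t ^ 2)) (Cmult w (Cmult w w))) (Cplus (RtoC 1) (Cmult (RtoC t) w)) in
  (u * (1 + t * u) + t * v * v) / ((1 + t * u) ^ 2 + (t * v) ^ 2) -
    (u - t * (u ^ 2 - v ^ 2)) = fst z /\
  (v * (1 + t * u) - t * v * u) / ((1 + t * u) ^ 2 + (t * v) ^ 2) -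
    (v - t * (2 * u * v)) = snd z /\ Cmod z <= 2 * W ^ 3).
{ intros t ht z; assert (h := hu' t ht).
  assert (hd : 0 < (1 + t * u) ^ 2 + (t * v) ^ 2).
  { assert (0 < (1 + t * u) ^ 2) by pos; generalize (pow2_ge_0 (t * v)); lra. }
  split; [|split].
  - unfold z, w, Cdiv, Cmult, Cinv, Cplus, RtoC; simpl; field.
    simpl in hd; repeat split; lra.
  - unfold z, w, Cdiv, Cmult, Cinv, Cplus, RtoC; simpl; field.
    simpl in hd; repeat split; lra.
  - assert (hc : 1 / 2 <= Cmod (Cplus (RtoC 1) (Cmult (RtoC t) w))).
    { apply Rle_trans with (2 := re_le_Cmod _); simpl.
      rewrite Rabs_pos_eq; lra. }
    unfold z; rewrite Cmod_div.
    + rewrite !Cmod_mult, Cmod_R, Rabs_pos_eq by apply pow2_ge_0; fold W.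
      apply Rmult_le_reg_r with (Cmod (Cplus (RtoC 1) (Cmult (RtoC t) w))); [lra|].
      unfold Rdiv; rewrite Rmult_assoc, Rinv_l, Rmult_1_r by lra.
      assert (t2 : 0 <= t ^ 2 <= 1) by nra.
      assert (W3 : 0 <= W ^ 3) by (apply pow_le; lra).
      replace (W * (W * W)) with (W ^ 3) by ring; nra.
    + apply Cmod_gt_0; lra. }
split.
- assert (N := abs_increment_le
    (fun t => clog_re (t * u) (t * v) - (t * u - t ^ 2 * (u ^ 2 - v ^ 2) / 2))
    (fun t => (u * (1 + t * u) + t * v * v) / ((1 + t * u) ^ 2 + (t * v) ^ 2) -
      (u - t * (u ^ 2 - v ^ 2))) 0 1 (2 * W ^ 3) ltac:(lra)).
  assert (z0 : clog_re 0 0 = 0).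
  { unfold clog_re; replace ((1 + 0) ^ 2 + 0 ^ 2) with 1 by ring; rewrite ln_1; field. }
  replace (clog_re u v - (u - (u ^ 2 - v ^ 2) / 2)) with
    (clog_re (1 * u) (1 * v) - (1 * u - 1 ^ 2 * (u ^ 2 - v ^ 2) / 2) -
     (clog_re (0 * u) (0 * v) - (0 * u - 0 ^ 2 * (u ^ 2 - v ^ 2) / 2)))
    by (rewrite !Rmult_1_l, !Rmult_0_l, z0; field).
  replace (2 * W ^ 3) with (2 * W ^ 3 * (1 - 0)) by ring; apply N.
  + intros t ht; assert (h := hu' t ht); unfold clog_re.
    assert (hd : 0 < (1 + t * u) ^ 2 + (t * v) ^ 2).
    { assert (0 < (1 + t * u) ^ 2) by pos; generalize (pow2_ge_0 (t * v)); lra. }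
    auto_derive; [simpl in hd; lra|].
    toR; unfold Rminus, Rdiv in *; simpl pow in *; field; lra.
  + intros t ht; destruct (D t ht) as [e1 [_ e3]]; rewrite e1.
    apply Rle_trans with (2 := e3), re_le_Cmod.
- assert (N := abs_increment_le
    (fun t => clog_im (t * u) (t * v) - (t * v - t ^ 2 * (u * v)))
    (fun t => (v * (1 + t * u) - t * v * u) / ((1 + t * u) ^ 2 + (t * v) ^ 2) -
      (v - t * (2 * u * v))) 0 1 (2 * W ^ 3) ltac:(lra)).
  assert (z0 : clog_im 0 0 = 0).
  { unfold clog_im; replace (0 / (1 + 0)) with 0 by field; apply atan_0. }
  replace (clog_im u v - (v - u * v)) with
    (clog_im (1 * u) (1 * v) - (1 * v - 1 ^ 2 * (u * v)) -
     (clog_im (0 * u) (0 * v) - (0 * v - 0 ^ 2 * (u * v))))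
    by (rewrite !Rmult_1_l, !Rmult_0_l, z0; ring).
  replace (2 * W ^ 3) with (2 * W ^ 3 * (1 - 0)) by ring; apply N.
  + intros t ht; assert (h := hu' t ht); unfold clog_im.
    assert (hd : 0 < (1 + t * u) ^ 2 + (t * v) ^ 2).
    { assert (0 < (1 + t * u) ^ 2) by pos; generalize (pow2_ge_0 (t * v)); lra. }
    auto_derive; [lra|].
    toR; unfold Rminus, Rdiv in *; simpl pow in *; field; repeat split; lra.
  + intros t ht; destruct (D t ht) as [_ [e2 e3]]; rewrite e2.
    apply Rle_trans with (2 := e3).
    apply Rle_trans with (2 := Rmax_Cmod _), Rmax_r.
Qed.

Lemma clog_exp (u v : R) : Rabs u <= 1 / 2 ->
  cexp (clog_re u v) (clog_im u v) = (1 + u, v).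
Proof.
intros hu; apply cexp_polar; revert hu; unfold Rabs; destruct Rcase_abs; lra.
Qed.

Lemma trig_bounds (t : R) : Rabs t <= 1 ->
  Rabs (sin t) <= Rabs t /\ Rabs (1 - cos t) <= Rabs t ^ 2 /\
  Rabs (sin t - t) <= Rabs t ^ 3 /\ Rabs (1 - cos t - t ^ 2 / 2) <= Rabs t ^ 3.
Proof.
assert (P : forall t, 0 <= t <= 1 -> Rabs (sin t) <= t /\ Rabs (1 - cos t) <= t ^ 2 /\
  Rabs (sin t - t) <= t ^ 3 /\ Rabs (1 - cos t - t ^ 2 / 2) <= t ^ 3).
{ assert (S : forall t, 0 <= t -> Rabs (sin t) <= t).
  { intros s hs; assert (N := abs_increment_le sin cos 0 s 1 hs).
    rewrite sin_0, !Rminus_0_r, Rmult_1_l in N; apply N.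
    - intros; auto_derive; [trivial | ring].
    - intros; apply Rabs_le, COS_bound. }
  assert (K : forall t, 0 <= t -> Rabs (1 - cos t) <= t ^ 2).
  { intros s hs; assert (N := abs_increment_le (fun t => - cos t) sin 0 s s hs).
    cbv beta in N; rewrite cos_0, !Rminus_0_r in N.
    replace (1 - cos s) with (- cos s - - (1)) by ring.
    replace (s ^ 2) with (s * s) by ring; apply N.
    - intros; auto_derive; [trivial | ring].
    - intros x hx; apply Rle_trans with (1 := S x ltac:(lra)); lra. }
  assert (S3 : forall t, 0 <= t -> Rabs (sin t - t) <= t ^ 3).
  { intros s hs; assert (N := abs_increment_le (fun t => sin t - t) (fun t => - (1 - cos t))
      0 s (s ^ 2) hs).
    cbv beta in N; rewrite sin_0, !Rminus_0_r in N.
    replace (s ^ 3) with (s ^ 2 * s) by ring; apply N.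
    - intros; auto_derive; [trivial | ring].
    - intros x hx; rewrite Rabs_Ropp; apply Rle_trans with (1 := K x ltac:(lra)).
      apply pow_incr; lra. }
  intros s hs; split; [apply S; lra | split; [apply K; lra | split; [apply S3; lra|]]].
  assert (N := abs_increment_le (fun t => - cos t - t ^ 2 / 2) (fun t => sin t - t)
    0 s (s ^ 2) ltac:(lra)).
  cbv beta in N; rewrite cos_0, Rminus_0_r in N.
  replace (1 - cos s - s ^ 2 / 2) with (- cos s - s ^ 2 / 2 - (- (1) - 0 ^ 2 / 2)) by field.
  replace (s ^ 3) with (s ^ 2 * s) by ring; apply N.
  - intros; auto_derive; [trivial | toR; field].
  - intros x hx; apply Rle_trans with (1 := S3 x ltac:(lra)).
    apply Rle_trans with (s ^ 3); [apply pow_incr; lra|]; nra. }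
intros ht; destruct (Rle_lt_dec 0 t) as [h|h].
- rewrite (Rabs_pos_eq t) in * by lra; apply P; lra.
- rewrite (Rabs_left t) in * by lra.
  destruct (P (- t)) as [h1 [h2 [h3 h4]]]; [lra|].
  rewrite sin_neg, cos_neg in *.
  replace (sin t - t) with (- (- sin t - - t)) by ring.
  replace (t ^ 2) with ((- t) ^ 2) by ring.
rewrite !Rabs_Ropp in *; auto.
Qed.

(** * The product near its saddle *)

Definition wre (m t u : R) : R := zre m u * (1 - cos t) + zim m u * sin t.
Definition wim (m t u : R) : R := zim m u * (1 - cos t) - zre m u * sin t.

(* 1 + zeta (1 - e^{i t}) = (1 - beta y e^{i t}) / (1 - beta y). *)
Definition zfac (m t u : R) : C := (1 + wre m t u, wim m t u).

Lemma fac_polar (m u : R) : 0 <= u ->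
  cexp (lmod m u) (- phase m u) = (1 - exp (- u) / 2, - (m * exp (- u) / 2)).
Proof.
intros hu; assert (h := exp_neg_le_1 u hu).
rewrite <- cexp_polar by lra; f_equal.
- unfold lmod, den; do 2 f_equal; field.
- unfold phase; rewrite <- atan_opp; f_equal; field; lra.
Qed.

Lemma fac_rotate (m t u : R) : 0 <= u ->
  Cmult (1 - exp (- u) / 2, - (m * exp (- u) / 2)) (zfac m t u) =
  (1 - exp (- u) / 2 * (cos t - m * sin t), - (exp (- u) / 2 * (sin t + m * cos t))).
Proof.
intros hu; assert (h := den_ge_1 m u hu).
unfold zfac, wre, wim, zre, zim, Cmult, den in *; simpl fst; simpl snd.
apply injective_projections; simpl fst; simpl snd; field; lra.
Qed.

(** In |1 + w|^2 with w = zeta (1 - e^(it)), the terms in 1 - cos t carry Re zeta + |zeta|^2. Now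
    zeta + |zeta|^2 = beta y / |1 - beta y|^2 has the argument of beta, so this real part is Im zeta
    / m. The square is therefore exactly 1 + 2 X, with X the exponent on the right, and 1 + 2 X <=
    exp (2 X). *)
Lemma zfac_Cmod_le (m t u : R) : 0 < m -> 0 <= u ->
  Cmod (zfac m t u) <= exp (zim m u * (sin t + (1 - cos t) / m)).
Proof.
intros hm hu; assert (h := den_ge_1 m u hu).
assert (sc := sin2_cos2 t); unfold Rsqr in sc.
assert (E : (1 + wre m t u) ^ 2 + wim m t u ^ 2 =
  1 + 2 * (zim m u * (sin t + (1 - cos t) / m))).
{ replace ((1 + wre m t u) ^ 2 + wim m t u ^ 2) with
    (1 + 2 * wre m t u + (zre m u ^ 2 + zim m u ^ 2) *
      (1 - 2 * cos t + (sin t * sin t + cos t * cos t))) by (unfold wre, wim; ring).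
  rewrite sc.
  assert (Z : zre m u + zre m u ^ 2 + zim m u ^ 2 = zim m u / m).
  { unfold zre, zim, den in *; field; lra. }
  replace ((1 - cos t) / m) with ((1 - cos t) * / m) by reflexivity.
  replace (2 * (zim m u * (sin t + (1 - cos t) * / m))) with
    (2 * zim m u * sin t + 2 * (1 - cos t) * (zim m u / m)) by (field; lra).
  rewrite <- Z; unfold wre; ring. }
unfold Cmod, zfac; simpl fst; simpl snd; rewrite E.
set (x := zim m u * _).
rewrite <- (sqrt_square (exp x)) by (apply Rlt_le, exp_pos).
apply sqrt_le_1_alt; rewrite <- exp_plus.
generalize (exp_ineq1_le (x + x)); lra.
Qed.

Lemma zfac_prod_bound (m : R) : 0 < m -> exists C, 0 < C /\ forall e n t, 0 < e <= 1 ->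
  exp (- (INR n * e)) <= e ->
  Cmod (cprod (fun k => zfac m t (INR k * e + e)) n) <=
  exp (atan m / e * (sin t + (1 - cos t) / m) + C).
Proof.
intros hm; destruct (zeta_sums m hm) as [C [hC H]].
exists (C * (1 + 2 / m)); split; [pos|]; intros e n t he hn.
destruct (H e n he hn) as [_ [HS _]].
assert (pk : forall k, 0 <= INR k * e + e).
{ intros k; generalize (pos_INR k); nra. }
apply Rle_trans with (1 := Cmod_cprod_le _ _ n (fun k => zfac_Cmod_le m t _ hm (pk k))).
apply exp_mono; set (h := sin t + (1 - cos t) / m).
rewrite (psum_ext _ (fun k => h * zim m (INR k * e + e))) by (intros; ring).
rewrite psum_scal; set (S := psum _ n) in *.
assert (hh : Rabs h <= 1 + 2 / m).
{ unfold h; apply Rle_trans with (1 := Rabs_triang _ _), Rplus_le_compat.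
  - apply Rabs_le, SIN_bound.
  - unfold Rdiv; rewrite Rabs_mult, (Rabs_pos_eq (/ m)) by (apply Rlt_le; pos).
    apply Rmult_le_compat_r; [apply Rlt_le; pos|].
    apply Rabs_le; generalize (COS_bound t); lra. }
assert (P : Rabs (h * (S - atan m / e)) <= (1 + 2 / m) * C).
{ rewrite Rabs_mult; apply Rmult_le_compat; auto using Rabs_pos. }
generalize (Rle_abs (h * (S - atan m / e))); lra.
Qed.

Lemma derive_le_0_decreasing (f df : R -> R) (a b : R) : a <= b ->
  (forall t, a <= t <= b -> is_derive f t (df t)) ->
  (forall t, a <= t <= b -> df t <= 0) -> f b <= f a.
Proof.
intros hab D H.
destruct (MVT_gen f a b df) as [c [hc E]]; try rewrite Rmin_left, Rmax_right in * by lra.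
- intros; apply D; lra.
- intros x hx; apply continuity_pt_filterlim.
  apply (ex_derive_continuous (V := R_NormedModule) f x); eexists; apply D; lra.
- specialize (H c ltac:(lra)); nra.
Qed.

Lemma sin_le_id (u : R) : 0 <= u -> sin u <= u.
Proof.
intros [hu| <-]; [apply Rlt_le, sin_lt_x, hu | rewrite sin_0; lra].
Qed.

Lemma one_minus_cos_le (u : R) : 1 - cos u <= u ^ 2 / 2.
Proof.
replace u with (2 * (u / 2)) at 1 by field; rewrite cos_2a_sin.
assert (h : sin (u / 2) ^ 2 <= (u / 2) ^ 2); [|lra].
assert (P : forall v, 0 <= v -> sin v ^ 2 <= v ^ 2).
{ intros v hv; rewrite <- (pow2_abs (sin v)); apply pow_incr; split; [apply Rabs_pos|].
  apply Rabs_le; split; [|apply sin_le_id, hv].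
  assert (h := derive_le_0_decreasing (fun v => - v - sin v) (fun v => - 1 - cos v) 0 v hv).
  cbv beta in h; rewrite sin_0 in h.
  assert (- v - sin v <= - 0 - 0); [apply h|lra].
  - intros; auto_derive; [trivial | ring].
  - intros t _; generalize (COS_bound t); lra. }
destruct (Rle_lt_dec 0 (u / 2)) as [h|h]; [apply P, h|].
replace (sin (u / 2) ^ 2) with (sin (- (u / 2)) ^ 2) by (rewrite sin_neg; ring).
replace ((u / 2) ^ 2) with ((- (u / 2)) ^ 2) by ring; apply P; lra.
Qed.

Lemma atan_lt_id (m : R) : 0 < m -> 0 < atan m < m.
Proof.
intros hm; split; [rewrite <- atan_0; apply atan_increasing, hm|].
assert (N := abs_increment_le atan (fun x => / (1 + x ^ 2)) (m / 2) m
  (/ (1 + (m / 2) ^ 2)) ltac:(lra)).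
assert (h : Rabs (atan m - atan (m / 2)) <= / (1 + (m / 2) ^ 2) * (m - m / 2)).
{ apply N.
  - intros; apply atan_derive.
  - intros t ht; rewrite Rabs_pos_eq by (apply Rlt_le, Rinv_0_lt_compat; nra).
    apply Rinv_le_contravar; nra. }
assert (h1 := Rle_trans _ _ _ (Rle_abs _) h).
assert (h2 := Rle_trans _ _ _ (Rle_abs _) (atan_abs_le (m / 2))).
rewrite Rabs_pos_eq in h2 by lra.
assert (h3 : / (1 + (m / 2) ^ 2) < 1).
{ rewrite <- Rinv_1; apply Rinv_lt_contravar; nra. }
nra.
Qed.

(** Concavity of the sine: f vanishes at 0 and at th, so a negative value at x would give a negative
    slope before x and a positive one after it, whereas the slope decreases. *)
Lemma sin_above_chord (th x : R) : th < PI -> 0 <= x <= th -> x * sin th <= th * sin x.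
Proof.
intros hth hx; apply Rnot_lt_le; intros hlt.
set (f := fun x => th * sin x - x * sin th); set (df := fun x => th * cos x - sin th).
assert (D : forall t, is_derive f t (df t)).
{ intros t; unfold f, df; auto_derive; [trivial | ring]. }
assert (C : forall t, continuity_pt f t).
{ intros t; apply continuity_pt_filterlim.
  apply (ex_derive_continuous (V := R_NormedModule) f t); eexists; apply D. }
destruct (MVT_gen f 0 x df) as [a [ha Ea]]; auto.
destruct (MVT_gen f x th df) as [b [hb Eb]]; auto.
rewrite Rmin_left, Rmax_right in ha by lra; rewrite Rmin_left, Rmax_right in hb by lra.
unfold f in Ea, Eb; rewrite sin_0 in Ea.
assert (dfa : df a < 0) by (apply Rnot_le_lt; intros h; nra).
assert (dfb : 0 < df b) by (apply Rnot_le_lt; intros h; nra).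
assert (cos b <= cos a) by (apply cos_decr_1; lra).
unfold df in *; nra.
Qed.

(* For t = - u < 0 the derivative in u is at most - (1 - kappa) u / 2 near 0 and
   nonpositive up to u = theta. *)
Lemma saddle_bound (m : R) : 0 < m -> exists c, 0 < c /\ forall t, - atan m <= t ->
  - atan m * t - t ^ 2 / 2 + atan m * (sin t + (1 - cos t) / m) <= - c * t ^ 2.
Proof.
intros hm; destruct (atan_lt_id m hm) as [th0 thm].
destruct (atan_bound m) as [_ thb].
assert (sc : sin (atan m) = m * cos (atan m)).
{ rewrite sin_atan, cos_atan; unfold Rdiv; ring. }
set (th := atan m) in *; set (kap := th / m).
assert (k1 : 0 < kap < 1).
{ unfold kap; split; [pos|]; apply Rmult_lt_reg_r with m; [lra|].
  unfold Rdiv; rewrite Rmult_assoc, Rinv_l; lra. }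
assert (c0 : 0 < cos th) by (apply cos_gt_0; lra).
set (u1 := (1 - kap) / th); assert (u10 : 0 < u1) by (unfold u1; pos).
set (G := fun u => th * u - u ^ 2 / 2 - th * sin u + kap * (1 - cos u)).
set (dG := fun u => th - u - th * cos u + kap * sin u).
assert (DG : forall u, is_derive G u (dG u)).
{ intros u; unfold G, dG; auto_derive; [trivial | toR; field]. }
assert (neg : forall u, 0 <= u <= th -> dG u <= 0).
(* Since m = tan th, multiplying [dG u] by sin th = m cos th gives (th - u) sin th - th sin (th -
   u), which the chord inequality makes nonpositive. *)
{ intros u hu; assert (h := sin_above_chord th (th - u) ltac:(lra) ltac:(lra)).
  rewrite sin_minus, sc in h; unfold dG, kap.
  apply Rmult_le_reg_r with (m * cos th); [pos|].
  replace ((th - u - th * cos u + th / m * sin u) * (m * cos th)) with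
    ((th - u) * (m * cos th) - th * (m * cos th * cos u - cos th * sin u)) by (field; lra).
  lra. }
assert (near : forall u, 0 <= u <= u1 -> G u <= - ((1 - kap) / 4) * u ^ 2).
{ intros u hu.
  assert (h := derive_le_0_decreasing (fun u => G u + (1 - kap) / 4 * u ^ 2)
    (fun u => dG u + (1 - kap) / 2 * u) 0 u ltac:(lra)).
  cbv beta in h.
  assert (h2 : G u + (1 - kap) / 4 * u ^ 2 <= G 0 + (1 - kap) / 4 * 0 ^ 2).
  { apply h.
    - intros t _; auto_derive; [eexists; apply DG|].
      replace (Derive (fun x : R => G x) t) with (dG t)
        by (symmetry; apply is_derive_unique, DG).
      toR; field.
    - intros t ht; unfold dG.
      assert (q1 := one_minus_cos_le t); assert (q2 := sin_le_id t ltac:(lra)).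
      assert (q3 : th * (1 - cos t) <= th * (t ^ 2 / 2)) by (apply Rmult_le_compat_l; lra).
      assert (q4 : kap * sin t <= kap * t) by (apply Rmult_le_compat_l; lra).
      assert (q5 : th * t <= 1 - kap).
      { apply Rle_trans with (th * u1); [apply Rmult_le_compat_l; lra|].
        right; unfold u1; field; lra. }
      nra. }
  unfold G at 2 in h2; rewrite sin_0, cos_0 in h2; lra. }
(* Beyond u1 the function G only decreases, so it stays below - (1 - kap)/4 u1^2; as u <= th, this
   is a multiple of u^2 after scaling by (u1 / th)^2. *)
set (c := Rmin ((1 - kap) / 4) ((1 - kap) / 4 * (u1 / th) ^ 2)).
assert (c1 : c <= (1 - kap) / 4) by apply Rmin_l.
assert (c2 : c <= (1 - kap) / 4 * (u1 / th) ^ 2) by apply Rmin_r.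
exists c; split; [apply Rmin_glb_lt; pos|]; intros t ht.
replace (th * (sin t + (1 - cos t) / m)) with (th * sin t + kap * (1 - cos t))
  by (unfold kap; field; lra).
assert (t2 := pow2_ge_0 t).
assert (ct : c * t ^ 2 <= (1 - kap) / 4 * t ^ 2) by (apply Rmult_le_compat_r; lra).
destruct (Rle_lt_dec 0 t) as [h|h].
- assert (q1 := one_minus_cos_le t); assert (q2 := sin_le_id t h).
  assert (q3 : th * sin t <= th * t) by (apply Rmult_le_compat_l; lra).
  assert (q4 : kap * (1 - cos t) <= kap * (t ^ 2 / 2)) by (apply Rmult_le_compat_l; lra).
  assert (0 <= (1 - kap) * t ^ 2) by (apply Rmult_le_pos; lra).
  lra.
- replace (_ + _) with (G (- t)).
  2:{ unfold G; rewrite sin_neg, cos_neg; field. }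
  replace (t ^ 2) with ((- t) ^ 2) in * by ring; set (u := - t) in *.
  assert (hu : 0 < u <= th) by (unfold u; lra).
  destruct (Rle_lt_dec u u1) as [h1|h1].
  + assert (q := near u ltac:(lra)); lra.
  + apply Rle_trans with (G u1).
    * apply (derive_le_0_decreasing G dG); [lra | auto|].
      intros; apply neg; lra.
    * apply Rle_trans with (1 := near u1 ltac:(lra)).
      assert (q : c * u ^ 2 <= (1 - kap) / 4 * u1 ^ 2); [|lra].
      apply Rle_trans with ((1 - kap) / 4 * (u1 / th) ^ 2 * th ^ 2).
      -- apply Rmult_le_compat; [apply Rlt_le, Rmin_glb_lt; pos | lra | exact c2|].
         apply pow_incr; lra.
      -- right; field; lra.
Qed.

Lemma Cmod_le_abs (u v : R) : Cmod (u, v) <= Rabs u + Rabs v.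
Proof.
replace ((u, v) : C) with (Cplus (RtoC u) (Cmult Ci (RtoC v)))
  by (unfold Cplus, Cmult, Ci, RtoC; simpl; apply injective_projections; simpl; ring).
apply Rle_trans with (1 := Cmod_triangle _ _).
rewrite Cmod_mult, Cmod_Ci, !Cmod_R; lra.
Qed.

Lemma w_Cmod_le (m t u : R) : 0 < m -> 0 <= u -> Rabs t <= 1 ->
  Cmod (wre m t u, wim m t u) <= 4 * zbound m * Rabs t * exp (- u).
Proof.
intros hm hu ht; destruct (z_bounds m u hm hu) as [h1 [h2 _]].
destruct (trig_bounds t ht) as [h3 [h4 _]].
set (Y := zbound m * exp (- u)) in *.
assert (h5 : Rabs (1 - cos t) <= Rabs t) by (generalize (Rabs_pos t); nra).
apply Rle_trans with (1 := Cmod_le_abs _ _).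
assert (P : forall a b, Rabs a <= Y -> Rabs b <= Rabs t -> Rabs (a * b) <= Y * Rabs t).
{ intros a b ha hb; rewrite Rabs_mult; apply Rmult_le_compat; auto using Rabs_pos. }
assert (q1 := P _ _ h1 h5); assert (q2 := P _ _ h2 h3).
assert (q3 := P _ _ h2 h5); assert (q4 := P _ _ h1 h3).
unfold wre, wim; assert (r1 := Rabs_triang (zre m u * (1 - cos t)) (zim m u * sin t)).
assert (r2 := Rabs_triang (zim m u * (1 - cos t)) (- (zre m u * sin t))).
rewrite Rabs_Ropp in r2; unfold Rminus at 2.
replace (4 * zbound m * Rabs t * exp (- u)) with (4 * (Y * Rabs t)) by (unfold Y; ring).
lra.
Qed.

(** Real and imaginary parts of the sum of w - w^2 / 2 with w = (p + i s)(kap - i eta). The angle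
    factor does not depend on k, so only the sums of zeta and of zeta^2 occur. *)
Lemma psum_w_sqr (p s : nat -> R) (kap eta : R) (n : nat) :
  psum (fun k => (p k * kap + s k * eta) - ((p k * kap + s k * eta) ^ 2 -
    (s k * kap - p k * eta) ^ 2) / 2) n =
  psum p n * kap + psum s n * eta - (psum (fun k => p k ^ 2 - s k ^ 2) n *
    (kap ^ 2 - eta ^ 2) + 2 * kap * eta * psum (fun k => 2 * p k * s k) n) / 2 /\
  psum (fun k => (s k * kap - p k * eta) - (p k * kap + s k * eta) *
    (s k * kap - p k * eta)) n =
  psum s n * kap - psum p n * eta - (psum (fun k => 2 * p k * s k) n *
    (kap ^ 2 - eta ^ 2) - 2 * kap * eta * psum (fun k => p k ^ 2 - s k ^ 2) n) / 2.
Proof.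
induction n as [|n [IH1 IH2]]; cbn [psum].
- split; field.
- rewrite IH1, IH2; split; field.
Qed.

(** P, S are the real and imaginary parts of the sum of zeta, and A, Bq those of the sum of zeta^2.
    The statement leaves them arbitrary: the imaginary part of the expansion is the same estimate at
    (S, - P, Bq, - A). *)
Lemma abs_expansion_le (P S A Bq a b C M e t x1 x2 x3 : R) (T := Rabs t) :
  0 < e -> 0 <= M -> 0 <= C -> T <= 1 ->
  Rabs P <= M / e -> Rabs S <= M / e -> Rabs A <= M / e -> Rabs Bq <= M / e ->
  Rabs a <= C -> Rabs b <= C ->
  Rabs x1 <= T ^ 3 -> Rabs x2 <= T ^ 3 -> Rabs x3 <= 3 * T ^ 3 ->
  forall x4, Rabs x4 <= T ^ 3 ->
  Rabs (P * x1 + S * x2 + a * t + t ^ 2 / 2 * b - A * x3 / 2 - Bq * x4) <=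
  5 * (M / e) * T ^ 3 + 2 * C * T.
Proof.
intros he hM hC hT hP hS hA hB ha hb h1 h2 h3 x4 h4.
assert (T0 : 0 <= T) by apply Rabs_pos.
assert (Pr : forall a b x y, Rabs a <= x -> Rabs b <= y -> Rabs (a * b) <= x * y).
{ intros; rewrite Rabs_mult; apply Rmult_le_compat; auto using Rabs_pos. }
assert (q1 := Pr _ _ _ _ hP h1); assert (q2 := Pr _ _ _ _ hS h2).
assert (q3 := Pr _ _ _ _ ha (Rle_refl T)); assert (q5 := Pr _ _ _ _ hA h3).
assert (q6 := Pr _ _ _ _ hB h4).
assert (t2 : Rabs (t ^ 2) <= T).
{ rewrite <- RPow_abs; fold T; nra. }
assert (q4 := Pr _ _ _ _ t2 hb).
set (X1 := P * x1) in *; set (X2 := S * x2) in *; set (X3 := a * t) in *.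
set (X5 := A * x3) in *; set (X6 := Bq * x4) in *.
replace (t ^ 2 / 2 * b) with (t ^ 2 * b / 2) by field; set (X4 := t ^ 2 * b) in *.
assert (D : 0 <= M / e * T ^ 3).
{ apply Rmult_le_pos; [apply Rmult_le_pos; [lra | apply Rlt_le; pos] | apply pow_le, T0]. }
set (Q := M / e * T ^ 3) in *.
replace (5 * (M / e) * T ^ 3) with (5 * Q) by (unfold Q; ring).
replace (M / e * (3 * T ^ 3)) with (3 * Q) in q5 by (unfold Q; ring).
assert (0 <= C * T) by (apply Rmult_le_pos; lra).
apply Rabs_le_between in q1; apply Rabs_le_between in q2.
apply Rabs_le_between in q3; apply Rabs_le_between in q4.
apply Rabs_le_between in q5; apply Rabs_le_between in q6.
clearbody X1 X2 X3 X4 X5 X6 Q; apply Rabs_le; split; lra.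
Qed.

(** The logarithm of the product is - i t sum zeta + (t^2 / 2) sum (zeta + zeta^2) up to O(t^3 / e).
    With t = r s and e = r^2 the first term is of order 1/r, the second of order 1, and the
    remainder of order r. *)
Lemma zfac_prod_local (m B delta : R) : 0 < m -> 0 < B -> 0 < delta ->
  exists r0, 0 < r0 <= 1 /\ forall r n s, 0 < r <= r0 ->
  exp (- (INR n * r ^ 2)) <= r ^ 2 -> Rabs s <= B ->
  exists X Y, cprod (fun k => zfac m (r * s) (INR k * r ^ 2 + r ^ 2)) n = cexp X Y /\
    Rabs (X - (atan m * s / r + zre m 0 * s ^ 2 / 2)) <= delta /\
    Rabs (Y - (logr m * s / r + zim m 0 * s ^ 2 / 2)) <= delta.
Proof.
intros hm hB hd; destruct (zeta_sums m hm) as [C [hC HZ]].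
set (K := zbound m); assert (hK : 1 <= K) by apply zbound_ge_1.
set (M := 2 * C + Rabs (logr m) + Rabs (atan m) + Rabs (zre m 0) + Rabs (zim m 0)).
assert (a1 := Rabs_pos (logr m)); assert (a2 := Rabs_pos (atan m)).
assert (a3 := Rabs_pos (zre m 0)); assert (a4 := Rabs_pos (zim m 0)).
(* r Q bounds the total error: 5 M from replacing sin t and 1 - cos t by leading terms, 256 K^3 from
   the Taylor remainders of the logarithms, 2 C B from the errors of the sums. *)
set (Q := (5 * M + 256 * K ^ 3) * B ^ 3 + 2 * C * B).
assert (hQ : 0 < Q).
{ unfold Q, M; apply Rplus_lt_0_compat; [apply Rmult_lt_0_compat; [|pos] | pos].
  assert (0 < K ^ 3) by pos; lra. }
(* The second bound keeps |w| <= 1/2, the range of the expansion of the logarithm, and |t| <= 1. *)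
set (r0 := Rmin 1 (Rmin (/ (8 * K * B)) (delta / Q))).
assert (hr0 : 0 < r0 <= 1).
{ split; [|apply Rmin_l]; repeat apply Rmin_glb_lt; pos. }
assert (r1 : r0 <= / (8 * K * B)) by (apply Rle_trans with (1 := Rmin_r _ _), Rmin_l).
assert (r2 : r0 <= delta / Q) by (apply Rle_trans with (1 := Rmin_r _ _), Rmin_r).
exists r0; split; [exact hr0|]; intros r n s hr hn hs.
set (e := r ^ 2) in *; assert (he : 0 < e <= 1) by (unfold e; split; [pos | nra]).
set (t := r * s).
assert (hT : Rabs t <= r * B).
{ unfold t; rewrite Rabs_mult, Rabs_pos_eq by lra; apply Rmult_le_compat_l; lra. }
assert (hT8 : 8 * K * (r * B) <= 1).
{ replace 1 with (/ (8 * K * B) * (8 * K * B)) by (field; lra).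
  replace (8 * K * (r * B)) with (r * (8 * K * B)) by ring.
  apply Rmult_le_compat_r; [apply Rlt_le; pos | lra]. }
assert (hT1 : Rabs t <= 1).
{ apply Rle_trans with (1 := hT); assert (0 < r * B) by pos; nra. }
assert (T0 := Rabs_pos t).
assert (pk : forall k, 0 <= INR k * e + e) by (intros k; generalize (pos_INR k); nra).
set (U := fun k => wre m t (INR k * e + e)); set (V := fun k => wim m t (INR k * e + e)).
assert (hw : forall k, Cmod (U k, V k) <= 4 * K * Rabs t * exp (- (INR k * e))).
{ intros k; apply Rle_trans with (1 := w_Cmod_le m t _ hm (pk k) hT1).
  apply Rmult_le_compat_l; [apply Rmult_le_pos; lra | apply exp_neg_anti; lra]. }
assert (hw2 : forall k, Cmod (U k, V k) <= 1 / 2).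
{ intros k; apply Rle_trans with (1 := hw k).
  assert (h := exp_neg_le_1 (INR k * e) ltac:(generalize (pos_INR k); nra)).
  assert (h0 := exp_pos (- (INR k * e))).
  apply Rle_trans with (4 * K * Rabs t * 1); [|nra].
  apply Rmult_le_compat_l; [apply Rmult_le_pos; lra | exact h]. }
assert (hw3 : forall k, 2 * Cmod (U k, V k) ^ 3 <=
  128 * K ^ 3 * Rabs t ^ 3 * exp (- (INR k * e))).
{ intros k; set (y := exp (- (INR k * e))).
  assert (hy : 0 < y <= 1).
  { split; [apply exp_pos | apply exp_neg_le_1; generalize (pos_INR k); nra]. }
  apply Rle_trans with (2 * (4 * K * Rabs t * y) ^ 3).
  - apply Rmult_le_compat_l; [lra|]; apply pow_incr; split; [apply Cmod_ge_0 | apply hw].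
  - replace (2 * (4 * K * Rabs t * y) ^ 3) with (128 * K ^ 3 * Rabs t ^ 3 * y ^ 3) by ring.
    apply Rmult_le_compat_l; [|nra].
    apply Rmult_le_pos; [apply Rlt_le; pos | apply pow_le, T0]. }
exists (psum (fun k => clog_re (U k) (V k)) n), (psum (fun k => clog_im (U k) (V k)) n).
split.
{ rewrite <- cprod_cexp; apply cprod_ext; intros k; rewrite clog_exp; [reflexivity|].
  apply Rle_trans with (2 := hw2 k), (re_le_Cmod (U k, V k)). }
assert (he3 : Rabs t ^ 3 / e <= r * B ^ 3).
{ apply Rle_trans with ((r * B) ^ 3 / e).
  - apply Rmult_le_compat_r; [apply Rlt_le; pos | apply pow_incr; lra].
  - right; unfold e; field; lra. }
assert (Tot : 5 * (M / e) * Rabs t ^ 3 + 2 * C * Rabs t +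
  128 * K ^ 3 * Rabs t ^ 3 * (2 / e) <= delta).
{ apply Rle_trans with (r * Q).
  - replace (5 * (M / e) * Rabs t ^ 3) with (5 * M * (Rabs t ^ 3 / e)) by (field; lra).
    replace (128 * K ^ 3 * Rabs t ^ 3 * (2 / e)) with (256 * K ^ 3 * (Rabs t ^ 3 / e))
      by (field; lra).
    assert (0 <= M) by (unfold M; lra).
    assert (q1 := Rmult_le_compat_l (5 * M) _ _ ltac:(lra) he3).
    assert (q2 := Rmult_le_compat_l (256 * K ^ 3) _ _ ltac:(apply Rlt_le; pos) he3).
    assert (q3 := Rmult_le_compat_l (2 * C) _ _ ltac:(lra) hT).
    unfold Q; lra.
  - apply Rle_trans with (delta / Q * Q); [apply Rmult_le_compat_r; lra|].
    right; field; lra. }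
destruct (HZ e n he) as [H1 [H2 [H3 H4]]].
{ apply Rle_trans with (1 := hn); unfold e; nra. }
set (p := fun k => zre m (INR k * e + e)); set (z := fun k => zim m (INR k * e + e)).
fold p in H1; fold z in H2.
set (P := psum p n) in *; set (S := psum z n) in *.
set (A := psum (fun k => p k ^ 2 - z k ^ 2) n).
set (Bq := psum (fun k => 2 * p k * z k) n).
assert (EA : psum (fun k => zre1 m (INR k * e + e)) n = P + A).
{ unfold P, A; rewrite <- psum_plus; apply psum_ext; intros k; unfold zre1, p, z; ring. }
assert (EB : psum (fun k => zim1 m (INR k * e + e)) n = S + Bq).
{ unfold S, Bq; rewrite <- psum_plus; apply psum_ext; intros k; unfold zim1, p, z; ring. }
rewrite EA in H3; rewrite EB in H4.
assert (ie : 1 <= / e) by (rewrite <- Rinv_1; apply Rinv_le_contravar; lra).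
assert (Dv : forall x, Rabs (x / e) <= Rabs x * / e).
{ intros x; unfold Rdiv; rewrite Rabs_mult, (Rabs_pos_eq (/ e)) by lra; lra. }
assert (d1 := Dv (logr m)); assert (d2 := Dv (atan m)).
assert (d3 := Dv (zre m 0)); assert (d4 := Dv (zim m 0)).
assert (Ce : C <= C * / e) by nra.
assert (Me : M / e = 2 * (C * / e) + Rabs (logr m) * / e + Rabs (atan m) * / e +
  Rabs (zre m 0) * / e + Rabs (zim m 0) * / e) by (unfold M; field; lra).
assert (p1 : 0 <= Rabs (logr m) * / e) by (apply Rmult_le_pos; lra).
assert (p2 : 0 <= Rabs (atan m) * / e) by (apply Rmult_le_pos; lra).
assert (p3 : 0 <= Rabs (zre m 0) * / e) by (apply Rmult_le_pos; lra).
assert (p4 : 0 <= Rabs (zim m 0) * / e) by (apply Rmult_le_pos; lra).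
assert (h1 := proj1 (Rabs_le_between _ _) H1); assert (h2 := proj1 (Rabs_le_between _ _) H2).
assert (h3 := proj1 (Rabs_le_between _ _) H3); assert (h4 := proj1 (Rabs_le_between _ _) H4).
apply Rabs_le_between in d1; apply Rabs_le_between in d2.
apply Rabs_le_between in d3; apply Rabs_le_between in d4.
assert (MP : Rabs P <= M / e) by (apply Rabs_le; rewrite Me; split; lra).
assert (MS : Rabs S <= M / e) by (apply Rabs_le; rewrite Me; split; lra).
assert (MA : Rabs A <= M / e) by (apply Rabs_le; rewrite Me; split; lra).
assert (MB : Rabs Bq <= M / e) by (apply Rabs_le; rewrite Me; split; lra).
destruct (trig_bounds t hT1) as [g1 [g2 [g3 g4]]].
set (kap := 1 - cos t) in *; set (eta := sin t) in *.
assert (x3 : Rabs (kap ^ 2 - eta ^ 2 + t ^ 2) <= 3 * Rabs t ^ 3).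
{ replace (kap ^ 2 - eta ^ 2 + t ^ 2) with (kap * kap + - ((eta - t) * (eta + t))) by ring.
  apply Rle_trans with (1 := Rabs_triang _ _); rewrite Rabs_Ropp, !Rabs_mult.
  assert (k2 : Rabs kap * Rabs kap <= Rabs t ^ 2 * Rabs t ^ 2)
    by (apply Rmult_le_compat; auto using Rabs_pos).
  assert (k3 : Rabs (eta - t) * Rabs (eta + t) <= Rabs t ^ 3 * (Rabs t + Rabs t)).
  { apply Rmult_le_compat; auto using Rabs_pos.
    apply Rle_trans with (1 := Rabs_triang _ _); lra. }
  assert (0 <= Rabs t ^ 3) by (apply pow_le; lra).
  replace (Rabs t ^ 2 * Rabs t ^ 2) with (Rabs t ^ 3 * Rabs t) in k2 by ring.
  nra. }
assert (x4 : Rabs (kap * eta) <= Rabs t ^ 3).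
{ rewrite Rabs_mult; replace (Rabs t ^ 3) with (Rabs t ^ 2 * Rabs t) by ring.
  apply Rmult_le_compat; auto using Rabs_pos. }
destruct (psum_w_sqr p z kap eta n) as [S1 S2]; fold P S A Bq in S1, S2.
assert (L : forall c w : nat -> R, (forall k, Rabs (c k - w k) <= 2 * Cmod (U k, V k) ^ 3) ->
  Rabs (psum c n - psum w n) <= 128 * K ^ 3 * Rabs t ^ 3 * (2 / e)).
{ intros c w hcw.
  replace (psum c n - psum w n) with (psum (fun k => c k + - 1 * w k) n)
    by (rewrite psum_plus, psum_scal; ring).
  apply interval_sum_bound; [exact he | |].
  - apply Rmult_le_pos; [apply Rlt_le; pos | apply pow_le, T0].
  - intros k; replace (c k + -1 * w k) with (c k - w k) by ring.
    apply Rle_trans with (1 := hcw k), hw3. }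
split.
- assert (N := L (fun k => clog_re (U k) (V k)) _
    (fun k => proj1 (clog_taylor (U k) (V k) (hw2 k)))).
  assert (N2 := abs_expansion_le P S A Bq (S - atan m / e) (P + A - zre m 0 / e) C M e t
    (kap - t ^ 2 / 2) (eta - t) (kap ^ 2 - eta ^ 2 + t ^ 2) ltac:(lra) ltac:(unfold M; lra)
    ltac:(lra) hT1 MP MS MA MB H2 H3 g4 g3 x3 (kap * eta) x4).
  unfold U, V, wre, wim in N; fold kap eta in N; unfold p, z in S1; rewrite S1 in N.
  apply Rle_trans with (2 := Tot).
  replace (_ - _) with
   ((psum (fun k => clog_re (U k) (V k)) n -
     (P * kap + S * eta - (A * (kap ^ 2 - eta ^ 2) + 2 * kap * eta * Bq) / 2)) +
    (P * (kap - t ^ 2 / 2) + S * (eta - t) + (S - atan m / e) * t +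
     t ^ 2 / 2 * (P + A - zre m 0 / e) - A * (kap ^ 2 - eta ^ 2 + t ^ 2) / 2 -
     Bq * (kap * eta))) by (unfold t, e; field; lra).
  apply Rle_trans with (1 := Rabs_triang _ _).
  rewrite Rplus_comm; apply Rplus_le_compat; assumption.
- assert (N := L (fun k => clog_im (U k) (V k)) _
    (fun k => proj2 (clog_taylor (U k) (V k) (hw2 k)))).
  assert (N2 := abs_expansion_le S (- P) Bq (- A) (- (P + logr m / e))
    (S + Bq - zim m 0 / e) C M e t
    (kap - t ^ 2 / 2) (eta - t) (kap ^ 2 - eta ^ 2 + t ^ 2) ltac:(lra) ltac:(unfold M; lra)
    ltac:(lra) hT1 MS ltac:(rewrite Rabs_Ropp; exact MP) MB
    ltac:(rewrite Rabs_Ropp; exact MA) ltac:(rewrite Rabs_Ropp; exact H1) H4 g4 g3 x3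
    (kap * eta) x4).
  unfold U, V, wre, wim in N; fold kap eta in N; unfold p, z in S2; rewrite S2 in N.
  apply Rle_trans with (2 := Tot).
  replace (_ - _) with
   ((psum (fun k => clog_im (U k) (V k)) n -
     (S * kap - P * eta - (Bq * (kap ^ 2 - eta ^ 2) - 2 * kap * eta * A) / 2)) +
    (S * (kap - t ^ 2 / 2) + - P * (eta - t) + - (P + logr m / e) * t +
     t ^ 2 / 2 * (S + Bq - zim m 0 / e) - Bq * (kap ^ 2 - eta ^ 2 + t ^ 2) / 2 -
     - A * (kap * eta))) by (unfold t, e; field; lra).
  apply Rle_trans with (1 := Rabs_triang _ _).
  rewrite Rplus_comm; apply Rplus_le_compat; assumption.
Qed.

(** * Fourier representation of the q-Airy function *)

(* (-1)^j q^(j (j + 1) / 2) / (q; q)_j, Euler's coefficients of (q w; q)_oo. *)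
Fixpoint euler_coef (q : R) (j : nat) : R :=
  match j with O => 1 | S i => euler_coef q i * (- q ^ S i / (1 - q ^ S i)) end.

(* The ratio of the j-th coefficient of (1 - q w) ... (1 - q^n w) to Euler's. *)
Fixpoint trunc_ratio (q : R) (n j : nat) : R :=
  match j with O => 1 | S i => trunc_ratio q n i * (1 - q ^ (n - i)) end.

Definition trunc_coef (q : R) (n j : nat) : R := euler_coef q j * trunc_ratio q n j.

Lemma pow_lt_1 (q : R) (n : nat) : 0 < q < 1 -> 0 < q ^ S n < 1.
Proof.
intros hq; split; [pos|]; induction n as [|n IH]; [simpl; lra|].
assert (0 < q ^ S n) by pos; simpl in *; nra.
Qed.

Lemma pow_le_1 (q : R) (n : nat) : 0 < q < 1 -> 0 < q ^ n <= 1.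
Proof.
intros hq; destruct n as [|n]; [simpl; lra | assert (h := pow_lt_1 q n hq); lra].
Qed.

(** The factor with i = n is 1 - q^0 = 0; it kills everything after it, where the subtraction n - i
    is truncated. *)
Lemma trunc_ratio_zero (q : R) (n j : nat) : (n < j)%nat -> trunc_ratio q n j = 0.
Proof.
induction j as [|j IH]; [lia|]; intros h; simpl.
destruct (Nat.eq_dec n j) as [->|hn].
- rewrite Nat.sub_diag; simpl; ring.
- rewrite IH by lia; ring.
Qed.

Lemma trunc_ratio_succ (q : R) (n j : nat) :
  trunc_ratio q (S n) (S j) = (1 - q ^ S n) * trunc_ratio q n j.
Proof.
induction j as [|j IH]; [simpl; ring|].
change (trunc_ratio q (S n) (S (S j))) with
  (trunc_ratio q (S n) (S j) * (1 - q ^ (S n - S j))).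
rewrite IH; simpl trunc_ratio; replace (S n - S j)%nat with (n - j)%nat by lia; ring.
Qed.

(** The q-Pascal rule: the effect on coefficients of multiplying by the next factor 1 - q^(n+1)
    w. *)
Lemma trunc_coef_succ (q : R) (n j : nat) : 0 < q < 1 ->
  trunc_coef q (S n) (S j) = trunc_coef q n (S j) - q ^ S n * trunc_coef q n j.
Proof.
intros hq; unfold trunc_coef; rewrite trunc_ratio_succ.
assert (h := pow_lt_1 q j hq).
cbn [euler_coef trunc_ratio].
destruct (le_lt_dec j n) as [hj|hj].
- assert (E : q ^ S n = q ^ S j * q ^ (n - j)) by (rewrite <- pow_add; f_equal; lia).
  rewrite E; field; lra.
- rewrite (trunc_ratio_zero q n j hj); ring.
Qed.

Fixpoint csum (f : nat -> C) (n : nat) : C :=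
  match n with O => RtoC 0 | S k => Cplus (csum f k) (f k) end.

Lemma csum_ext (f g : nat -> C) (n : nat) :
  (forall k, f k = g k) -> csum f n = csum g n.
Proof. intros H; induction n as [|n IH]; simpl; [reflexivity | rewrite IH, H; reflexivity]. Qed.

Lemma csum_Sl (f : nat -> C) (n : nat) :
  csum f (S n) = Cplus (f O) (csum (fun k => f (S k)) n).
Proof.
induction n as [|n IH]; [simpl; ring|].
change (csum f (S (S n))) with (Cplus (csum f (S n)) (f (S n))).
rewrite IH; simpl; ring.
Qed.

Lemma csum_plus (f g : nat -> C) (n : nat) :
  csum (fun k => Cplus (f k) (g k)) n = Cplus (csum f n) (csum g n).
Proof. induction n as [|n IH]; simpl; [|rewrite IH]; ring. Qed.

Lemma csum_scal (c : C) (f : nat -> C) (n : nat) :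
  csum (fun k => Cmult c (f k)) n = Cmult c (csum f n).
Proof. induction n as [|n IH]; simpl; [|rewrite IH]; ring. Qed.

Lemma cprod_q_expand (q : R) (w : C) (n N : nat) : 0 < q < 1 -> (n < N)%nat ->
  csum (fun j => Cmult (RtoC (trunc_coef q n j)) (Cpow w j)) N =
  cprod (fun k => Cminus (RtoC 1) (Cmult (RtoC (q ^ S k)) w)) n.
Proof.
intros hq; revert N; induction n as [|n IH]; intros N hN.
- destruct N as [|N]; [lia|]; rewrite csum_Sl.
  rewrite (csum_ext _ (fun k => Cmult (RtoC 0) (RtoC 0))), csum_scal.
  + unfold trunc_coef; simpl; rewrite Rmult_1_r; ring.
  + intros k; unfold trunc_coef; rewrite trunc_ratio_zero by lia.
    rewrite Rmult_0_r; ring.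
- destruct N as [|N]; [lia|].
  rewrite csum_Sl, (csum_ext _ (fun j =>
    Cplus (Cmult (RtoC (trunc_coef q n (S j))) (Cpow w (S j)))
     (Cmult (Cmult (RtoC (- q ^ S n)) w) (Cmult (RtoC (trunc_coef q n j)) (Cpow w j))))).
  2:{ intros j; rewrite trunc_coef_succ by exact hq.
      unfold Rminus; rewrite RtoC_plus, RtoC_opp, RtoC_mult, RtoC_opp.
      cbn [Cpow]; ring. }
  rewrite csum_plus, csum_scal, (IH N) by lia.
  assert (E := IH (S N) ltac:(lia)); rewrite csum_Sl in E.
  replace (trunc_coef q (S n) 0) with (trunc_coef q n 0) by reflexivity.
  rewrite Cplus_assoc, E; cbn [cprod]; rewrite RtoC_opp; ring.
Qed.

Lemma Cpow_cexp (R t : R) (j : nat) : Cpow (cexp R t) j = cexp (INR j * R) (INR j * t).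
Proof.
induction j as [|j IH].
- simpl; rewrite !Rmult_0_l; symmetry; apply cexp_0.
- cbn [Cpow]; rewrite IH, cexp_plus, S_INR; f_equal; ring.
Qed.

(** The real part of e^(- i b t) (q e^(rho + i t); q)_n, written as a trigonometric polynomial so
    that it can be integrated term by term. *)
Definition trunc_fourier (q rho b t : R) (n : nat) : R :=
  psum (fun j => trunc_coef q n j * exp (INR j * rho) * cos ((INR j - b) * t)) (S n).

Lemma trunc_fourier_prod (q rho b t : R) (n : nat) : 0 < q < 1 ->
  trunc_fourier q rho b t n =
  fst (Cmult (cexp 0 (- (b * t)))
    (cprod (fun k => Cminus (RtoC 1) (Cmult (RtoC (q ^ S k)) (cexp rho t))) n)).
Proof.
intros hq; rewrite <- (cprod_q_expand q (cexp rho t) n (S n) hq) by lia.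
rewrite <- csum_scal; unfold trunc_fourier; generalize (S n) as N.
induction N as [|N IH]; [reflexivity|].
cbn [psum csum]; rewrite IH, Cpow_cexp; simpl.
f_equal; unfold cexp; simpl.
replace ((INR N - b) * t) with (INR N * t + - (b * t)) by ring.
rewrite cos_plus, exp_0; ring.
Qed.

(** With q = exp (- e), a finite stand-in for A_q(sqrt q e^(2 rho)): the coefficients of (q w; q)_n
    take the place of Euler's. *)
Definition trunc_airy (q rho e : R) (n : nat) : R :=
  psum (fun j => trunc_coef q n j * exp (- (e * INR j ^ 2 / 2) + 2 * INR j * rho)) (S n).

Lemma psum_lim (f : nat -> R -> R) (l : nat -> R) (n : nat) :
  (forall k, is_lim (f k) p_infty (l k)) ->
  is_lim (fun T => psum (fun k => f k T) n) p_infty (psum l n).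
Proof.
intros H; induction n as [|n IH]; simpl; [apply is_lim_const|].
apply (is_lim_plus' _ _ p_infty _ _ IH (H n)).
Qed.

Lemma RInt_psum (f : nat -> R -> R) (a b : R) (n : nat) :
  (forall k t, continuous (f k) t) ->
  RInt (fun t => psum (fun k => f k t) n) a b = psum (fun k => RInt (f k) a b) n /\
  (forall t, continuous (fun t => psum (fun k => f k t) n) t).
Proof.
intros H; induction n as [|n [IH1 IH2]]; simpl.
- split; [rewrite RInt_const_R; toR; ring | intros; apply continuous_const].
- split.
  + rewrite RInt_plus_R, IH1 by (apply ex_RInt_everywhere; auto); reflexivity.
  + intros t; apply (continuous_plus (V := R_NormedModule)); auto.
Qed.

(** The j-th term has frequency b = (j - rho / e) r, and exp (- b^2 / 2) is q^(j^2 / 2) e^(j rho)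
    e^(- rho^2 / (2e)). The factor sqrt (2 PI) / 2 belongs to the half line. *)
Lemma trunc_airy_integral (rho r : R) (n : nat) (q := exp (- r ^ 2)) : 0 < r ->
  is_lim (RInt (fun s => exp (- s ^ 2 / 2) * trunc_fourier q rho (rho / r ^ 2) (r * s) n) 0)
    p_infty (sqrt (2 * PI) / 2 * exp (- (rho ^ 2 / (2 * r ^ 2))) * trunc_airy q rho (r ^ 2) n).
Proof.
intros hr.
set (b := fun j => (INR j - rho / r ^ 2) * r).
set (c := fun j => trunc_coef q n j * exp (INR j * rho)).
set (f := fun j s => c j * (exp (- s ^ 2 / 2) * cos (b j * s))).
assert (Cf0 : forall j t, continuous (fun s => exp (- s ^ 2 / 2) * cos (b j * s)) t)
  by (intros; contd; trivial).
assert (Cf : forall j t, continuous (f j) t) by (intros; unfold f; contd; trivial).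
apply is_lim_ext with (fun T => psum (fun j => RInt (f j) 0 T) (S n)).
{ intros T; rewrite <- (proj1 (RInt_psum f 0 T (S n) Cf)).
  apply RInt_ext; intros s _; unfold trunc_fourier.
  rewrite <- psum_scal; apply psum_ext; intros j; unfold f, c, b.
  replace ((INR j - rho / r ^ 2) * r * s) with ((INR j - rho / r ^ 2) * (r * s)) by ring.
  toR; ring. }
replace (_ * trunc_airy q rho (r ^ 2) n) with
  (psum (fun j => c j * (sqrt (2 * PI) / 2 * exp (- b j ^ 2 / 2))) (S n)).
- apply psum_lim; intros j.
  apply is_lim_ext with (fun T => c j * RInt (fun s => exp (- s ^ 2 / 2) * cos (b j * s)) 0 T).
  + intros T; symmetry; apply RInt_scal_R, ex_RInt_everywhere, Cf0.
  + apply (is_lim_scal_l _ (c j) p_infty (sqrt (2 * PI) / 2 * exp (- b j ^ 2 / 2))).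
    apply gauss_fourier.
- unfold trunc_airy; rewrite <- psum_scal; apply psum_ext; intros j; unfold c, b.
  replace (- (r ^ 2 * INR j ^ 2 / 2) + 2 * INR j * rho) with
    (INR j * rho + - ((INR j - rho / r ^ 2) * r) ^ 2 / 2 + rho ^ 2 / (2 * r ^ 2))
    by (field; lra).
  rewrite (exp_plus (_ + _)), (exp_plus (INR j * rho)), exp_Ropp.
  field; apply Rgt_not_eq, exp_pos.
Qed.

(** One minus a product of numbers 1 - q^(n-i) is at most the sum of the q^(n-i). The factor q^n is
    the gain in n; the growth in j is left to the series. *)
Lemma trunc_ratio_bound (q : R) (n j : nat) : 0 < q < 1 ->
  0 <= trunc_ratio q n j <= 1 /\ 1 - trunc_ratio q n j <= q ^ n * (INR j * (/ q) ^ j).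
Proof.
intros hq; induction j as [|j [IH1 IH2]]; [simpl; lra|].
cbn [trunc_ratio].
assert (h := pow_le_1 q (n - j) hq).
assert (qj : 0 < q ^ j) by pos; assert (qn : 0 < q ^ n) by pos.
split; [split; nra|].
assert (A : q ^ (n - j) <= q ^ n * (/ q) ^ j).
{ rewrite pow_inv; apply Rmult_le_reg_r with (q ^ j); [exact qj|].
  rewrite Rmult_assoc, Rinv_l, Rmult_1_r by lra.
  destruct (le_lt_dec j n) as [hj|hj].
  - rewrite <- pow_add; right; f_equal; lia.
  - replace (n - j)%nat with 0%nat by lia; rewrite pow_O, Rmult_1_l.
    replace (q ^ j) with (q ^ n * q ^ (j - n)) by (rewrite <- pow_add; f_equal; lia).
    assert (g := pow_le_1 q (j - n) hq); nra. }
assert (i1 : 1 <= / q) by (rewrite <- Rinv_1; apply Rinv_le_contravar; lra).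
assert (ij : 0 < (/ q) ^ j) by (apply pow_lt; lra).
rewrite S_INR; cbn [pow].
apply Rle_trans with (q ^ n * ((INR j + 1) * (/ q) ^ j)); [nra|].
apply Rmult_le_compat_l; [lra|]; apply Rmult_le_compat_l; [generalize (pos_INR j); lra|].
nra.
Qed.

Definition airy_term (q rho e : R) (j : nat) : R :=
  euler_coef q j * exp (- (e * INR j ^ 2 / 2) + 2 * INR j * rho).

(** The weight is the growth in j of the truncation error. The ratio of consecutive terms is still
    O(q^j), so the series converges. *)
Lemma airy_term_series (rho e : R) (q := exp (- e)) : 0 < e ->
  ex_series (fun j => Rabs (airy_term q rho e j) * ((INR j + 1) * (/ q) ^ j)).
Proof.
intros he; assert (q0 : 0 < q < 1).
{ split; [apply exp_pos | unfold q; rewrite <- exp_0; apply exp_increasing; lra]. }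
assert (nz : forall j, euler_coef q j <> 0).
{ induction j as [|j IH]; cbn [euler_coef]; [lra|].
  assert (h := pow_lt_1 q j q0); apply Rmult_integral_contrapositive; split; [exact IH|].
  apply Rmult_integral_contrapositive; split; [lra|]; apply Rinv_neq_0_compat; lra. }
assert (tp : forall j, 0 < Rabs (airy_term q rho e j)).
{ intros j; apply Rabs_pos_lt; unfold airy_term.
  apply Rmult_integral_contrapositive; split; [apply nz | apply Rgt_not_eq, exp_pos]. }
assert (jp : forall j, 0 < INR j + 1) by (intros j; generalize (pos_INR j); lra).
assert (ip : forall j, 0 < (/ q) ^ j) by (intros j; apply pow_lt, Rinv_0_lt_compat; lra).
set (c := fun j => Rabs (airy_term q rho e j) * ((INR j + 1) * (/ q) ^ j)).
apply ex_series_ext with (fun j => Rabs (c j)).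
{ intros j; apply Rabs_pos_eq; unfold c; specialize (tp j); specialize (jp j).
  specialize (ip j); apply Rlt_le; pos. }
apply (ex_series_DAlembert c 0); [lra | |]; unfold c; clear c.
{ intros j; apply Rgt_not_eq, Rmult_lt_0_compat; [apply tp|].
  apply Rmult_lt_0_compat; [apply jp | apply ip]. }
apply (is_lim_seq_le_le (fun _ => 0) _ (fun j => 2 * exp (2 * rho) / (1 - q) * q ^ j)).
2:{ apply is_lim_seq_const. }
2:{ replace (Finite 0) with (Rbar_mult (2 * exp (2 * rho) / (1 - q)) 0)
      by (simpl; f_equal; ring).
    apply is_lim_seq_scal_l, is_lim_seq_geom; rewrite Rabs_pos_eq; lra. }
intros j; split; [apply Rabs_pos|].
assert (E : airy_term q rho e (S j) = airy_term q rho e j *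
  (- (q ^ S j / (1 - q ^ S j)) * exp (- (e * (2 * INR j + 1) / 2) + 2 * rho))).
{ unfold airy_term; cbn [euler_coef]; rewrite S_INR.
  replace (- (e * (INR j + 1) ^ 2 / 2) + 2 * (INR j + 1) * rho) with
    ((- (e * INR j ^ 2 / 2) + 2 * INR j * rho) +
     (- (e * (2 * INR j + 1) / 2) + 2 * rho)) by field.
  rewrite exp_plus; unfold Rdiv; ring. }
assert (h := pow_lt_1 q j q0).
assert (hj : q ^ S j = q * q ^ j) by reflexivity.
set (z := q ^ S j / (1 - q ^ S j) * exp (- (e * (2 * INR j + 1) / 2) + 2 * rho)).
assert (z0 : 0 < z) by (unfold z; pos).
assert (Rabs (airy_term q rho e (S j)) = Rabs (airy_term q rho e j) * z) as ->.
{ rewrite E, Rabs_mult; f_equal; rewrite <- (Rabs_pos_eq z) by lra.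
  rewrite <- Rabs_Ropp; f_equal; unfold z; ring. }
rewrite S_INR; cbn [pow].
specialize (tp j); specialize (jp j); specialize (ip j).
replace (_ / _) with (z * / q * ((INR j + 2) / (INR j + 1))) by (field; lra).
rewrite Rabs_pos_eq by (apply Rlt_le; pos).
assert (b1 : (INR j + 2) / (INR j + 1) <= 2).
{ apply Rmult_le_reg_r with (INR j + 1); [lra|].
  unfold Rdiv; rewrite Rmult_assoc, Rinv_l by lra; generalize (pos_INR j); lra. }
assert (b2 : z <= q ^ S j / (1 - q) * exp (2 * rho)).
{ unfold z; apply Rmult_le_compat.
  - apply Rlt_le; pos.
  - apply Rlt_le, exp_pos.
  - apply Rmult_le_compat_l; [lra|]; apply Rinv_le_contravar; [lra|].
    rewrite hj; assert (g := pow_le_1 q j q0); nra.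
  - apply exp_mono; assert (0 <= e * (2 * INR j + 1) / 2); [|lra].
    generalize (pos_INR j); intros; apply Rlt_le; pos. }
replace (2 * exp (2 * rho) / (1 - q) * q ^ j) with
  (q ^ S j / (1 - q) * exp (2 * rho) * / q * 2) by (rewrite hj; field; lra).
assert (0 < / q) by pos.
apply Rmult_le_compat.
- apply Rlt_le; pos.
- apply Rlt_le; generalize (pos_INR j); intros; pos.
- apply Rmult_le_compat_r; lra.
- exact b1.
Qed.

Lemma exp_pow (x : R) (k : nat) : exp x ^ k = exp (INR k * x).
Proof.
induction k as [|k IH]; [simpl; rewrite Rmult_0_l, exp_0; reflexivity|].
cbn [pow]; rewrite IH, <- exp_plus, S_INR; f_equal; ring.
Qed.

(** q^(j^2) = q^(j(j+1)/2) q^(j^2/2) q^(-j/2): the first factor belongs to Euler's coefficient, the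
    second is the Gaussian weight, and the third is cancelled by the sqrt q of the argument. *)
Lemma qAiry_term (rho e : R) (j : nat) (q := exp (- e)) : 0 < e ->
  q ^ (j ^ 2)%nat / qpoch q j * (- (sqrt q * exp (2 * rho))) ^ j = airy_term q rho e j.
Proof.
intros he; assert (q0 : 0 < q < 1).
{ split; [apply exp_pos | unfold q; rewrite <- exp_0; apply exp_increasing; lra]. }
assert (sq : sqrt q = exp (- (e / 2))).
{ rewrite <- (sqrt_square (exp (- (e / 2)))) by (apply Rlt_le, exp_pos).
  rewrite <- exp_plus; unfold q; do 2 f_equal; field. }
unfold airy_term; rewrite sq, <- exp_plus; unfold q at 1; rewrite exp_pow, pow_INR.
assert (qp : forall k, 0 < qpoch q k).
{ induction k as [|k IH]; simpl qpoch; [lra|].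
  assert (h := pow_lt_1 q k q0); apply Rmult_lt_0_compat; [exact IH | simpl in *; lra]. }
assert (EC : euler_coef q j * qpoch q j = (-1) ^ j * exp (- (e * INR j * (INR j + 1) / 2))).
{ induction j as [|j IH].
  - simpl; rewrite Rmult_0_r, Rmult_0_l, Rdiv_0_l, Ropp_0, exp_0; ring.
  - cbn [euler_coef qpoch]; assert (h := pow_lt_1 q j q0).
    replace (_ * _ * (_ * _)) with (euler_coef q j * qpoch q j * - q ^ S j) by (field; lra).
    rewrite IH; unfold q; rewrite exp_pow; rewrite S_INR; cbn [pow].
    replace (- (e * (INR j + 1) * (INR j + 1 + 1) / 2)) with
      (- (e * INR j * (INR j + 1) / 2) + (INR j + 1) * - e) by field.
    rewrite exp_plus; ring. }
replace (euler_coef q j) with ((-1) ^ j * exp (- (e * INR j * (INR j + 1) / 2)) / qpoch q j)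
  by (rewrite <- EC; field; apply Rgt_not_eq, qp).
replace (- exp (- (e / 2) + 2 * rho)) with (-1 * exp (- (e / 2) + 2 * rho)) by ring.
rewrite Rpow_mult_distr, exp_pow.
replace (INR j ^ 2 * - e) with (- (e * INR j * (INR j + 1) / 2) + (- (e * INR j ^ 2 / 2)
  + e * INR j / 2)) by field.
replace (INR j * (- (e / 2) + 2 * rho)) with (- (e * INR j / 2) + 2 * INR j * rho) by field.
rewrite !exp_plus, (exp_Ropp (e * INR j / 2)).
field; split; apply Rgt_not_eq; [apply qp | apply exp_pos].
Qed.

Lemma trunc_airy_lim (rho e : R) (q := exp (- e)) : 0 < e ->
  is_lim_seq (trunc_airy q rho e) (qAiry q (sqrt q * exp (2 * rho))).
Proof.
intros he; assert (q0 : 0 < q < 1).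
{ split; [apply exp_pos | unfold q; rewrite <- exp_0; apply exp_increasing; lra]. }
set (a := airy_term q rho e).
set (b := fun j => Rabs (a j) * ((INR j + 1) * (/ q) ^ j)).
assert (Sb : ex_series b) by (apply airy_term_series, he).
assert (i1 : 1 <= / q) by (rewrite <- Rinv_1; apply Rinv_le_contravar; lra).
assert (ij : forall j, 1 <= (/ q) ^ j) by (intros; apply pow_R1_Rle, i1).
assert (ab : forall j, Rabs (a j) <= b j).
{ intros j; unfold b; rewrite <- (Rmult_1_r (Rabs (a j))) at 1.
  apply Rmult_le_compat_l; [apply Rabs_pos|].
  specialize (ij j); generalize (pos_INR j); nra. }
assert (Sa : ex_series a).
{ apply ex_series_Rabs, (ex_series_le (V := R_CompleteNormedModule) _ b); [|exact Sb].
  intros j; unfold norm; simpl; unfold abs; simpl; rewrite Rabs_Rabsolu; apply ab. }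
assert (sp : forall (f : nat -> R) n, sum_n f n = psum f (S n)).
{ intros f n; induction n as [|n IH]; [rewrite sum_O; simpl; ring|].
  rewrite sum_Sn, IH; reflexivity. }
unfold qAiry; rewrite (Series_ext _ a) by (intros; apply qAiry_term, he).
assert (L : is_lim_seq (fun n => psum a (S n)) (Series a)).
{ apply is_lim_seq_ext with (sum_n a); [intros; apply sp | apply Series_correct, Sa]. }
assert (bp : forall j, 0 <= b j) by (intros j; apply Rle_trans with (2 := ab j), Rabs_pos).
assert (bound : forall n, Rabs (trunc_airy q rho e n - psum a (S n)) <= q ^ n * Series b).
{ intros n; unfold trunc_airy.
  replace (_ - _) with (psum (fun j => - (a j * (1 - trunc_ratio q n j))) (S n)).
  2:{ rewrite (psum_ext _ (fun j => trunc_coef q n j *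
        exp (- (e * INR j ^ 2 / 2) + 2 * INR j * rho) + -1 * a j)).
      - rewrite psum_plus, psum_scal; ring.
      - intros j; unfold a, airy_term, trunc_coef; ring. }
  apply Rle_trans with (1 := psum_abs _ _).
  apply Rle_trans with (psum (fun j => q ^ n * b j) (S n)).
  - apply psum_le; intros j; rewrite Rabs_Ropp, Rabs_mult.
    destruct (trunc_ratio_bound q n j q0) as [h1 h2].
    rewrite (Rabs_pos_eq (1 - _)) by lra; unfold b.
    replace (q ^ n * (Rabs (a j) * ((INR j + 1) * (/ q) ^ j))) with
      (Rabs (a j) * (q ^ n * ((INR j + 1) * (/ q) ^ j))) by ring.
    apply Rmult_le_compat_l; [apply Rabs_pos|].
    apply Rle_trans with (1 := h2); apply Rmult_le_compat_l; [apply Rlt_le; pos|].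
    apply Rmult_le_compat_r; [specialize (ij j); lra | lra].
  - rewrite psum_scal; apply Rmult_le_compat_l; [apply Rlt_le; pos|].
    rewrite <- sp.
    apply (is_lim_seq_incr_compare (sum_n b)); [apply Series_correct, Sb|].
    intros k; rewrite sum_Sn; unfold plus; simpl; specialize (bp (S k)); lra. }
assert (Z : is_lim_seq (fun n => q ^ n * Series b) 0).
{ replace (Finite 0) with (Rbar_mult 0 (Series b)) by (simpl; f_equal; ring).
  apply is_lim_seq_scal_r, is_lim_seq_geom; rewrite Rabs_pos_eq; lra. }
apply (is_lim_seq_le_le (fun n => psum a (S n) - q ^ n * Series b) _
  (fun n => psum a (S n) + q ^ n * Series b)).
- intros n; generalize (proj1 (Rabs_le_between _ _) (bound n)); lra.
- replace (Finite (Series a)) with (Finite (Series a - 0)) by (f_equal; ring).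
  apply is_lim_seq_minus'; assumption.
- replace (Finite (Series a)) with (Finite (Series a + 0)) by (f_equal; ring).
  apply is_lim_seq_plus'; assumption.
Qed.

(** * Saddle point asymptotics *)

Definition log_modulus (m r : R) (n : nat) : R :=
  psum (fun k => lmod m (INR k * r ^ 2 + r ^ 2)) n.

(** Minus the argument of the integrand at the saddle: the first term comes from e^(- i a t / e),
    the sum from the factors. *)
Definition saddle_phase (m r : R) (n : nat) : R :=
  logr m * atan m / r ^ 2 + psum (fun k => phase m (INR k * r ^ 2 + r ^ 2)) n.

(* The Fourier integrand recentred at the saddle theta = atan m, divided by its size
   there. *)
Definition saddle_integrand (m r : R) (n : nat) (s : R) : R :=
  exp (- (atan m * s / r) - s ^ 2 / 2) *
  fst (Cmult (cexp 0 (- (saddle_phase m r n + logr m * s / r)))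
    (cprod (fun k => zfac m (r * s) (INR k * r ^ 2 + r ^ 2)) n)).

Lemma exp_logr_cos (m : R) : exp (logr m) * cos (atan m) = 1 / 2 /\
  exp (logr m) * sin (atan m) = m / 2.
Proof.
assert (h : 0 < 1 + m ^ 2) by nra.
assert (E : exp (logr m) = sqrt (1 + m ^ 2) / 2).
{ rewrite <- (exp_ln (sqrt (1 + m ^ 2) / 2)).
  - f_equal; unfold logr.
    replace ((1 + m ^ 2) / 4) with ((sqrt (1 + m ^ 2) / 2) * (sqrt (1 + m ^ 2) / 2)).
    + rewrite ln_mult; [field | |]; assert (g := sqrt_lt_R0 _ h); lra.
    + replace (_ / 2 * _) with ((sqrt (1 + m ^ 2) * sqrt (1 + m ^ 2)) / 4) by field.
      rewrite sqrt_sqrt; lra.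
  - assert (g := sqrt_lt_R0 _ h); lra. }
assert (g := sqrt_lt_R0 _ h).
rewrite E, cos_atan, sin_atan; replace (1 + m²) with (1 + m ^ 2) by (unfold Rsqr; ring).
split; field; lra.
Qed.

(** Each factor at the angle theta + r s is its value at theta, in polar form, times [zfac]; the
    values at theta make up the modulus and phase taken out. *)
Lemma fourier_recentre (m r s : R) (n : nat) (q := exp (- r ^ 2)) : 0 < r ->
  exp (- (atan m / r + s) ^ 2 / 2) *
    trunc_fourier q (logr m) (logr m / r ^ 2) (r * (atan m / r + s)) n =
  exp (- (atan m ^ 2 / (2 * r ^ 2)) + log_modulus m r n) * saddle_integrand m r n s.
Proof.
intros hr; assert (r2 : 0 < r ^ 2) by pos.
assert (q0 : 0 < q < 1).
{ split; [apply exp_pos | unfold q; rewrite <- exp_0; apply exp_increasing; lra]. }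
rewrite trunc_fourier_prod by exact q0.
destruct (exp_logr_cos m) as [ec es].
rewrite (cprod_ext _ (fun k => Cmult (cexp (lmod m (INR k * r ^ 2 + r ^ 2))
    (- phase m (INR k * r ^ 2 + r ^ 2))) (zfac m (r * s) (INR k * r ^ 2 + r ^ 2)))).
2:{ intros k; set (u := INR k * r ^ 2 + r ^ 2).
    assert (hu : 0 <= u) by (unfold u; generalize (pos_INR k); nra).
    rewrite fac_polar, fac_rotate by exact hu.
    replace (q ^ S k) with (exp (- u)).
    2:{ unfold q, u; rewrite exp_pow, S_INR; f_equal; ring. }
    replace (r * (atan m / r + s)) with (atan m + r * s) by (field; lra).
    unfold cexp, Cminus, Cplus, Copp, Cmult, RtoC; simpl fst; simpl snd.
    rewrite cos_plus, sin_plus; apply injective_projections; simpl fst; simpl snd.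
    - replace (exp (logr m) * (cos (atan m) * cos (r * s) - sin (atan m) * sin (r * s)))
        with (exp (logr m) * cos (atan m) * cos (r * s) -
          exp (logr m) * sin (atan m) * sin (r * s)) by ring.
      rewrite ec, es; field.
    - replace (exp (logr m) * (sin (atan m) * cos (r * s) + cos (atan m) * sin (r * s)))
        with (exp (logr m) * sin (atan m) * cos (r * s) +
          exp (logr m) * cos (atan m) * sin (r * s)) by ring.
      rewrite ec, es; field. }
rewrite cprod_mult, cprod_cexp.
unfold saddle_integrand; set (Z := cprod (fun k => zfac _ _ _) n).
fold (log_modulus m r n).
rewrite Cmult_assoc, cexp_plus.
set (Lam := log_modulus m r n).
set (Phi := psum (fun k => - phase m (INR k * r ^ 2 + r ^ 2)) n).
assert (HPhi : Phi = - psum (fun k => phase m (INR k * r ^ 2 + r ^ 2)) n).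
{ unfold Phi; rewrite (psum_ext _ (fun k => -1 * phase m (INR k * r ^ 2 + r ^ 2)))
    by (intros; ring); rewrite psum_scal; ring. }
replace (- (saddle_phase m r n + logr m * s / r)) with
  (- (logr m / r ^ 2 * (r * (atan m / r + s))) + Phi).
2:{ rewrite HPhi; unfold saddle_phase; field; lra. }
set (B := _ + Phi); clearbody B Lam Z.
replace (- (atan m / r + s) ^ 2 / 2) with
  (- (atan m ^ 2 / (2 * r ^ 2)) + (- (atan m * s / r) - s ^ 2 / 2)) by (field; lra).
unfold cexp, Cmult; simpl fst; simpl snd; rewrite !exp_plus, exp_0; ring.
Qed.

Lemma trunc_fourier_continuous (q rho b t : R) (n : nat) :
  continuous (fun t => trunc_fourier q rho b t n) t.
Proof.
apply (RInt_psum (fun j t => trunc_coef q n j * exp (INR j * rho) * cos ((INR j - b) * t))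
  0 1 (S n)); intros; contd; trivial.
Qed.

(** Continuity is carried over from the trigonometric polynomial, so the complex product need not be
    treated. *)
Lemma saddle_integrand_continuous (m r s : R) (n : nat) : 0 < r ->
  continuous (saddle_integrand m r n) s.
Proof.
intros hr; set (E := exp (- (atan m ^ 2 / (2 * r ^ 2)) + log_modulus m r n)).
assert (hE : 0 < E) by apply exp_pos.
apply continuous_ext with (fun s => / E * (exp (- (atan m / r + s) ^ 2 / 2) *
    trunc_fourier (exp (- r ^ 2)) (logr m) (logr m / r ^ 2) (r * (atan m / r + s)) n)).
{ intros x; rewrite fourier_recentre by exact hr; fold E; toR; field; lra. }
apply (continuous_scal_r (K := R_AbsRing) (V := R_NormedModule) (/ E)).
apply (continuous_mult (K := R_AbsRing)); [contd; trivial|].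
apply (continuous_comp (fun s => r * (atan m / r + s))
  (fun t => trunc_fourier (exp (- r ^ 2)) (logr m) (logr m / r ^ 2) t n)).
- contd; trivial.
- apply trunc_fourier_continuous.
Qed.

Lemma fst_cexp_mult_le (b : R) (Z : C) : Rabs (fst (Cmult (cexp 0 b) Z)) <= Cmod Z.
Proof.
apply Rle_trans with (1 := re_le_Cmod _); rewrite Cmod_mult.
replace (Cmod (cexp 0 b)) with 1; [lra|].
unfold Cmod, cexp; simpl fst; simpl snd; rewrite exp_0.
replace (_ + _) with 1; [symmetry; apply sqrt_1|].
assert (h := sin2_cos2 b); unfold Rsqr in h; simpl; lra.
Qed.

(** With t = r s the exponent is 1/r^2 times the quantity of [saddle_bound], up to a constant, so
    the quadratic bound in t becomes one in s with the same c. *)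
Lemma saddle_integrand_bound (m : R) : 0 < m -> exists K c, 0 < K /\ 0 < c /\
  forall r n s, 0 < r <= 1 -> exp (- (INR n * r ^ 2)) <= r ^ 2 -> - (atan m / r) <= s ->
  Rabs (saddle_integrand m r n s) <= K * exp (- c * s ^ 2).
Proof.
intros hm; destruct (zfac_prod_bound m hm) as [C [hC HZ]].
destruct (saddle_bound m hm) as [c [hc HS]].
exists (exp C), c; split; [apply exp_pos | split; [exact hc|]]; intros r n s hr hn hs.
assert (he : 0 < r ^ 2 <= 1) by (split; [pos | nra]).
unfold saddle_integrand; rewrite Rabs_mult, Rabs_pos_eq by (apply Rlt_le, exp_pos).
apply Rle_trans with (exp (- (atan m * s / r) - s ^ 2 / 2) *
  exp (atan m / r ^ 2 * (sin (r * s) + (1 - cos (r * s)) / m) + C)).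
- apply Rmult_le_compat_l; [apply Rlt_le, exp_pos|].
  apply Rle_trans with (1 := fst_cexp_mult_le _ _), HZ; assumption.
- rewrite <- !exp_plus; apply exp_mono.
  assert (h := HS (r * s)).
  assert (ht : - atan m <= r * s).
  { apply Rmult_le_reg_l with (/ r); [pos|].
    replace (/ r * - atan m) with (- (atan m / r)) by (field; lra).
    replace (/ r * (r * s)) with s by (field; lra); exact hs. }
  specialize (h ht).
  set (x := sin (r * s) + (1 - cos (r * s)) / m) in *.
  replace (- (atan m * s / r) - s ^ 2 / 2 + (atan m / r ^ 2 * x + C)) with
    (C + / r ^ 2 * (- atan m * (r * s) - (r * s) ^ 2 / 2 + atan m * x)) by (field; lra).
  replace (- c * s ^ 2) with (/ r ^ 2 * (- c * (r * s) ^ 2)) by (field; lra).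
  apply Rplus_le_compat_l, Rmult_le_compat_l; [apply Rlt_le; pos | exact h].
Qed.

Lemma cexp_re_perturb (A d1 d2 d : R) : d <= 1 -> Rabs d1 <= d -> Rabs d2 <= d ->
  Rabs (exp d1 * cos (A + d2) - cos A) <= 6 * d.
Proof.
intros hd h1 h2.
assert (L : forall x, Rabs x <= 1 -> Rabs (exp x - 1) <= 3 * Rabs x).
{ intros x hx; rewrite <- exp_0 at 1.
  destruct (MVT_gen exp 0 x exp) as [c [hc ->]].
  - intros; auto_derive; [trivial | ring].
  - intros; apply derivable_continuous_pt; reg.
  - rewrite Rminus_0_r, Rabs_mult; apply Rmult_le_compat_r; [apply Rabs_pos|].
    rewrite Rabs_pos_eq by (apply Rlt_le, exp_pos).
    apply Rle_trans with (2 := exp_le_3), exp_mono.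
    revert hc hx; unfold Rmin, Rmax, Rabs; destruct (Rle_dec 0 x); destruct Rcase_abs; lra. }
assert (L2 : Rabs (cos (A + d2) - cos A) <= 1 * Rabs d2).
{ destruct (MVT_gen cos A (A + d2) (fun x => - sin x)) as [c [hc ->]].
  - intros; auto_derive; [trivial | ring].
  - intros; apply derivable_continuous_pt; reg.
  - replace (A + d2 - A) with d2 by ring; rewrite Rabs_mult, Rabs_Ropp.
    apply Rmult_le_compat_r; [apply Rabs_pos | apply Rabs_le, SIN_bound]. }
assert (h3 := L d1 ltac:(lra)).
replace (exp d1 * cos (A + d2) - cos A) with
  ((exp d1 - 1) * cos (A + d2) + (cos (A + d2) - cos A)) by ring.
apply Rle_trans with (1 := Rabs_triang _ _); rewrite Rabs_mult.
assert (Rabs (exp d1 - 1) * Rabs (cos (A + d2)) <= 3 * d * 1).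
{ apply Rmult_le_compat; try apply Rabs_pos; [lra | apply Rabs_le, COS_bound]. }
assert (0 <= d) by (apply Rle_trans with (2 := h1), Rabs_pos).
lra.
Qed.

(** The terms of order 1/r in the logarithm of the product cancel those of the integrand, in modulus
    and in phase: this is the saddle condition. Only the quadratic terms survive. *)
Lemma saddle_integrand_local (m B delta : R) : 0 < m -> 0 < B -> 0 < delta ->
  exists r0, 0 < r0 <= 1 /\ forall r n s, 0 < r <= r0 ->
  exp (- (INR n * r ^ 2)) <= r ^ 2 -> Rabs s <= B ->
  Rabs (saddle_integrand m r n s - exp (- ((1 - zre m 0) / 2) * s ^ 2) *
    cos (zim m 0 / 2 * s ^ 2 - saddle_phase m r n)) <= delta.
Proof.
intros hm hB hd; set (d := Rmin 1 (delta / 6)).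
assert (hd0 : 0 < d) by (apply Rmin_glb_lt; lra).
assert (hd1 : d <= 1) by apply Rmin_l.
assert (hd2 : d <= delta / 6) by apply Rmin_r.
destruct (zfac_prod_local m B d hm hB hd0) as [r0 [hr0 H]].
exists r0; split; [exact hr0|]; intros r n s hr hn hs.
destruct (H r n s hr hn hs) as [X [Y [E [HX HY]]]].
unfold saddle_integrand; rewrite E, cexp_plus; unfold cexp; simpl fst.
set (al := saddle_phase m r n).
set (d1 := X - (atan m * s / r + zre m 0 * s ^ 2 / 2)) in *.
set (d2 := Y - (logr m * s / r + zim m 0 * s ^ 2 / 2)) in *.
set (A := zim m 0 / 2 * s ^ 2 - al).
replace (- (al + logr m * s / r) + Y) with (A + d2) by (unfold A, d2; field; lra).
rewrite <- Rmult_assoc, <- exp_plus.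
replace (- (atan m * s / r) - s ^ 2 / 2 + (0 + X)) with
  (- ((1 - zre m 0) / 2) * s ^ 2 + d1) by (unfold d1; field; lra).
rewrite exp_plus; set (G := exp (- ((1 - zre m 0) / 2) * s ^ 2)).
replace (G * exp d1 * cos (A + d2) - G * cos A) with
  (G * (exp d1 * cos (A + d2) - cos A)) by ring.
rewrite Rabs_mult; apply Rle_trans with (1 * (6 * d)); [|lra].
apply Rmult_le_compat; try apply Rabs_pos.
- unfold G; rewrite Rabs_pos_eq by (apply Rlt_le, exp_pos).
  apply Rle_trans with (exp 0); [|rewrite exp_0; lra]; apply exp_mono; rewrite zre_0.
  assert (hk : 0 <= (1 - (1 - m ^ 2) / (1 + m ^ 2)) / 2).
  { replace ((1 - (1 - m ^ 2) / (1 + m ^ 2)) / 2) with (m ^ 2 / (1 + m ^ 2)) by (field; nra).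
    apply Rlt_le; pos. }
  set (k := (1 - (1 - m ^ 2) / (1 + m ^ 2)) / 2) in *; clearbody k.
  assert (0 <= k * s ^ 2) by (apply Rmult_le_pos; [exact hk | apply pow2_ge_0]); lra.
- apply cexp_re_perturb; assumption.
Qed.

(* The limiting Gaussian exp (- (1 - e^{2 i theta}) s^2 / 2) is a real Gaussian on a line
   rotated by (theta - pi / 2) / 2. *)
Lemma saddle_gaussian (m : R) : 0 < m -> exists C, 0 < C /\ forall al A T, 1 <= A -> 1 <= T ->
  Rabs (RInt (fun s => exp (- ((1 - zre m 0) / 2) * s ^ 2) *
      cos (zim m 0 / 2 * s ^ 2 - al)) (- A) T -
    sqrt (PI / sin (atan m)) * cos (PI / 4 - atan m / 2 - al)) <= C * (/ A + / T).
Proof.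
intros hm; assert (hth := atan_lt_id m hm); assert (hb := atan_bound m).
set (th := atan m) in *; set (psi := (th - PI / 2) / 2).
assert (hpsi : Rabs psi < PI / 4).
{ apply Rabs_lt_between; unfold psi; lra. }
assert (s0 : 0 < sin th) by (apply sin_gt_0; lra).
assert (c0 : 0 < cos th) by (apply cos_gt_0; lra).
assert (e1 : cos (2 * psi) = sin th).
{ unfold psi; replace (2 * ((th - PI / 2) / 2)) with (- (PI / 2 - th)) by field.
  rewrite cos_neg; apply cos_shift. }
assert (e2 : sin (2 * psi) = - cos th).
{ unfold psi; replace (2 * ((th - PI / 2) / 2)) with (- (PI / 2 - th)) by field.
  rewrite sin_neg, sin_shift; reflexivity. }
assert (m2 : 0 < 1 + m ^ 2) by nra.
assert (hq := sqrt_lt_R0 _ m2).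
assert (es : sin th = m / sqrt (1 + m ^ 2)).
{ unfold th; rewrite sin_atan; do 2 f_equal; unfold Rsqr; ring. }
assert (ec : cos th = 1 / sqrt (1 + m ^ 2)).
{ unfold th; rewrite cos_atan; do 2 f_equal; unfold Rsqr; ring. }
assert (hqq := sqrt_sqrt _ (Rlt_le _ _ m2)).
set (w := sqrt (1 + m ^ 2)) in *; clearbody w.
assert (ss : sin th * sin th = m ^ 2 / (1 + m ^ 2)).
{ rewrite es, <- hqq; field; lra. }
assert (sc : sin th * cos th = m / (1 + m ^ 2)).
{ rewrite es, ec, <- hqq; field; lra. }
(* 1 - e^(2 i theta) = 2 sin theta e^(2 i psi), and zeta at u = 0 is e^(2 i theta); hence the
   modulus 2 sin theta. *)
assert (f1 : 2 * sin th * cos (2 * psi) / 2 = (1 - zre m 0) / 2).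
{ rewrite e1, zre_0; replace (2 * sin th * sin th / 2) with (sin th * sin th) by field.
  rewrite ss; field; lra. }
assert (f2 : 2 * sin th * sin (2 * psi) / 2 = - (zim m 0 / 2)).
{ rewrite e2, zim_0; replace (2 * sin th * - cos th / 2) with (- (sin th * cos th)) by field.
  rewrite sc; field; lra. }
exists (2 / (2 * sin th * cos (2 * psi)) + 8 / (2 * sin th) / sqrt (2 * sin th / 2)).
split.
{ assert (0 < sqrt (2 * sin th / 2)) by (apply sqrt_lt_R0; lra).
  rewrite e1; pos. }
intros al A T hA hT.
assert (G := gauss_integral_rotated (2 * sin th) psi (PI / 4 - th / 2 - al) A T
  ltac:(lra) hpsi hA hT).
rewrite f1, f2 in G.
replace (2 * PI / (2 * sin th)) with (PI / sin th) in G by (field; lra).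
rewrite (RInt_ext _ (fun s => exp (- ((1 - zre m 0) / 2) * s ^ 2) *
  cos (PI / 4 - th / 2 - al + psi - - (zim m 0 / 2) * s ^ 2))).
- exact G.
- intros s _; do 2 f_equal; unfold psi; toR; field.
Qed.

Lemma trunc_airy_saddle (m eta : R) : 0 < m -> 0 < eta ->
  exists r0, 0 < r0 <= 1 /\ forall r n, 0 < r <= r0 -> exp (- (INR n * r ^ 2)) <= r ^ 2 ->
  Rabs (sqrt (2 * PI) / 2 * exp (- (logr m ^ 2 / (2 * r ^ 2))) *
      trunc_airy (exp (- r ^ 2)) (logr m) (r ^ 2) n -
    exp (- (atan m ^ 2 / (2 * r ^ 2)) + log_modulus m r n) *
      (sqrt (PI / sin (atan m)) * cos (PI / 4 - atan m / 2 - saddle_phase m r n))) <=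
  exp (- (atan m ^ 2 / (2 * r ^ 2)) + log_modulus m r n) * eta.
Proof.
intros hm he; assert (hth := atan_lt_id m hm).
destruct (saddle_integrand_bound m hm) as [K0 [c0 [hK0 [hc0 HB]]]].
destruct (saddle_gaussian m hm) as [C [hC HG]].
set (p := (1 - zre m 0) / 2).
assert (hp : 0 < p).
{ unfold p; rewrite zre_0; replace ((1 - (1 - m ^ 2) / (1 + m ^ 2)) / 2) with
    (m ^ 2 / (1 + m ^ 2)) by (field; nra).
  apply Rdiv_lt_0_compat; nra. }
set (K := K0 + 1); set (c := Rmin c0 p).
assert (hc : 0 < c) by (apply Rmin_glb_lt; lra).
assert (c1 : c <= c0) by apply Rmin_l; assert (c2 : c <= p) by apply Rmin_r.
destruct (exists_gauss_small (2 * K) c (eta / 4)) as [B [B1 hB]]; try (unfold K; lra).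
destruct (saddle_integrand_local m B (eta / (8 * B)) hm) as [r1 [hr1 HL]]; [lra | pos |].
set (th := atan m) in *.
(* With A = th / r, the second bound gives B <= A and the third makes the part of the limiting
   Gaussian below - A at most eta / 4. *)
set (r0 := Rmin r1 (Rmin (th / B) (th * (eta / (4 * C))))).
assert (q1 : r0 <= r1) by apply Rmin_l.
assert (q2 : r0 <= th / B) by (apply Rle_trans with (1 := Rmin_r _ _), Rmin_l).
assert (q3 : r0 <= th * (eta / (4 * C))) by (apply Rle_trans with (1 := Rmin_r _ _), Rmin_r).
exists r0; split; [split; [repeat apply Rmin_glb_lt; pos | lra]|]; intros r n hr hn.
set (A := th / r).
assert (hAB : B <= A).
{ unfold A; apply Rmult_le_reg_r with (r / B); [pos|].
  replace (B * (r / B)) with r by (field; lra).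
  replace (th / r * (r / B)) with (th / B) by (field; lra); lra. }
assert (hA : C * / A <= eta / 4).
{ unfold A; replace (C * / (th / r)) with (C * / th * r) by (field; lra).
  replace (eta / 4) with (C * / th * (th * (eta / (4 * C)))) by (field; lra).
  apply Rmult_le_compat_l; [apply Rlt_le; pos | lra]. }
set (E := exp (- (th ^ 2 / (2 * r ^ 2)) + log_modulus m r n)).
assert (hE : 0 < E) by apply exp_pos.
set (al := saddle_phase m r n).
assert (L := trunc_airy_integral (logr m) r n ltac:(lra)).
apply (is_lim_le_bound _ _ _ _ (A + (B + 4 * C / eta)) L); intros T hT.
assert (T1 : B <= T - A) by (assert (0 < 4 * C / eta) by pos; lra).
assert (T2 : C * / (T - A) <= eta / 4).
{ apply Rmult_le_reg_r with ((T - A) * (4 / eta)); [pos|].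
  replace (C * / (T - A) * ((T - A) * (4 / eta))) with (4 * C / eta) by (field; lra).
  replace (eta / 4 * ((T - A) * (4 / eta))) with (T - A) by (field; lra); lra. }
set (F := fun s => exp (- s ^ 2 / 2) *
  trunc_fourier (exp (- r ^ 2)) (logr m) (logr m / r ^ 2) (r * s) n).
assert (CF : forall s, continuous F s).
{ intros s; apply (continuous_mult (K := R_AbsRing)); [contd; trivial|].
  apply (continuous_comp (fun s => r * s)
    (fun t => trunc_fourier (exp (- r ^ 2)) (logr m) (logr m / r ^ 2) t n)).
  - contd; trivial.
  - apply trunc_fourier_continuous. }
assert (S := RInt_substitution F 1 A (- A) (T - A) ltac:(apply ex_RInt_everywhere; exact CF)).
replace (1 * - A + A) with 0 in S by ring; replace (1 * (T - A) + A) with T in S by ring.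
rewrite S, Rmult_1_l, (RInt_ext _ (fun s => E * saddle_integrand m r n s)).
2:{ intros s _; unfold F, E, A, th; rewrite <- fourier_recentre by lra.
    replace (1 * s + atan m / r) with (atan m / r + s) by ring; reflexivity. }
rewrite RInt_scal_R by (apply ex_RInt_everywhere; intros;
  apply saddle_integrand_continuous; lra).
rewrite <- Rmult_minus_distr_l, Rabs_mult, (Rabs_pos_eq E) by lra.
apply Rmult_le_compat_l; [lra|].
set (g := fun s => exp (- p * s ^ 2) * cos (zim m 0 / 2 * s ^ 2 - al)).
assert (LC := laplace_compare (saddle_integrand m r n) g K c (eta / (8 * B)) B A (T - A)
  ltac:(unfold K; lra) hc ltac:(lra) T1).
specialize (LC ltac:(intros; apply saddle_integrand_continuous; lra)
  ltac:(intros; unfold g; contd; trivial)).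
assert (exp_c : forall c' s, c <= c' -> exp (- c' * s ^ 2) <= exp (- c * s ^ 2)).
{ intros c' s h; apply exp_mono; generalize (pow2_ge_0 s); nra. }
assert (LC' : Rabs (RInt (saddle_integrand m r n) (- A) (T - A) - RInt g (- A) (T - A)) <=
  2 * B * (eta / (8 * B)) + 2 * K / (c * B) * exp (- c * B ^ 2)).
{ apply LC.
  - intros s hs; apply Rle_trans with (1 := HB r n s ltac:(lra) hn ltac:(unfold A in hs; lra)).
    apply Rmult_le_compat; [lra | apply Rlt_le, exp_pos | unfold K; lra | apply exp_c, c1].
  - intros s _; unfold g; rewrite Rabs_mult, Rabs_pos_eq, Rmult_comm
      by (apply Rlt_le, exp_pos).
    apply Rmult_le_compat; [apply Rabs_pos | apply Rlt_le, exp_pos | | apply exp_c, c2].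
    apply Rle_trans with 1; [apply Rabs_le, COS_bound | unfold K; lra].
  - intros s hs; apply (HL r n s); [lra | exact hn | apply Rabs_le; lra]. }
assert (G := HG al A (T - A) ltac:(lra) ltac:(lra)); fold p in G.
change (Rabs (RInt g (- A) (T - A) - sqrt (PI / sin th) * cos (PI / 4 - th / 2 - al)) <=
  C * (/ A + / (T - A))) in G.
set (I := RInt (saddle_integrand m r n) (- A) (T - A)) in *.
set (J := RInt g (- A) (T - A)) in *.
replace (I - _) with ((I - J) + (J - sqrt (PI / sin th) * cos (PI / 4 - th / 2 - al))) by ring.
apply Rle_trans with (1 := Rabs_triang _ _).
replace (2 * B * (eta / (8 * B))) with (eta / 4) in LC' by (field; lra).
lra.
Qed.

(** For m = sqrt (4x-1) and e = log (1/q), the amplitude common to both sides of the theorem. *)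
Definition envelope (m e : R) : R :=
  2 / sqrt m * exp (logr m ^ 2 / e - PI ^ 2 / (12 * e)).

(** The factors come from the half-line Gaussian, the saddle, and the half end term of the trapezoid
    rule; they combine through sqrt x sin theta = m / 2. *)
Lemma saddle_constant (m : R) : 0 < m ->
  2 / sqrt (2 * PI) * sqrt (PI / sin (atan m)) * exp (- (logr m / 2)) = 2 / sqrt m.
Proof.
intros hm; assert (hp := PI_RGT_0).
assert (hth := atan_lt_id m hm); assert (hb := atan_bound m).
assert (s0 : 0 < sin (atan m)) by (apply sin_gt_0; lra).
destruct (exp_logr_cos m) as [_ es].
assert (e0 := exp_pos (logr m)).
assert (E : exp (- (logr m / 2)) = / sqrt (exp (logr m))).
{ rewrite exp_Ropp; f_equal.
  rewrite <- (sqrt_square (exp (logr m / 2))) by (apply Rlt_le, exp_pos).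
  rewrite <- exp_plus; do 2 f_equal; field. }
rewrite E, sqrt_div_alt, sqrt_mult by lra.
replace m with (2 * (exp (logr m) * sin (atan m))) at 3 by lra.
rewrite !sqrt_mult by (try apply Rmult_le_pos; lra).
field; repeat split; apply Rgt_not_eq, sqrt_lt_R0; lra.
Qed.

Lemma trunc_airy_asymptotic (m delta : R) : 0 < m -> 0 < delta ->
  exists r0, 0 < r0 <= 1 /\ forall r n, 0 < r <= r0 -> (0 < n)%nat ->
  exp (- (INR n * r ^ 2)) <= (r ^ 2) ^ 2 ->
  Rabs (trunc_airy (exp (- r ^ 2)) (logr m) (r ^ 2) n -
    envelope m (r ^ 2) * cos (PI / 4 - airy_angle m / r ^ 2)) <=
  envelope m (r ^ 2) * delta.
Proof.
intros hm hd; assert (hp := PI_RGT_0).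
assert (hth := atan_lt_id m hm); assert (hb := atan_bound m).
assert (s0 : 0 < sin (atan m)) by (apply sin_gt_0; lra).
assert (SC := saddle_constant m hm).
set (v := sqrt (PI / sin (atan m))) in *.
assert (hv : 0 < v) by (apply sqrt_lt_R0; pos).
destruct (log_sums m hm) as [C [hC HL]].
destruct (trunc_airy_saddle m (delta * v / 6) hm ltac:(pos)) as [r1 [hr1 HS]].
set (r0 := Rmin r1 (Rmin 1 (delta / 12) / (C + 1))).
assert (k0 : 0 < Rmin 1 (delta / 12)) by (apply Rmin_glb_lt; lra).
assert (q1 : r0 <= r1) by apply Rmin_l.
assert (q2 : r0 <= Rmin 1 (delta / 12) / (C + 1)) by apply Rmin_r.
exists r0; split; [split; [apply Rmin_glb_lt; pos | lra]|]; intros r n hr hn0 hn.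
set (e := r ^ 2) in *; assert (hr1' : 0 < r <= 1) by lra.
assert (he : 0 < e <= 1) by (unfold e; split; [pos | nra]).
assert (hCe : C * e <= Rmin 1 (delta / 12)).
{ apply Rle_trans with ((C + 1) * r).
  - assert (er : e <= r) by (unfold e; nra).
    assert (C * e <= C * r) by (apply Rmult_le_compat_l; lra); lra.
  - apply Rle_trans with ((C + 1) * (Rmin 1 (delta / 12) / (C + 1))).
    + apply Rmult_le_compat_l; lra.
    + right; field; lra. }
assert (hC1 : C * e <= 1) by (apply Rle_trans with (1 := hCe), Rmin_l).
assert (hC2 : C * e <= delta / 12) by (apply Rle_trans with (1 := hCe), Rmin_r).
assert (hne : 0 < INR n * e) by (apply Rmult_lt_0_compat; [apply lt_0_INR, hn0 | lra]).
destruct (HL e n he hne hn) as [L1 L2].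
assert (S := HS r n ltac:(lra) ltac:(fold e; apply Rle_trans with (1 := hn); nra)).
fold e in S; unfold saddle_phase, log_modulus in S; fold e in S.
set (Lam := psum (fun k => lmod m (INR k * e + e)) n) in *.
set (Phi := psum (fun k => phase m (INR k * e + e)) n) in *.
set (lam := Lam - ((logr m ^ 2 + atan m ^ 2) / 2 - PI ^ 2 / 12) / e + logr m / 2) in *.
set (phi := Phi - (airy_angle m - logr m * atan m) / e + atan m / 2) in *.
set (A0 := PI / 4 - airy_angle m / e).
(* The theta / 2 of the rotated Gaussian cancels the half end term of the trapezoid rule, and the
   products (log x) theta / (2e) cancel as well; only [airy_angle] remains. *)
replace (PI / 4 - atan m / 2 - (logr m * atan m / e + Phi)) with (A0 + - phi) in S
  by (unfold A0, phi; field; lra).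
set (w := sqrt (2 * PI)) in *; assert (hw : 0 < w) by (apply sqrt_lt_R0; lra).
set (An := trunc_airy _ _ _ n) in *.
set (P := 2 / w * exp (logr m ^ 2 / (2 * e))).
assert (hP : 0 < P) by (unfold P; pos).
set (E := exp (- (atan m ^ 2 / (2 * e)) + Lam)) in *.
assert (hE : 0 < E) by apply exp_pos.
(* The term - theta^2 / (2e) cancels its counterpart in the dilogarithm, while
   [logr m ^ 2 / (2 * e)] occurs twice, once in [P] and once in [Lam]. *)
assert (EP : P * E * v = envelope m e * exp lam).
{ unfold P, E, envelope; rewrite <- SC.
  replace (- (atan m ^ 2 / (2 * e)) + Lam) with
    ((logr m ^ 2 / (2 * e) - PI ^ 2 / (12 * e)) + (- (logr m / 2) + lam))
    by (unfold lam; field; lra).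
  replace (logr m ^ 2 / e - PI ^ 2 / (12 * e)) with
    (logr m ^ 2 / (2 * e) + (logr m ^ 2 / (2 * e) - PI ^ 2 / (12 * e))) by (field; lra).
  rewrite (exp_plus (logr m ^ 2 / (2 * e))), (exp_plus (_ - _)), (exp_plus (- (logr m / 2))).
  ring. }
set (D := envelope m e) in *.
assert (hD : 0 < D).
{ unfold D, envelope; assert (0 < sqrt m) by (apply sqrt_lt_R0, hm); pos. }
assert (EA : P * (w / 2 * exp (- (logr m ^ 2 / (2 * e))) * An) = An).
{ unfold P; rewrite exp_Ropp; field; split; [apply Rgt_not_eq, exp_pos | lra]. }
assert (hl : exp lam <= 3).
{ apply Rle_trans with (2 := exp_le_3), exp_mono.
  apply Rabs_le_between in L1; lra. }
rewrite <- EA.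
replace (P * _ - D * cos A0) with
  (P * (w / 2 * exp (- (logr m ^ 2 / (2 * e))) * An - E * (v * cos (A0 + - phi))) +
   D * (exp lam * cos (A0 + - phi) - cos A0)).
2:{ rewrite !Rmult_minus_distr_l.
    replace (P * (E * (v * cos (A0 + - phi)))) with (P * E * v * cos (A0 + - phi)) by ring.
    rewrite EP; ring. }
apply Rle_trans with (1 := Rabs_triang _ _).
rewrite !Rabs_mult, (Rabs_pos_eq P), (Rabs_pos_eq D) by lra.
assert (T1 : P * Rabs (w / 2 * exp (- (logr m ^ 2 / (2 * e))) * An -
  E * (v * cos (A0 + - phi))) <= D * (delta / 2)).
{ apply Rle_trans with (P * (E * (delta * v / 6))).
  - apply Rmult_le_compat_l; [lra | exact S].
  - replace (P * (E * (delta * v / 6))) with (P * E * v * (delta / 6)) by field.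
    rewrite EP; replace (D * (delta / 2)) with (D * 3 * (delta / 6)) by field.
    apply Rmult_le_compat_r; [lra|]; apply Rmult_le_compat_l; lra. }
assert (T2 : Rabs (exp lam * cos (A0 + - phi) - cos A0) <= delta / 2).
{ apply Rle_trans with (6 * (C * e)); [|lra].
  apply cexp_re_perturb; [lra | exact L1 | rewrite Rabs_Ropp; exact L2]. }
assert (T3 := Rmult_le_compat_l D _ _ (Rlt_le _ _ hD) T2).
lra.
Qed.

Lemma qAiry_asymptotic (m delta : R) : 0 < m -> 0 < delta ->
  exists e0, 0 < e0 /\ forall e, 0 < e <= e0 ->
  Rabs (qAiry (exp (- e)) (sqrt (exp (- e)) * exp (2 * logr m)) -
    envelope m e * cos (PI / 4 - airy_angle m / e)) <= envelope m e * delta.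
Proof.
intros hm hd; destruct (trunc_airy_asymptotic m delta hm hd) as [r0 [hr0 H]].
exists (r0 ^ 2); split; [pos|]; intros e he.
set (r := sqrt e); assert (hr : 0 < r) by (apply sqrt_lt_R0; lra).
assert (r2 : r ^ 2 = e) by (unfold r; apply pow2_sqrt; lra).
assert (hr' : r <= r0).
{ unfold r; rewrite <- (sqrt_pow2 r0) by lra; apply sqrt_le_1_alt; lra. }
assert (L := trunc_airy_lim (logr m) e ltac:(lra)).
set (k := envelope m e * cos (PI / 4 - airy_angle m / e)).
(* From n >= 1/e^3 follows n e >= 1/e^2, and exp (- z) <= 1/z then gives the required exp (- n e) <=
   e^2. *)
destruct (nfloor_ex (/ e ^ 3)) as [N [_ hN]].
{ apply Rlt_le; pos. }
apply (is_lim_seq_le_loc (fun n => Rabs (trunc_airy (exp (- e)) (logr m) e n - k))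
  (fun _ => envelope m e * delta) (Rabs (qAiry (exp (- e)) (sqrt (exp (- e)) *
    exp (2 * logr m)) - k)) (envelope m e * delta)).
- exists (S N); intros n hn.
  assert (hn' : / e ^ 3 <= INR n).
  { apply Rle_trans with (INR (S N)); [rewrite S_INR; lra | apply le_INR, hn]. }
  unfold k; rewrite <- r2; apply H; [lra | lia |].
  rewrite r2.
  assert (hz : / e ^ 2 <= INR n * e).
  { replace (/ e ^ 2) with (/ e ^ 3 * e) by (field; lra).
    apply Rmult_le_compat_r; lra. }
  assert (e2 : 0 < / e ^ 2) by pos.
  apply Rle_trans with (1 := exp_inv_le (INR n * e) ltac:(lra)).
  rewrite <- (Rinv_inv (e ^ 2)); apply Rinv_le_contravar; lra.
- apply (is_lim_seq_abs _ (qAiry (exp (- e)) (sqrt (exp (- e)) * exp (2 * logr m)) - k)).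
  apply is_lim_seq_minus'; [exact L | apply is_lim_seq_const].
- apply is_lim_seq_const.
Qed.

(** * Matching the two oscillating asymptotics *)

Lemma Rpower_pow_root (a : R) (n : nat) (b : R) : 0 < a -> INR n * b = 1 ->
  Rpower (a ^ n) b = a.
Proof.
intros ha hb; rewrite <- Rpower_pow, Rpower_mult, hb by exact ha; apply Rpower_1, ha.
Qed.

(** With xi = mu^4 the fourth roots become (xi / m^2)^(1/4) = mu / sqrt m and [Ai_env xi] = 1 /
    (sqrt PI mu). *)
Lemma envelope_spec (m xi e mu : R) : 0 < m -> 0 < e -> 0 < mu -> xi = mu ^ 4 ->
  let c := 2 * sqrt PI * exp ((3 * (2 * logr m) ^ 2 - PI ^ 2) / (12 * e)) *
    Rpower (xi / m ^ 2) (1 / 4) in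
  c = sqrt PI * mu * envelope m e /\ c * Ai_env xi = envelope m e.
Proof.
intros hm he hmu -> c.
assert (hs : 0 < sqrt m) by (apply sqrt_lt_R0, hm).
assert (hpi : 0 < sqrt PI) by (apply sqrt_lt_R0, PI_RGT_0).
assert (E : c = sqrt PI * mu * envelope m e).
{ unfold c, envelope.
  replace (mu ^ 4 / m ^ 2) with ((mu / sqrt m) ^ 4).
  2:{ rewrite <- (sqrt_sqrt m) at 2 by lra; field; lra. }
  rewrite Rpower_pow_root by (pos || (simpl; field)).
  replace ((3 * (2 * logr m) ^ 2 - PI ^ 2) / (12 * e)) with
    (logr m ^ 2 / e - PI ^ 2 / (12 * e)) by (field; lra).
  field; lra. }
split; [exact E|]; rewrite E; unfold Ai_env.
rewrite Rpower_Ropp, Rpower_pow_root by (lra || (simpl; field)).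
field; lra.
Qed.

Theorem theorem2 (xi : R -> R -> R) (Hxi : is_xi xi) (x : R) (Hx : 1 / 4 < x) :
  let C := fun q : R =>
    2 * sqrt PI
    * exp ((3 * (ln x) ^ 2 - PI ^ 2) / (12 * ln (1 / q)))
    * Rpower (xi q x / (4 * x - 1)) (1 / 4) in
  is_equiv_env (at_left 1)
    (fun q => C q * Ai_env (xi q x))
    (fun q => qAiry q (sqrt q * x))
    (fun q => C q * Ai (- xi q x)).
Proof.
intros C [delta hd]; unfold norm; simpl; unfold abs, minus, plus, opp; simpl.
set (m := sqrt (4 * x - 1)).
assert (hm : 0 < m) by (apply sqrt_lt_R0; lra).
assert (m2 : m ^ 2 = 4 * x - 1) by (unfold m; apply pow2_sqrt; lra).
assert (hlog : 2 * logr m = ln x).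
{ unfold logr; rewrite m2; replace ((1 + (4 * x - 1)) / 4) with x by field; field. }
assert (hang : airy_angle m = RInt (fun s => atan (sqrt (exp s - 1))) 0 (ln (4 * x))).
{ unfold airy_angle; rewrite m2; do 2 f_equal; ring. }
assert (hlq : forall q, 0 < q < 1 -> 0 < ln (1 / q)).
{ intros q hq; rewrite <- ln_1; apply ln_increasing; [lra|].
  apply Rmult_lt_reg_r with q; [lra|]; unfold Rdiv.
  rewrite !Rmult_1_l, Rinv_l; lra. }
assert (hP0 : 0 < airy_angle m).
(* The integral does not involve q, so the defining equation of [xi] at the single value q = 1/2
   shows that it is positive. *)
{ destruct (Hxi (1 / 2) x ltac:(lra) Hx) as [_ h]; rewrite <- hang in h.
  assert (l2 := hlq (1 / 2) ltac:(lra)).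
  assert (r2 : 0 < Rpower (xi (1 / 2) x) (3 / 2)) by apply exp_pos.
  apply Rmult_lt_reg_l with (1 / ln (1 / (1 / 2))); [pos | lra]. }
destruct (qAiry_asymptotic m (delta / 2) hm ltac:(lra)) as [e0 [he0 HQ]].
assert (hsp : 0 < sqrt PI) by (apply sqrt_lt_R0, PI_RGT_0).
destruct (Ai_asymptotic (delta / (2 * sqrt PI))) as [M [hM HA]]; [pos|].
(* As mu^6 = xi^(3/2) = (3/2) [airy_angle m] / e, the second bound forces mu >= M. *)
set (e1 := Rmin e0 (3 / 2 * airy_angle m / M ^ 6)).
assert (he1 : 0 < e1) by (apply Rmin_glb_lt; pos).
assert (e10 : e1 <= e0) by apply Rmin_l.
assert (e1M : e1 <= 3 / 2 * airy_angle m / M ^ 6) by apply Rmin_r.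
assert (d1 : 0 < 1 - exp (- e1)).
{ assert (exp (- e1) < exp 0) by (apply exp_increasing; lra); rewrite exp_0 in *; lra. }
(* For q < 1, being within 1 - exp (- e1) of 1 means log (1/q) < e1. *)
exists (mkposreal _ d1); intros q hq hq1.
unfold ball in hq; simpl in hq; unfold AbsRing_ball, abs, minus, plus, opp in hq; simpl in hq.
apply Rabs_lt_between in hq.
assert (q0 : exp (- e1) < q) by lra.
assert (q01 : 0 < q < 1) by (generalize (exp_pos (- e1)); lra).
set (e := ln (1 / q)).
assert (eln : e = - ln q) by (unfold e; unfold Rdiv; rewrite Rmult_1_l; apply ln_Rinv; lra).
assert (qe : q = exp (- e)) by (rewrite eln, Ropp_involutive, exp_ln; lra).
assert (he : 0 < e) by (apply hlq, q01).
assert (hee : e <= e1).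
{ rewrite qe in q0; apply exp_lt_inv in q0; lra. }
destruct (Hxi q x q01 Hx) as [xi0 hxi]; rewrite <- hang in hxi; fold e in hxi.
set (mu := Rpower (xi q x) (1 / 4)).
assert (hmu : 0 < mu) by apply exp_pos.
assert (mu4 : xi q x = mu ^ 4).
{ unfold mu; rewrite <- Rpower_pow, Rpower_mult by exact hmu.
  replace (1 / 4 * INR 4) with 1 by (simpl; field); symmetry; apply Rpower_1, xi0. }
assert (mu6 : mu ^ 6 = 3 / 2 * (airy_angle m / e)).
{ unfold mu; rewrite <- Rpower_pow, Rpower_mult by exact hmu.
  replace (1 / 4 * INR 6) with (3 / 2) by (simpl; field).
  replace (airy_angle m / e) with (1 / e * airy_angle m) by (field; lra); lra. }
assert (hMmu : M <= mu).
{ apply Rnot_lt_le; intros hlt.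
  assert (h6 : mu ^ 6 < M ^ 6).
  { assert (s1 : mu ^ 2 < M ^ 2) by nra.
    assert (mu20 : 0 < mu ^ 2) by pos.
    assert (s2 : mu ^ 4 < M ^ 4) by nra.
    assert (mu40 : 0 < mu ^ 4) by pos; nra. }
  assert (h : M ^ 6 <= 3 / 2 * airy_angle m / e).
  { apply Rmult_le_reg_r with (e / M ^ 6); [pos|].
    replace (M ^ 6 * (e / M ^ 6)) with e by (field; lra).
    replace (3 / 2 * airy_angle m / e * (e / M ^ 6)) with (3 / 2 * airy_angle m / M ^ 6)
      by (field; lra); lra. }
  replace (3 / 2 * (airy_angle m / e)) with (3 / 2 * airy_angle m / e) in mu6
    by (field; lra).
  lra. }
destruct (envelope_spec m (xi q x) e mu hm he hmu mu4) as [c1 c2].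
rewrite hlog, m2 in c1, c2.
fold e in c1, c2.
change (C q = sqrt PI * mu * envelope m e) in c1.
change (C q * Ai_env (xi q x) = envelope m e) in c2.
assert (D0 : 0 < envelope m e).
{ unfold envelope; assert (0 < sqrt m) by (apply sqrt_lt_R0, hm); pos. }
rewrite c2, (Rabs_pos_eq (envelope m e)) by lra.
assert (Q := HQ e ltac:(lra)); rewrite <- qe, hlog, exp_ln in Q by lra.
assert (AI := HA mu hMmu).
set (T := cos (PI / 4 - airy_angle m / e)) in *.
(* Here the two phases meet: (2/3) mu^6 is exactly [airy_angle m] / e, and (cos + sin) / sqrt 2 is a
   cosine shifted by PI / 4. *)
assert (trig : sqrt PI * mu * (/ (PI * mu) * (sqrt (PI / 2) *
   (cos (- (2 / 3 * mu ^ 6)) - sin (- (2 / 3 * mu ^ 6))))) = T).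
{ rewrite mu6; replace (2 / 3 * (3 / 2 * (airy_angle m / e))) with (airy_angle m / e) by (field; lra).
  unfold T; rewrite cos_minus, cos_PI4, sin_PI4, cos_neg, sin_neg.
  rewrite sqrt_div_alt by lra.
  assert (h2 : 0 < sqrt 2) by (apply sqrt_lt_R0; lra).
  rewrite <- (sqrt_sqrt PI) at 2 by (generalize PI_RGT_0; lra).
  field; lra. }
rewrite mu4, c1.
replace (sqrt PI * mu * envelope m e * Ai (- mu ^ 4) + - qAiry q (sqrt q * x)) with
  (envelope m e * (sqrt PI * mu * (Ai (- mu ^ 4) - / (PI * mu) * (sqrt (PI / 2) *
   (cos (- (2 / 3 * mu ^ 6)) - sin (- (2 / 3 * mu ^ 6))))) ) -
   (qAiry q (sqrt q * x) - envelope m e * T)) by (rewrite <- trig; ring).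
apply Rle_trans with (1 := Rabs_triang _ _); rewrite Rabs_Ropp, !Rabs_mult.
rewrite (Rabs_pos_eq (envelope m e)), (Rabs_pos_eq (sqrt PI)), (Rabs_pos_eq mu) by lra.
assert (A2 : envelope m e * (sqrt PI * mu * Rabs (Ai (- mu ^ 4) - / (PI * mu) *
   (sqrt (PI / 2) * (cos (- (2 / 3 * mu ^ 6)) - sin (- (2 / 3 * mu ^ 6)))))) <=
   envelope m e * (delta / 2)).
{ apply Rmult_le_compat_l; [lra|].
  apply Rle_trans with (sqrt PI * mu * (delta / (2 * sqrt PI) / mu)).
  - apply Rmult_le_compat_l; [apply Rlt_le; pos | exact AI].
  - right; field; lra. }
lra.
Qed.
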